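(* Let $\Gamma\subset\operatorname{SL}(2,\mathbb R)$ be a cocompact lattice, let $h_t$ be the horocycle flow on $\operatorname{SL}(2,\mathbb R)/\Gamma$, let $\tau\in C^1(\operatorname{SL}(2,\mathbb R)/\Gamma)$ with $\tau>0$, and let $h_t^\tau$ be the time change of $h_t$ given by $\tau$. Then $h_t^\tau$ has the strong R-property.
   Context: The horocycle flow is $h_t(x\Gamma)=\exp\left(t\begin{pmatrix}0&1\\0&0\end{pmatrix}\right)x\Gamma$, preserving the normalized Haar measure $\mu$; $\operatorname{SL}(2,\mathbb R)/\Gamma$ carries the metric $d$ induced by a right invariant metric on $\operatorname{SL}(2,\mathbb R)$. The time change is $h_t^\tau(x)=h_{\alpha(x,t)}(x)$, where $\alpha(x,t)$ is defined by $\int_0^{\alpha(x,t)}\tau(h_sx)\,ds=t$; it preserves the probability measure $d\mu^\tau=\frac{\tau}{\int\tau\,d\mu}\,d\mu$. **Strong R-property.** Let $\lambda$ be Lebesgue measure on $\mathbb R$, let $T_t$ be an ergodic flow on a probability metric space $(X,\mathcal B,\mu,d)$ and $p>0$. $T_t$ has the strong $R(p)$-property if for every $\epsilon>0$ and every $N\in\mathbb N$ there exist $\kappa=\kappa(\epsilon)\in(0,\epsilon)$ (depending only on $\epsilon$), $Z\in\mathcal B$ with $\mu(Z)\ge1-\epsilon$, and $\delta>0$ such that for every $x,x'\in Z$ with $d(x,x')<\delta$ and $x$ not in the orbit of $x'$ there exists $M_1\in\mathbb N$, $M_1\ge N$, such that: for every $L\in[\kappa^{-2},M_1]$ there exists $p_L\in[-p,p]$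 with $$\lambda\left(\{t\in[L,L+\kappa L]: d(T_tx,T_{t+p_L}x')<\epsilon\}\right)\ge(1-\epsilon)\kappa L,$$ and moreover $|p_{M_1}|\ge p/2$. $T_t$ has the strong R-property if it has the strong $R(p)$-property for some $p>0$. *)

(* Defs.v *)
From HB Require Import structures.
From mathcomp Require Import all_boot all_order all_algebra.
From mathcomp Require Import all_classical all_reals all_analysis.

Set Implicit Arguments.
Unset Strict Implicit.
Unset Printing Implicit Defensive.

Import Order.TTheory GRing.Theory Num.Theory.
Import numFieldNormedType.Exports.

Local Open Scope classical_set_scope.
Local Open Scope quotient_scope.
Local Open Scope ring_scope.

Section SpecialLinearGroup.
Context {R : realType}.

(* As the coercion of a set of matrices to a type, SL2 carries the subspace
   topology of the space of real 2 x 2 matrices *)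
Definition SL2 : Type := [set A : 'M[R]_2 | \det A = 1].

HB.instance Definition _ :=
  SubType.copy SL2 (set_type [set A : 'M[R]_2 | \det A = 1]).
HB.instance Definition _ :=
  Choice.copy SL2 (set_type [set A : 'M[R]_2 | \det A = 1]).
HB.instance Definition _ :=
  Topological.copy SL2 (set_type [set A : 'M[R]_2 | \det A = 1]).

Definition mkSL2 (A : 'M[R]_2) (detA : \det A = 1) : SL2 :=
  exist _ A (mem_set detA).

Lemma det_SL2 (g : SL2) : \det (val g) = 1.
Proof. by case: g => A /= /set_mem. Qed.

Lemma SL2_unit (g : SL2) : val g \in unitmx.
Proof. by rewrite unitmxE det_SL2 unitr1. Qed.

Definition one_SL2 : SL2 := mkSL2 (det1 R 2).

Fact mul_SL2_subproof (g h : SL2) : \det (val g *m val h) = 1.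
Proof. by rewrite det_mulmx !det_SL2 mulr1. Qed.
Definition mul_SL2 (g h : SL2) : SL2 := mkSL2 (mul_SL2_subproof g h).

Fact inv_SL2_subproof (g : SL2) : \det (invmx (val g)) = 1.
Proof. by rewrite det_inv det_SL2 invr1. Qed.
Definition inv_SL2 (g : SL2) : SL2 := mkSL2 (inv_SL2_subproof g).

Fact mul_SL2A : associative mul_SL2.
Proof. by move=> f g h; apply: val_inj; rewrite /= mulmxA. Qed.
Fact mul1_SL2 : left_id one_SL2 mul_SL2.
Proof. by move=> g; apply: val_inj; rewrite /= mul1mx. Qed.
Fact mul_SL21 : right_id one_SL2 mul_SL2.
Proof. by move=> g; apply: val_inj; rewrite /= mulmx1. Qed.
Fact mulV_SL2 : left_inverse one_SL2 inv_SL2 mul_SL2.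
Proof. by move=> g; apply: val_inj; rewrite /= mulVmx ?SL2_unit. Qed.
Fact mul_SL2V : right_inverse one_SL2 inv_SL2 mul_SL2.
Proof. by move=> g; apply: val_inj; rewrite /= mulmxV ?SL2_unit. Qed.

HB.instance Definition _ :=
  isGroup.Build SL2 mul_SL2A mul1_SL2 mul_SL21 mulV_SL2 mul_SL2V.
HB.instance Definition _ := isPointed.Build SL2 1%g.

End SpecialLinearGroup.
Arguments SL2 R : clear implicits.

Section Horocycle.
Context {R : realType}.

Definition expmx (A : 'M[R]_2) : 'M[R]_2 :=
  lim (series (fun k => k`!%:R^-1 *: A ^+ k) @ \oo).

Definition horo_gen : 'M[R]_2 :=
  \matrix_(i, j) if (i == 0) && (j == 1) then 1 else 0.

Lemma expmx_horo (t : R) : expmx (t *: horo_gen) = 1 + t *: horo_gen.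
Proof.
have sq0 : horo_gen ^+ 2 = 0 :> 'M[R]_2.
  apply/matrixP => i j; rewrite expr2 !mxE big1 // => k _; rewrite !mxE.
  case: (eqVneq k 0) => [->|k0] /=; last by rewrite mulr0.
  by rewrite andbF mul0r.
rewrite /expmx; apply: cvg_lim; first exact: norm_hausdorff.
apply: cvg_near_cst; exists 2%N => // n /= n2.
rewrite /series /= -(subnKC n2) /index_iota subn0 iotaD big_cat /=.
rewrite !big_cons big_nil /= expr0 expr1 !invr1 !scale1r addr0.
rewrite big1_seq ?addr0// => k /andP[_]; rewrite mem_iota => /andP[k2 _].
by rewrite exprZn -[X in horo_gen ^+ X](subnKC k2) exprD sq0 mul0r !scaler0.
Qed.

Lemma det_expmx_horo (t : R) : \det (expmx (t *: horo_gen)) = 1.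
Proof.
rewrite expmx_horo (expand_det_row _ 0) !big_ord_recl big_ord0.
by rewrite /cofactor !det_mx11 !mxE /= !(mulr0, mulr1, addr0, mul0r, expr0).
Qed.

Definition horo (t : R) : SL2 R := mkSL2 (det_expmx_horo t).

End Horocycle.

Section HomogeneousSpace.
Context {R : realType}.
Implicit Type Gam : set (SL2 R).

Definition lcoset Gam (g : SL2 R) : set (SL2 R) :=
  [set (g * c)%g | c in Gam].

Definition lcoset_rel Gam : rel (SL2 R) :=
  fun g h => `[< lcoset Gam g = lcoset Gam h >].

Fact lcoset_rel_refl Gam : reflexive (lcoset_rel Gam).
Proof. by move=> g; apply/asboolP. Qed.
Fact lcoset_rel_sym Gam : symmetric (lcoset_rel Gam).
Proof. by move=> g h; apply/asboolP/asboolP. Qed.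
Fact lcoset_rel_trans Gam : transitive (lcoset_rel Gam).
Proof. by move=> h g k /asboolP gh /asboolP hk; apply/asboolP; rewrite gh. Qed.

Canonical lcoset_equiv Gam :=
  EquivRel (lcoset_rel Gam) (lcoset_rel_refl Gam) (lcoset_rel_sym Gam)
    (@lcoset_rel_trans Gam).

(* SL(2,R)/Gam with its quotient topology and Borel sigma-algebra *)
Definition homspace Gam : Type := quotient_topology {eq_quot lcoset_equiv Gam}.

HB.instance Definition _ Gam := Quotient.copy (homspace Gam)
  (quotient_topology {eq_quot lcoset_equiv Gam}).
HB.instance Definition _ Gam := PointedTopological.copy (homspace Gam)
  (quotient_topology {eq_quot lcoset_equiv Gam}).
HB.instance Definition _ Gam := Measurable.copy (homspace Gam)
  (g_sigma_algebraType (@open (homspace Gam))).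

Definition cls Gam (g : SL2 R) : homspace Gam := \pi_(homspace Gam) g.

Definition act Gam (g : SL2 R) (x : homspace Gam) : homspace Gam :=
  cls Gam (g * repr x)%g.

Lemma clsP Gam (g h : SL2 R) :
  cls Gam g = cls Gam h <-> lcoset Gam g = lcoset Gam h.
Proof.
split; first by move/eqquotP/asboolP.
by move=> gh; apply/eqquotP/asboolP.
Qed.

Lemma act_cls Gam (g h : SL2 R) : act g (cls Gam h) = cls Gam (g * h)%g.
Proof.
have /clsP e : cls Gam (repr (cls Gam h)) = cls Gam h by rewrite /cls reprK.
apply/clsP; have lcosetM k :
    lcoset Gam (g * k)%g = (fun h => g * h)%g @` lcoset Gam k.
  rewrite /lcoset; apply/seteqP; split => [_ [c Gc <-]|_ [_ [c Gc <-] <-]].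
    by exists (k * c)%g; [exists c|rewrite mulgA].
  by exists c => //; rewrite mulgA.
by rewrite !lcosetM e.
Qed.

Definition subgroup Gam :=
  [/\ Gam 1%g, (forall g h, Gam g -> Gam h -> Gam (g * h)%g) &
      (forall g, Gam g -> Gam (g^-1)%g)].

Definition discrete_subgroup Gam := subgroup Gam /\ isolated Gam = Gam.

Definition SL2_invariant Gam (mu : set (homspace Gam) -> \bar R) :=
  forall g (A : set (homspace Gam)), measurable A ->
    mu (act g @^-1` A) = mu A.

Definition lattice Gam := discrete_subgroup Gam /\
  exists mu : probability (homspace Gam) R, SL2_invariant mu.

Definition cocompact Gam := compact [set: homspace Gam].

End HomogeneousSpace.
Arguments cls {R} Gam g.

Section Metrics.
Context {R : realType}.

Definition is_metric (T : Type) (d : T -> T -> R) :=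
  [/\ forall x y, 0 <= d x y,
      forall x y, d x y = 0 <-> x = y,
      forall x y, d x y = d y x &
      forall x y z, d x z <= d x y + d y z].

Definition induces_topology (T : topologicalType) (d : T -> T -> R) :=
  forall (x : T) (A : set T),
    nbhs x A <-> exists2 e : R, 0 < e & [set y | d x y < e] `<=` A.

Definition right_invariant_metric (dG : SL2 R -> SL2 R -> R) :=
  [/\ is_metric dG, induces_topology dG &
      forall g h k, dG (g * k)%g (h * k)%g = dG g h].

Definition quot_dist (dG : SL2 R -> SL2 R -> R) (Gam : set (SL2 R))
    (x y : homspace Gam) : R :=
  inf [set r | exists g h, [/\ cls Gam g = x, cls Gam h = y & r = dG g h]].

End Metrics.

Section ContinuouslyDifferentiable.
Context {R : realType}.

Definition C1_on (V : normedModType R) (U : set V) (F : V -> R) :=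
  (forall A, U A -> differentiable F A) /\
  (forall (v : V) A, U A -> {for A, continuous (fun B => 'D_v F B)}).

(* SL(2,R) is an embedded submanifold of the space of 2 x 2 matrices: a function
   on it is C^1 when it extends locally to a C^1 function of the entries *)
Definition C1_SL2 (f : SL2 R -> R) := forall g : SL2 R,
  exists (U : set 'M[R]_2) (F : 'M[R]_2 -> R),
    [/\ open U, U (val g), C1_on U F & forall h, U (val h) -> f h = F (val h)].

(* SL(2,R) -> SL(2,R)/Gam is a local diffeomorphism when Gam is discrete *)
Definition C1_homspace (Gam : set (SL2 R)) (f : homspace Gam -> R) :=
  C1_SL2 (f \o cls Gam).

End ContinuouslyDifferentiable.

Section TimeChange.
Context {R : realType} {Gam : set (SL2 R)}.

Definition horocycle_flow (t : R) (x : homspace Gam) : homspace Gam :=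
  act (horo t) x.

Definition oriented_integral (f : R -> R) (a b : R) : R :=
  if a <= b then \int[lebesgue_measure]_(s in `[a, b]) f s
  else - \int[lebesgue_measure]_(s in `[b, a]) f s.

(* There is exactly one such a when tau is continuous and positive and the
   quotient is compact, so the default value 0 plays no role then *)
Definition time_alpha (tau : homspace Gam -> R) (x : homspace Gam) (t : R) : R :=
  xget 0 [set a |
    oriented_integral (fun s => tau (horocycle_flow s x)) 0 a = t].

Definition time_change (tau : homspace Gam -> R) (t : R) (x : homspace Gam) :
    homspace Gam :=
  horocycle_flow (time_alpha tau x t) x.

Definition time_change_measure (tau : homspace Gam -> R)
    (mu nu : probability (homspace Gam) R) :=
  forall A, measurable A ->
    nu A = (\int[mu]_(x in A) (tau x / (\int[mu]_y tau y)%R)%:E)%E.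

End TimeChange.

Section StrongR.
Context {R : realType} d {T : measurableType d}.
Variables (dist : T -> T -> R) (mu : probability T R) (flow : R -> T -> T).

Definition measure_preserving_flow :=
  [/\ flow 0 =1 id, forall s t x, flow (s + t) x = flow s (flow t x),
      measurable_fun setT (fun z : R * T => flow z.1 z.2) &
      forall t A, measurable A -> mu (flow t @^-1` A) = mu A].

Definition ergodic_flow := measure_preserving_flow /\
  forall A, measurable A -> (forall t, flow t @^-1` A = A) ->
    mu A = 0%E \/ mu A = 1%E.

Definition close_on (eps kap L q : R) (x x' : T) :=
  (((1 - eps) * (kap * L))%:E <=
   lebesgue_measure
     [set t | (L <= t <= L + kap * L)%R /\
              (dist (flow t x) (flow (t + q) x') < eps)%R])%E.

(* M1 lies in [kap^-2, M1], so that p_M1 is one of the numbers p_L *)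
Definition strong_Rp (p : R) :=
  [/\ 0 < p, is_metric dist, ergodic_flow &
  forall eps : R, 0 < eps -> exists2 kap : R, 0 < kap < eps &
  forall N : nat, exists (Z : set T) (del : R),
    [/\ measurable Z, ((1 - eps)%:E <= mu Z)%E, 0 < del &
    forall x x', Z x -> Z x' -> dist x x' < del ->
      ~ (exists t, x = flow t x') ->
    exists (M1 : nat) (q : R -> R),
      [/\ (N <= M1)%N, kap ^- 2 <= M1%:R,
          forall L, kap ^- 2 <= L <= M1%:R ->
            - p <= q L <= p /\ close_on eps kap L (q L) x x' &
          p / 2 <= `|q M1%:R|]]].

Definition strong_R := exists p, strong_Rp p.

End StrongR.

(* Main.v *)
Require Import Defs.
From mathcomp Require Import all_boot all_order all_algebra.
From mathcomp Require Import all_classical all_reals all_analysis.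
From mathcomp Require Import measurable_realfun ring lra.

Set Implicit Arguments.
Unset Strict Implicit.
Unset Printing Implicit Defensive.

Import Order.TTheory GRing.Theory Num.Theory.
Import numFieldNormedType.Exports.

Local Open Scope classical_set_scope.
Local Open Scope ring_scope.

(* Let x' = g x with g = [[a, b], [c, d]] close to 1, and let l(t) = d - c t and
   s(t) = (t a - b) / l(t). The identity u_s(t) g = [[1/l, 0], [c, l]] u_t for
   the horocyclic elements u_t shows that the two orbits stay close in space
   until (1 - d) t + c t^2 / 2 has order 1. In the clock of the time change the
   second one lags by the drift
     D(t) = int_0^s(t) tau(u_r x') dr - int_0^t tau(u_r x) dr,
   and D'(t) = psi(u_t x) (1 - l(t)) + small, where psi is continuous with
   integral 2 int tau. As the horocycle flow is uniquely ergodic, D(t) is close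
   to 2 int tau ((1 - d) t + c t^2 / 2). If S (|1 - d| + |c| S) is a suitable
   constant then |D| reaches the required size before S, and its slope up to 4 S
   is O(1/S), so that D is nearly constant on windows of small relative length.

   Unique ergodicity: by the Mautner phenomenon the averages of f along u_t,
   0 <= t <= n, are asymptotically invariant in L^1 under all of SL(2,R),
   uniformly in the group element. Composed with diag(sqrt n, 1 / sqrt n) they
   are equicontinuous, by the same shear identity, hence nearly constant. *)

(** * Entries and topology of SL(2,R) *)

(** Differentiability of [tau] enters because the drift accumulates over a time of order S while the
    orbits are at distance O(1 / S): [tau] has to be controlled to first order, up to a small
    multiple of 1 / S, for the total error to stay below the threshold. The first-order term along
    the diagonal does not affect the mean of psi, and the factor 2 in this mean comes from s'(t) =
    l(t)^-2. The two terms in the main part of D can cancel at a given time; S is therefore defined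
    from the absolute values of both coefficients, and the size of D is tested at S / 2 and at S.
    The order of the quantifiers shapes the estimates: kappa depends on epsilon only, so the bounds
    up to 4 S have the form K / S with K independent of N and of the pair of points, and N enters
    only by forcing S to be large. Measure preservation and ergodicity of the time change, which
    belong to the property, come from the same uniform convergence of horocycle averages, tested on
    continuous functions. *)

Section Matrices.
Context {R : realType}.
Implicit Types (g h : SL2 R) (a b c d s t : R).

Lemma mulmx2E (A B : 'M[R]_2) i j :
  (A *m B) i j = A i 0 * B 0 j + A i 1 * B 1 j.
Proof.
by rewrite mxE !big_ord_recl big_ord0 addr0; congr (_ + A i _ * B _ j);
  exact: val_inj.
Qed.

Lemma ord2P (P : 'I_2 -> Prop) : P 0 -> P 1 -> forall i, P i.
Proof.
move=> P0 P1 [[|[|//]] p]; first by rewrite (_ : Ordinal _ = 0) //; exact: val_inj.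
by rewrite (_ : Ordinal _ = 1) //; exact: val_inj.
Qed.

Lemma mx2P (A B : 'M[R]_2) : A 0 0 = B 0 0 -> A 0 1 = B 0 1 ->
  A 1 0 = B 1 0 -> A 1 1 = B 1 1 -> A = B.
Proof.
by move=> *; apply/matrixP => i j; elim/ord2P: i; elim/ord2P: j.
Qed.

Definition mx2 a b c d : 'M[R]_2 := \matrix_(i, j)
  if i == 0 then (if j == 0 then a else b) else (if j == 0 then c else d).

Lemma mx2E a b c d : (mx2 a b c d 0 0 = a) * (mx2 a b c d 0 1 = b) *
  (mx2 a b c d 1 0 = c) * (mx2 a b c d 1 1 = d).
Proof. by rewrite !mxE. Qed.

Lemma det2E (A : 'M[R]_2) : \det A = A 0 0 * A 1 1 - A 0 1 * A 1 0.
Proof.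
rewrite (expand_det_row _ 0) !big_ord_recl big_ord0 addr0 /cofactor !det_mx11.
rewrite !mxE /= expr0 expr1 mul1r mulN1r mulrN.
by congr (A _ _ * A _ _ - A _ _ * A _ _); exact: val_inj.
Qed.

Definition m11 g := val g 0 0.
Definition m12 g := val g 0 1.
Definition m21 g := val g 1 0.
Definition m22 g := val g 1 1.

Lemma valSL2E g : val g = mx2 (m11 g) (m12 g) (m21 g) (m22 g).
Proof. by apply: mx2P; rewrite !mx2E. Qed.

Lemma SL2_det g : m11 g * m22 g - m12 g * m21 g = 1.
Proof. by rewrite -det2E det_SL2. Qed.

Lemma SL2P g h : m11 g = m11 h -> m12 g = m12 h -> m21 g = m21 h ->
  m22 g = m22 h -> g = h.
Proof. by move=> *; apply: val_inj; exact: mx2P. Qed.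

(* The junk value for a d - b c <> 1 is the unit *)
Definition sl2 a b c d : SL2 R := insubd (1%g : SL2 R) (mx2 a b c d).

Lemma val_sl2 a b c d : a * d - b * c = 1 -> val (sl2 a b c d) = mx2 a b c d.
Proof.
move=> e; rewrite /sl2 val_insubd ifT//.
by apply: mem_set => /=; rewrite det2E !mx2E.
Qed.

Lemma sl2E a b c d : a * d - b * c = 1 ->
  (m11 (sl2 a b c d) = a) * (m12 (sl2 a b c d) = b) *
  (m21 (sl2 a b c d) = c) * (m22 (sl2 a b c d) = d).
Proof. by rewrite /m11 /m12 /m21 /m22 => /val_sl2 ->; rewrite !mx2E. Qed.

Lemma mulSL2_entry g h i j :
  val (g * h)%g i j = val g i 0 * val h 0 j + val g i 1 * val h 1 j.
Proof. by rewrite -mulmx2E. Qed.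

Lemma m11M g h : m11 (g * h)%g = m11 g * m11 h + m12 g * m21 h.
Proof. exact: mulSL2_entry. Qed.
Lemma m12M g h : m12 (g * h)%g = m11 g * m12 h + m12 g * m22 h.
Proof. exact: mulSL2_entry. Qed.
Lemma m21M g h : m21 (g * h)%g = m21 g * m11 h + m22 g * m21 h.
Proof. exact: mulSL2_entry. Qed.
Lemma m22M g h : m22 (g * h)%g = m21 g * m12 h + m22 g * m22 h.
Proof. exact: mulSL2_entry. Qed.
Definition mulSL2E := (m11M, m12M, m21M, m22M).

Lemma oneSL2E : (m11 (1%g : SL2 R) = 1) * (m12 (1%g : SL2 R) = 0) *
  (m21 (1%g : SL2 R) = 0) * (m22 (1%g : SL2 R) = 1).
Proof. by rewrite /m11 /m12 /m21 /m22 /= !mxE. Qed.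

Lemma horoE t : (m11 (horo t) = 1) * (m12 (horo t) = t) *
  (m21 (horo t) = 0) * (m22 (horo t) = 1).
Proof.
by rewrite /m11 /m12 /m21 /m22 /= expmx_horo !mxE /= !(mulr1, mulr0, addr0, add0r).
Qed.

Definition vert c := sl2 1 0 c 1.
(** The parameter is the lower right entry, so that [ltri c l] is [vert (c * l) * dil l] with the
    same [l]. *)
Definition dil a := sl2 a^-1 0 0 a.

Lemma vertE c : (m11 (vert c) = 1) * (m12 (vert c) = 0) *
  (m21 (vert c) = c) * (m22 (vert c) = 1).
Proof. by apply: sl2E; rewrite mulr1 mul0r subr0. Qed.

Lemma dilE a : a != 0 -> (m11 (dil a) = a^-1) * (m12 (dil a) = 0) *
  (m21 (dil a) = 0) * (m22 (dil a) = a).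
Proof. by move=> a0; apply: sl2E; rewrite mulVf// mulr0 subr0. Qed.

Lemma horoD s t : horo (s + t) = (horo s * horo t)%g :> SL2 R.
Proof. by apply: SL2P; rewrite !mulSL2E !horoE; ring. Qed.

Lemma horo0 : horo 0 = 1%g :> SL2 R.
Proof. by apply: SL2P; rewrite !horoE !oneSL2E. Qed.

End Matrices.

#[local] Opaque m11 m12 m21 m22.

Section SL2Topology.
Context {R : realType}.
Implicit Types (g h : SL2 R).

Definition SL2_close (r : R) g h := forall i j, `|val g i j - val h i j| < r.

Lemma SL2_closeP r g h : SL2_close r g h <->
  [/\ `|m11 g - m11 h| < r, `|m12 g - m12 h| < r,
      `|m21 g - m21 h| < r & `|m22 g - m22 h| < r].
Proof.
by split=> [gh|[? ? ? ?] i j]; [split; exact: gh|elim/ord2P: i; elim/ord2P: j].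
Qed.

Lemma nbhs_SL2P g (A : set (SL2 R)) :
  nbhs g A <-> exists2 r, 0 < r & [set h | SL2_close r g h] `<=` A.
Proof.
split.
  move=> [B [[C oC <-] Cg] BA].
  have /nbhs_ballP[r r0 rC] : nbhs (val g) C by apply: open_nbhs_nbhs; split.
  by exists r => // h gh; apply: BA; apply: rC; split.
move=> [r r0 rA].
have : nbhs g (val @^-1` ball (val g) r).
  exact: (@initial_continuous _ _ (val : SL2 R -> _)) (nbhsx_ballx _ _ r0).
by apply: filterS => h [_ gh]; apply: rA.
Qed.

Lemma cvg_SL2P {T : Type} (F : set_system T) {FF : Filter F} (f : T -> SL2 R) g :
  (forall i j, (fun x => val (f x) i j) @ F --> val g i j) -> f @ F --> g.
Proof.
move=> fg A /nbhs_SL2P[r r0 rA]; rewrite nbhs_filterE /fmap /=.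
have H i j : \forall x \near F, `|val g i j - val (f x) i j| < r.
  by have /cvgr_dist_lt := fg i j; exact.
have : \forall x \near F, SL2_close r g (f x).
  near=> x => i j; elim/ord2P: i; elim/ord2P: j; near: x; exact: H.
by apply: filterS => x; exact: rA.
Unshelve. all: by end_near. Qed.

Lemma entry_continuous i j : continuous (fun g => val g i j).
Proof.
move=> g; apply: (@continuous_comp _ _ _ (val : SL2 R -> 'M[R]_2)
  (fun A : 'M[R]_2 => A i j)).
  exact: (@initial_continuous _ _ (val : SL2 R -> _)).
exact: coord_continuous.
Qed.

Lemma cvg_mulSL2 {T : Type} (F : set_system T) {FF : Filter F}
    (f f' : T -> SL2 R) g h :
  f @ F --> g -> f' @ F --> h -> (fun x => (f x * f' x)%g : SL2 R) @ F --> ((g * h)%g : SL2 R).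
Proof.
move=> fg fh; apply: cvg_SL2P => i j.
have e k l : (fun x => val (f x) k l) @ F --> val g k l.
  exact: (cvg_comp _ _ fg (@entry_continuous k l g)).
have e' k l : (fun x => val (f' x) k l) @ F --> val h k l.
  exact: (cvg_comp _ _ fh (@entry_continuous k l h)).
rewrite mulSL2_entry; under eq_fun do rewrite mulSL2_entry.
by apply: cvgD; apply: cvgM.
Qed.

Lemma cvg_mulSL2r {T : Type} (F : set_system T) {FF : Filter F}
    (f : T -> SL2 R) g h :
  f @ F --> g -> (fun x => (f x * h)%g : SL2 R) @ F --> ((g * h)%g : SL2 R).
Proof. by move=> fg; apply: cvg_mulSL2 fg _; exact: (@cvg_cst (SL2 R)). Qed.

Lemma cvg_mulSL2l {T : Type} (F : set_system T) {FF : Filter F}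
    (f : T -> SL2 R) g h :
  f @ F --> g -> (fun x => (h * f x)%g : SL2 R) @ F --> ((h * g)%g : SL2 R).
Proof. by move=> fg; apply: cvg_mulSL2 _ fg; exact: (@cvg_cst (SL2 R)). Qed.

Lemma mulSL2r_continuous h : continuous (fun g => (g * h)%g : SL2 R).
Proof. by move=> g; apply: (@cvg_mulSL2r _ (nbhs g) (nbhs_filter g)) => ?. Qed.

Lemma mulSL2l_continuous h : continuous (fun g => (h * g)%g : SL2 R).
Proof. by move=> g; apply: (@cvg_mulSL2l _ (nbhs g) (nbhs_filter g)) => ?. Qed.

Lemma cvg_horo {T : Type} (F : set_system T) {FF : Filter F} (f : T -> R) t :
  f @ F --> t -> (fun x => horo (f x)) @ F --> (horo t : SL2 R).
Proof.
move=> ft; apply: cvg_SL2P => i j; elim/ord2P: i; elim/ord2P: j.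
- have E s : val (horo s) 0 0 = 1 := (horoE s).1.1.1.
  by rewrite E; under eq_fun do rewrite E; exact: cvg_cst.
- have E s : val (horo s) 0 1 = s := (horoE s).1.1.2.
  by rewrite E; under eq_fun do rewrite E; exact: ft.
- have E s : val (horo s) 1 0 = 0 := (horoE s).1.2.
  by rewrite E; under eq_fun do rewrite E; exact: cvg_cst.
- have E s : val (horo s) 1 1 = 1 := (horoE s).2.
  by rewrite E; under eq_fun do rewrite E; exact: cvg_cst.
Qed.

End SL2Topology.

(** * The homogeneous space *)

Section HomTopology.
Context {R : realType} {Gam : set (SL2 R)}.
Implicit Types (g h : SL2 R) (x y : homspace Gam).

Lemma cls_repr x : cls Gam (repr x) = x.
Proof. exact: reprK. Qed.

Lemma actM g h x : act g (act h x) = act (g * h)%g x.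
Proof. by rewrite -(cls_repr x) !act_cls mulgA. Qed.

Lemma act1 x : act 1%g x = x.
Proof. by rewrite -{1}(cls_repr x) act_cls mul1g cls_repr. Qed.

Lemma act_invK g x : act (g^-1)%g (act g x) = x.
Proof. by rewrite actM mulVg act1. Qed.

Lemma act_Kinv g x : act g (act (g^-1)%g x) = x.
Proof. by rewrite actM mulgV act1. Qed.

Lemma cls_continuous : continuous (cls Gam).
Proof. exact: pi_continuous. Qed.

Hypothesis Gs : subgroup Gam.

Lemma cls_eqP g h : cls Gam g = cls Gam h <-> Gam (g^-1 * h)%g.
Proof.
have [G1 GM GV] := Gs; rewrite clsP; split.
  move=> gh; have : lcoset Gam h h by exists 1%g; rewrite ?mulg1.
  by rewrite -gh => -[c Gc <-]; rewrite mulKg.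
move=> gh; apply/seteqP; split => _ [c Gc <-].
  exists ((g^-1 * h)^-1 * c)%g; first exact: GM (GV _ gh) Gc.
  by rewrite invgM invgK !mulgA mulgV mul1g.
by exists (g^-1 * h * c)%g; [exact: GM|rewrite !mulgA mulgV mul1g].
Qed.

Lemma cls_mulr g h : Gam h -> cls Gam (g * h)%g = cls Gam g.
Proof. by move=> Gh; apply/esym/cls_eqP; rewrite mulKg. Qed.

(** The projection is open because the saturation of an open set is a union of its right translates
    by elements of [Gam]. *)
Lemma nbhs_cls g (A : set (SL2 R)) : nbhs g A -> nbhs (cls Gam g) (cls Gam @` A).
Proof.
rewrite nbhsE => -[B [oB Bg] BA].
rewrite nbhsE; exists (cls Gam @` B); last exact: image_subset.
split; last by exists g.
rewrite /open /= /quotient_open openE => k [h Bh hk].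
have /cls_eqP Gc := esym hk; rewrite /interior.
have : (fun k' : SL2 R => (k' * (k^-1 * h))%g : SL2 R) @ k --> ((k * (k^-1 * h))%g : SL2 R).
  exact: mulSL2r_continuous.
have nB : nbhs h B by apply: open_nbhs_nbhs; split.
rewrite mulVKg => /(_ B nB).
apply: (@filterS _ (nbhs k) (nbhs_filter k)) => k' Bk' /=.
by exists (k' * (k^-1 * h))%g => //; exact: cls_mulr.
Qed.

(** As the projection is open, neighbourhoods of a representative project to neighbourhoods of [x];
    joint continuity of the product in the group thus passes to the action. *)
Lemma cvg_act {T : Type} (F : set_system T) {FF : Filter F}
    (f : T -> SL2 R) (f' : T -> homspace Gam) g x :
  f @ F --> g -> f' @ F --> x -> (fun t => act (f t) (f' t)) @ F --> act g x.
Proof.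
move=> fg fx A; rewrite -(cls_repr x) act_cls => /cls_continuous nA.
have : (fun p : SL2 R * SL2 R => (p.1 * p.2)%g : SL2 R) @ (g, repr x) -->
      ((g * repr x)%g : SL2 R).
  by apply: cvg_mulSL2; [exact: cvg_fst|exact: cvg_snd].
move/(_ _ nA) => -[[U V] /= [nU nV] UV].
have FU := fg _ nU.
have := nbhs_cls nV; rewrite cls_repr => /fx FV.
rewrite nbhs_filterE /fmap /=; near=> t.
have : U (f t) by near: t.
have : (cls Gam @` V) (f' t) by near: t.
by move=> /= [h Vh <-] Uf; rewrite act_cls; exact: (UV (_, _) (conj Uf Vh)).
Unshelve. all: by end_near. Qed.

(** Orbit maps are open, so that topological statements on the quotient can be checked on group
    elements near 1, without charts. *)
Lemma nbhs_homP x (A : set (homspace Gam)) :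
  nbhs x A <-> \forall g \near (1%g : SL2 R), A (act g x).
Proof.
split.
  have : (fun g => act g x) @ (1%g : SL2 R) --> act 1%g x.
    by apply: (@cvg_act _ (nbhs (1%g : SL2 R)) (nbhs_filter _));
      [move=> ?|exact: cvg_cst].
  by rewrite act1 => H /H.
move=> H.
have : (fun h : SL2 R => (h * (repr x)^-1)%g : SL2 R) @ repr x --> (1%g : SL2 R).
  by rewrite -(mulgV (repr x)); exact: mulSL2r_continuous.
move=> /(_ _ H) /nbhs_cls; rewrite cls_repr.
apply: filterS => _ [h /= + <-].
by rewrite -[x in act _ x]cls_repr act_cls -mulgA mulVg mulg1.
Qed.

End HomTopology.

(** * Derivatives and oriented integrals *)

Section RealCalculus.
Context {R : realType}.
Implicit Types (f F G : R -> R) (a b c x t : R).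

Definition der f x (d : R) := is_derive (x : R) (1 : R) f d.

Lemma der_eq f x d e : der f x d -> d = e -> der f x e.
Proof. by move=> ? <-. Qed.

Lemma der_cst c x : der (fun=> c) x 0.
Proof. exact: is_derive_cst. Qed.

Lemma der_id x : der id x 1.
Proof. exact: is_derive_id. Qed.

Lemma derD F G x d e : der F x d -> der G x e ->
  der (fun t => F t + G t) x (d + e).
Proof. exact: is_deriveD. Qed.

Lemma derB F G x d e : der F x d -> der G x e ->
  der (fun t => F t - G t) x (d - e).
Proof. exact: is_deriveB. Qed.

Lemma derM F G x d e : der F x d -> der G x e ->
  der (fun t => F t * G t) x (d * G x + F x * e).
Proof.
move=> dF dG; apply: der_eq (is_deriveM dF dG) _.
by rewrite addrC mulrC.
Qed.

Lemma derZ F c x d : der F x d -> der (fun t => c * F t) x (c * d).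
Proof.
by move=> dF; apply: der_eq (derM (der_cst c x) dF) _; rewrite mul0r add0r.
Qed.

Lemma der_comp F G x d e : der G x e -> der F (G x) d ->
  der (fun t => F (G t)) x (d * e).
Proof. by move=> dG dF; exact: (is_derive1_comp dF dG). Qed.

Lemma derV F x d : F x != 0 -> der F x d -> der (fun t => (F t)^-1) x (- d / F x ^+ 2).
Proof.
move=> F0 dF; apply: der_eq (is_deriveV F0 dF) _.
by rewrite /GRing.scale /= -exprVn; ring.
Qed.

Lemma der_continuous F x d : der F x d -> F @ x --> F x.
Proof.
by move=> [dF _]; apply: differentiable_continuous; apply/derivable1_diffP.
Qed.

Lemma der_within F a b : (forall x, a <= x <= b -> exists d, der F x d) ->
  {within `[a, b], continuous F}.
Proof.
move=> dF; apply: continuous_in_subspaceT => x; rewrite inE /= in_itv /= => /dF[d].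
exact: der_continuous.
Qed.

Lemma der_MVT F f a b : a <= b -> (forall x, a <= x <= b -> der F x (f x)) ->
  exists2 c, a <= c <= b & F b - F a = f c * (b - a).
Proof.
move=> ab dF; have [x /[!in_itv] /=| |c] := @MVT_segment R F f a b ab.
- by move=> /andP[ax xb]; apply: dF; rewrite !ltW.
- by apply: der_within => x /dF; exists (f x).
- by rewrite in_itv /=; exists c.
Qed.

Lemma der_bound F f B a b : a <= b -> (forall x, a <= x <= b -> der F x (f x)) ->
  (forall x, a <= x <= b -> `|f x| <= B) -> `|F b - F a| <= B * (b - a).
Proof.
move=> ab dF fB; have [c ? ->] := der_MVT ab dF.
by rewrite normrM (ger0_norm (_ : 0 <= b - a)) ?subr_ge0// ler_wpM2r ?subr_ge0 ?fB.
Qed.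

Lemma der_boundT F f B a b : (forall x, der F x (f x)) ->
  (forall x, `|f x| <= B) -> `|F b - F a| <= B * `|b - a|.
Proof.
move=> dF fB; have [ab|/ltW ba] := leP a b.
  by rewrite [`|b - a|]ger0_norm ?subr_ge0//; apply: (@der_bound _ f).
by rewrite distrC [`|b - a|]distrC [`|a - b|]ger0_norm ?subr_ge0//;
  apply: (@der_bound _ f).
Qed.

(** Serves as the substitution rule: integrals along orbits are compared through their derivatives,
    as in [bintD] and [bint_time_change]. *)
Lemma der_inj F G f a b : (forall x, der F x (f x)) -> (forall x, der G x (f x)) ->
  F b - F a = G b - G a.
Proof.
move=> dF dG; have /(@der_boundT _ _ 0 a b) : forall x, der (fun t => F t - G t) x 0.
  by move=> x; apply: der_eq (derB (dF x) (dG x)) _; rewrite subrr.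
rewrite normr0 => /(_ (fun=> lexx _)); rewrite mul0r normr_le0 => /eqP; lra.
Qed.

Lemma derS F G x d : (\forall t \near x, F t = G t) -> der F x d -> der G x d.
Proof. exact: near_eq_is_derive. Qed.

(** * Primitives of continuous functions *)

Section OrientedIntegral.
Variables (f : R -> R) (cf : continuous f).

Let mu := @lebesgue_measure R.

Let itg a b : mu.-integrable `[a, b] (EFin \o f).
Proof.
apply: continuous_compact_integrable; first exact: segment_compact.
exact: continuous_subspaceT.
Qed.

Let P c x := \int[mu]_(t in `[c, x]) f t.

Let PB c a b : c <= a -> a <= b -> \int[mu]_(t in `[a, b]) f t = P c b - P c a.
Proof.
move=> ca ab; rewrite /P Rintegral_itvB ?bnd_simp//.
rewrite Rintegral_itv_obnd_cbnd//; apply: integrableS (itg a b) => //.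
exact: subset_itv_oc_cc.
Qed.

Let ointP c a b : c <= a -> c <= b -> oriented_integral f a b = P c b - P c a.
Proof.
rewrite /oriented_integral => ca cb; case: ifPn => [ab|]; first exact: PB.
by rewrite -ltNge => /ltW ba; rewrite (PB cb ba) opprB.
Qed.

Let derP c x : c < x -> der (P c) x (f x).
Proof.
move=> cx; have [] := @continuous_FTC1_closed R f c x (x + 1) _ (itg _ _) cx (@cf x).
  by rewrite ltrDl.
by move=> /derivableP dF; rewrite derive1E => e; apply: der_eq dF e.
Qed.

Lemma der_oint a x : der (oriented_integral f a) x (f x).
Proof.
(* The base point lies to the left of [a] and [x]: near [x] the oriented integral is then a
   difference of two integrals from [c], whatever the order of its bounds, and the fundamental
   theorem of calculus applies at [x]. *)
pose c := Num.min a x - 1.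
have [ca cx] : c < a /\ c < x.
  have := ge_min a a x; have := ge_min x a x; rewrite !lexx orbT /= /c => *.
  by split; lra.
apply: (@derS (fun t => P c t - P c a)); last first.
  by apply: der_eq (derB (derP cx) (der_cst _ _)) _; rewrite subr0.
near=> t; rewrite (@ointP c)// ltW//.
by near: t; apply: lt_nbhsr.
Unshelve. all: by end_near. Qed.

Lemma oint0 a : oriented_integral f a a = 0.
Proof. by rewrite (@ointP a) ?subrr. Qed.

End OrientedIntegral.
End RealCalculus.

(** * Integrals along the horocycle flow *)

Section Flow.
Context {R : realType} {Gam : set (SL2 R)}.
Hypothesis Gs : subgroup Gam.
Local Notation X := (homspace Gam).
Implicit Types (g : SL2 R) (x : X) (s t : R).

Lemma hflow0 x : horocycle_flow 0 x = x.
Proof. by rewrite /horocycle_flow horo0 act1. Qed.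

Lemma hflowD s t x :
  horocycle_flow (s + t) x = horocycle_flow s (horocycle_flow t x).
Proof. by rewrite /horocycle_flow actM horoD. Qed.

Lemma cvg_hflow {T : Type} (F : set_system T) {FF : Filter F}
    (f : T -> R) (f' : T -> X) t x :
  f @ F --> t -> f' @ F --> x ->
  (fun u => horocycle_flow (f u) (f' u)) @ F --> horocycle_flow t x.
Proof. by move=> ft fx; apply: cvg_act => //; exact: cvg_horo. Qed.

Lemma act_continuous g : continuous (@act R Gam g).
Proof.
by move=> x; apply: (@cvg_act _ _ Gs _ (nbhs x) (nbhs_filter x)); [exact: (@cvg_cst (SL2 R))|by move=> ?].
Qed.

Lemma orbit_continuous (f : X -> R) x : continuous f ->
  continuous (fun s => f (horocycle_flow s x)).
Proof.
move=> cf s.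
suff H : (fun s => horocycle_flow s x) @ s --> horocycle_flow s x.
  exact: (cvg_comp _ _ H (cf _)).
by apply: (@cvg_hflow _ (nbhs s) (nbhs_filter s)); [by move=> ?|exact: cvg_cst].
Qed.

(** * Uniformity over the compact quotient *)

Section Compactness.
Hypothesis Gc : cocompact Gam.

(** Compactness in covering form. The filter varies in the applications: neighbourhoods of 1, large
    bounds, large indices, small radii, and the filter generated by the null sets. *)
Lemma near_hom (I : Type) (F : set_system I) (P : I -> X -> Prop) :
  Filter F -> (forall x, \forall x' \near x & i \near F, P i x') ->
  \forall i \near F, forall x, P i x.
Proof.
move=> FF H; have /compact_near_coveringP/(_ _ _ P FF) := Gc.
by move=> /(_ (fun x _ => H x)); apply: filterS => i Pi x; exact: Pi.
Qed.

Lemma hom_unif (f : X -> R) (e : R) : continuous f -> 0 < e ->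
  \forall g \near (1%g : SL2 R), forall x, `|f (act g x) - f x| < e.
Proof.
move=> cf e0; apply: (@near_hom _ (nbhs (1%g : SL2 R)) _ (nbhs_filter _)) => x.
have c1 : (fun p : X * SL2 R => act p.2 p.1) @ (x, 1%g : SL2 R) --> x.
  by rewrite -{2}(act1 x); apply: (@cvg_act _ _ Gs); [exact: cvg_snd|exact: cvg_fst].
have c2 : (fun p : X * SL2 R => p.1) @ (x, 1%g : SL2 R) --> x by exact: cvg_fst.
have : (fun p : X * SL2 R => f (act p.2 p.1) - f p.1) @ (x, 1%g : SL2 R) --> f x - f x.
  by apply: cvgB; [exact: (cvg_comp _ _ c1 (cf x))|exact: (cvg_comp _ _ c2 (cf x))].
rewrite subrr => /cvgr0_norm_lt; exact.
Qed.

Lemma hom_bounded (f : X -> R) : continuous f ->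
  exists2 B, 0 < B & forall x, `|f x| <= B.
Proof.
move=> cf.
have : \forall B \near (+oo : set_system R), forall x, `|f x| <= B.
  apply: near_hom => x.
  exists ([set y | `|f y| < `|f x| + 1], [set B | `|f x| + 1 < B]).
    split => /=; last by apply: nbhs_pinfty_gt; exact: num_real.
    have /cvgr_norm_lt := cf x; apply; lra.
  by move=> [y B] /= [/ltW yx /ltW xB]; exact: le_trans xB.
move=> H; have [B []] : exists B, 0 < B /\ forall x, `|f x| <= B.
  near (+oo : set_system R) => B; exists B; split; near: B => //.
  exact: nbhs_pinfty_gt.
by exists B.
Unshelve. all: by end_near. Qed.

Lemma hom_lower (f : X -> R) : continuous f -> (forall x, 0 < f x) ->
  exists2 m, 0 < m & forall x, m <= f x.
Proof.
move=> cf f0; have [|B B0 fB] := @hom_bounded (fun x => (f x)^-1).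
  by move=> x; apply: cvgV (cf x); rewrite gt_eqF.
exists B^-1; first by rewrite invr_gt0.
move=> x; rewrite -[f x]invrK lef_pV2 ?posrE ?invr_gt0//.
exact: le_trans (ler_norm _) (fB x).
Qed.

End Compactness.

Definition bint (f : X -> R) x t :=
  oriented_integral (fun s => f (horocycle_flow s x)) 0 t.

Section Birkhoff.
Variables (f : X -> R) (cf : continuous f).

Lemma der_bint x t : der (bint f x) t (f (horocycle_flow t x)).
Proof. exact: (der_oint (@orbit_continuous f x cf) 0 t). Qed.

Lemma bint0 x : bint f x 0 = 0.
Proof. exact: (oint0 (@orbit_continuous f x cf) 0). Qed.

Lemma bintD x s t : bint f x (s + t) = bint f x s + bint f (horocycle_flow s x) t.
Proof.
have d1 u : der (fun v => bint f x (s + v)) u (f (horocycle_flow u (horocycle_flow s x))).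
  rewrite -hflowD addrC; apply: der_eq (der_comp _ (der_bint _ _)) (mulr1 _).
  by apply: der_eq (derD (der_cst _ _) (der_id _)) _; rewrite add0r.
have := der_inj 0 t d1 (der_bint _); rewrite bint0 addr0 subr0; lra.
Qed.

Lemma bint_bound B x t : (forall y, `|f y| <= B) -> `|bint f x t| <= B * `|t|.
Proof.
move=> fB; have := der_boundT 0 t (der_bint x) (fun s => fB _).
by rewrite bint0 !subr0.
Qed.

Lemma bint_lip B x s t : (forall y, `|f y| <= B) ->
  `|bint f x s - bint f x t| <= B * `|s - t|.
Proof. by move=> fB; apply: (der_boundT t s (der_bint x) (fun s => fB _)). Qed.

Lemma hom_cvgP (h : X -> R) x :
  (forall e, 0 < e -> \forall y \near x, `|h x - h y| <= e) -> h @ x --> h x.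
Proof. by move=> H; apply/(@cvgrPdist_le _ _ _ (nbhs x) (nbhs_filter x)). Qed.

Lemma bint_continuous t : continuous (bint f ^~ t).
Proof.
move=> x; apply: hom_cvgP => e e0.
pose K := `[- `|t|, `|t|]%classic : set R.
(* The [+ 1] keeps the divisor positive when [t = 0]. *)
have e1 : 0 < e / (`|t| + 1) by rewrite divr_gt0// ltr_wpDl.
have H : \forall y \near x, forall s, - `|t| <= s <= `|t| ->
    `|f (horocycle_flow s x) - f (horocycle_flow s y)| <= e / (`|t| + 1).
  have /compact_near_coveringP/(_ _ (nbhs x) (fun y s =>
    `|f (horocycle_flow s x) - f (horocycle_flow s y)| <= e / (`|t| + 1)) _) :=
    @segment_compact R (- `|t|) (`|t|).
  have H s : (fun p : R * X => f (horocycle_flow p.1 x) - f (horocycle_flow p.1 p.2))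
      @ (s, x) --> f (horocycle_flow s x) - f (horocycle_flow s x).
    have c1 : (fun p : R * X => horocycle_flow p.1 x) @ (s, x) --> horocycle_flow s x.
      by apply: cvg_hflow; [exact: cvg_fst|exact: cvg_cst].
    have c2 : (fun p : R * X => horocycle_flow p.1 p.2) @ (s, x) --> horocycle_flow s x.
      by apply: cvg_hflow; [exact: cvg_fst|exact: cvg_snd].
    by apply: cvgB; [exact: (cvg_comp _ _ c1 (@cf _))|exact: (cvg_comp _ _ c2 (@cf _))].
  have H' s : \forall s' \near s & y \near nbhs x,
      `|f (horocycle_flow s' x) - f (horocycle_flow s' y)| <= e / (`|t| + 1).
    by have := H s; rewrite subrr => /cvgr0_norm_le; exact.
  move=> /(_ (fun s _ => H' s)).
  apply: (@filterS _ (nbhs x) (nbhs_filter x)) => y yK s sK.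
  by apply: yK; rewrite /= in_itv.
near=> y.
have yK : forall s, - `|t| <= s <= `|t| ->
    `|f (horocycle_flow s x) - f (horocycle_flow s y)| <= e / (`|t| + 1).
  by near: y.
have d s : der (fun s => bint f x s - bint f y s) s
    (f (horocycle_flow s x) - f (horocycle_flow s y)).
  by apply: derB; exact: der_bint.
have le1 : e / (`|t| + 1) * `|t| <= e.
  by rewrite mulrAC ler_pdivrMr ?ltr_wpDl// ler_pM2l// lerDl.
apply: le_trans le1; have [t0|/ltW t0] := leP 0 t.
  have := @der_bound R _ _ (e / (`|t| + 1)) 0 t t0 (fun s _ => d s).
  rewrite !bint0 !subr0 (ger0_norm t0) in yK *; apply => s /andP[s0 st]; apply: yK; lra.
have := @der_bound R _ _ (e / (`|t| + 1)) t 0 t0 (fun s _ => d s).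
rewrite !bint0 subrr !sub0r normrN (ler0_norm t0) in yK *; apply => s /andP[s0 st].
apply: yK; lra.
Unshelve. all: by end_near. Qed.

End Birkhoff.
End Flow.

(** * The shear *)

Section InverseBounds.
Context {R : realType}.
Implicit Types l : R.

Lemma near1_gt0 l : `|1 - l| <= 4^-1 -> 3 / 4 <= l <= 5 / 4.
Proof. by rewrite ler_norml => /andP[? ?]; apply/andP; split; lra. Qed.

Lemma near1_inv_le l : `|1 - l| <= 4^-1 -> 0 < l^-1 <= 2.
Proof.
move=> /near1_gt0/andP[l0 l1]; have lp : 0 < l by lra.
by rewrite invr_gt0 lp /= invf_ple ?posrE//; lra.
Qed.

Lemma near1_inv l : `|1 - l| <= 4^-1 -> `|l^-1 - 1| <= 2 * `|1 - l|.
Proof.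
move=> H; have /andP[l0 l1] := near1_gt0 H; have /andP[i0 i1] := near1_inv_le H.
have -> : l^-1 - 1 = l^-1 * (1 - l) by field; lra.
by rewrite normrM (gtr0_norm i0) ler_wpM2r.
Qed.

Lemma near1_invsq_le l : `|1 - l| <= 4^-1 -> 0 <= l ^- 2 <= 2.
Proof.
move=> H; have /andP[l0 l1] := near1_gt0 H.
have lp : 0 < l by lra.
have i1 : l^-1 <= 4 / 3 by rewrite -[leRHS]invf_div lef_pV2 ?posrE//; lra.
have i0 : 0 <= l^-1 by rewrite invr_ge0 ltW.
rewrite -exprVn exprn_ge0//=.
apply: le_trans (_ : (4 / 3) ^+ 2 <= _); last by lra.
by rewrite ler_pXn2r// nnegrE; lra.
Qed.

Lemma near1_invsq l : `|1 - l| <= 4^-1 -> `|l ^- 2 - 1| <= 5 * `|1 - l|.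
Proof.
move=> H; have /andP[l0 l1] := near1_gt0 H; have /andP[i0 i1] := near1_invsq_le H.
have -> : l ^- 2 - 1 = l ^- 2 * (1 + l) * (1 - l) by field; lra.
rewrite normrM ler_wpM2r// ger0_norm; first nra.
by rewrite mulr_ge0//; lra.
Qed.

Lemma near1_invsq2 l : `|1 - l| <= 4^-1 ->
  `|l ^- 2 - 1 - 2 * (1 - l)| <= 7 * `|1 - l| ^+ 2.
Proof.
move=> H; have /andP[l0 l1] := near1_gt0 H; have /andP[i0 i1] := near1_invsq_le H.
have -> : l ^- 2 - 1 - 2 * (1 - l) = l ^- 2 * (1 + 2 * l) * (1 - l) ^+ 2.
  by field; lra.
rewrite normrM normrX ler_wpM2r ?exprn_ge0// ger0_norm; first nra.
by rewrite mulr_ge0//; lra.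
Qed.

End InverseBounds.

Section Shear.
Context {R : realType} {Gam : set (SL2 R)}.
Hypothesis Gs : subgroup Gam.
Local Notation X := (homspace Gam).
Implicit Types (g : SL2 R) (x : X) (s t c l : R).

Definition ltri c l : SL2 R := sl2 l^-1 0 c l.

Lemma ltriE c l : l != 0 -> (m11 (ltri c l) = l^-1) * (m12 (ltri c l) = 0) *
  (m21 (ltri c l) = c) * (m22 (ltri c l) = l).
Proof. by move=> l0; apply: sl2E; rewrite mulVf// mul0r subr0. Qed.

Definition shear_lam g t := m22 g - m21 g * t.
Definition shear_time g t := (t * m11 g - m12 g) / shear_lam g t.

Lemma shear_mul g t : shear_lam g t != 0 ->
  (horo (shear_time g t) * g)%g = (ltri (m21 g) (shear_lam g t) * horo t)%g.
Proof.
move=> l0; have e := SL2_det g.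
apply: SL2P; rewrite !mulSL2E !horoE !(ltriE (m21 g) l0) /shear_time; move: l0 e; rewrite /shear_lam;
  move: (m11 g) (m12 g) (m21 g) (m22 g) => a b c d l0 e.
- transitivity ((a * d - b * c) / (d - c * t)); first by field.
  by rewrite e; ring.
- transitivity ((a * d - b * c) / (d - c * t) * t); first by field.
  by rewrite e; ring.
- by ring.
- by ring.
Qed.

Lemma shear_flow g x t : shear_lam g t != 0 ->
  horocycle_flow (shear_time g t) (act g x) =
  act (ltri (m21 g) (shear_lam g t)) (horocycle_flow t x).
Proof. by move=> l0; rewrite /horocycle_flow !actM shear_mul. Qed.

(** After the quotient rule the numerator is the determinant of [g], which is 1. *)
Lemma der_shear_time g t : shear_lam g t != 0 ->
  der (shear_time g) t (shear_lam g t ^- 2).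
Proof.
move=> l0; have e := SL2_det g.
have d1 : der (shear_lam g) t (- m21 g).
  by apply: der_eq (derB (der_cst _ _) (derZ _ (der_id _))) _; rewrite mulr1 sub0r.
have d2 : der (fun t => t * m11 g - m12 g) t (m11 g).
  apply: der_eq (derB (derM (der_id _) (der_cst _ _)) (der_cst _ _)) _.
  by rewrite mulr0 addr0 subr0 mul1r.
apply: der_eq (derM d2 (derV l0 d1)) _; move: l0 e {d1 d2}; rewrite /shear_lam;
  move: (m11 g) (m12 g) (m21 g) (m22 g) => a b c d l0 e.
transitivity ((a * d - b * c) / (d - c * t) ^+ 2); first by field.
by rewrite e mul1r.
Qed.

Lemma der_shear (f : X -> R) g x t : continuous f -> shear_lam g t != 0 ->
  der (fun t => bint f (act g x) (shear_time g t)) t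
    (f (act (ltri (m21 g) (shear_lam g t)) (horocycle_flow t x)) *
     shear_lam g t ^- 2).
Proof.
move=> cf l0; rewrite -shear_flow//.
exact: (der_comp (der_shear_time l0) (der_bint Gs cf _ _)).
Qed.

Lemma ltri_close c l r : `|1 - l| <= 4^-1 -> 2 * `|1 - l| < r -> `|c| < r ->
  SL2_close r 1%g (ltri c l).
Proof.
move=> H lr cr; have /andP[l1 _] := near1_gt0 H.
have := near1_inv H; have := normr_ge0 (1 - l) => ? ?.
have l0 : l != 0 by lra.
apply/SL2_closeP; rewrite !oneSL2E !(ltriE _ l0); split.
- by rewrite distrC; lra.
- by rewrite subrr normr0; lra.
- by rewrite sub0r normrN.
- by lra.
Qed.

Lemma shear_lamB g t T r : 0 <= t <= T -> `|m22 g - 1| <= r ->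
  `|m21 g| * T <= r -> `|1 - shear_lam g t| <= 2 * r.
Proof.
move=> /andP[t0 tT] dr cr; rewrite /shear_lam.
have : `|m21 g * t| <= r.
  by apply: le_trans cr; rewrite normrM (ger0_norm t0) ler_wpM2l.
move: dr; rewrite !ler_norml => /andP[? ?] /andP[? ?].
by apply/andP; split; lra.
Qed.

Hypothesis Gc : cocompact Gam.

(* Conjugation by diag(sqrt T, 1 / sqrt T) turns these conditions on g into a
   neighbourhood of 1 that does not depend on T *)
Lemma bint_equicontinuous (f : X -> R) e : continuous f -> 0 < e ->
  exists2 r, 0 < r & forall T g x, 1 <= T ->
    `|m11 g - 1| <= r -> `|m12 g| <= r * T ->
    `|m21 g| * T <= r -> `|m22 g - 1| <= r ->
    `|bint f (act g x) T - bint f x T| <= e * T.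
Proof.
move=> cf e0; have [B B0 fB] := hom_bounded Gc cf.
have e4 : 0 < e / 4 by lra.
have /nbhs_SL2P[r1 r10 r1P] := hom_unif Gs Gc cf e4.
(* [r <= 8^-1] gives [|1 - l| <= 4^-1] along the orbit, [5 * r <= r1] puts [ltri] into the
   neighbourhood from [hom_unif], and [40 * B * r <= e] absorbs the errors 10, 8 and 2 times [B * r]
   found below into [e / 2]. *)
have [r [r0 r8 rr1 rB]] : exists r, [/\ 0 < r, r <= 8^-1, 5 * r <= r1 & 40 * B * r <= e].
  exists (Num.min 8^-1 (Num.min (r1 / 5) (e / (40 * B)))).
  have h1 : 0 < r1 / 5 by lra.
  have h2 : 0 < e / (40 * B) by rewrite divr_gt0// mulr_gt0.
  split; first by rewrite !lt_min h1 h2 andbT /=; lra.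
  - by rewrite ge_min lexx.
  - by rewrite mulrC -ler_pdivlMr// !ge_min lexx !orbT.
  - by rewrite mulrC -ler_pdivlMr ?mulr_gt0// !ge_min lexx !orbT.
exists r => // T g x T1 ar br cr dr.
have T0 : 0 <= T by lra.
have lr t : 0 <= t <= T -> `|1 - shear_lam g t| <= 2 * r.
  by move=> tT; exact: shear_lamB tT dr cr.
have l4 t : 0 <= t <= T -> `|1 - shear_lam g t| <= 4^-1.
  by move=> /lr; lra.
have l0 t : 0 <= t <= T -> shear_lam g t != 0.
  by move=> /l4/near1_gt0/andP[? _]; lra.
have cr' : `|m21 g| < r1.
  have : `|m21 g| <= `|m21 g| * T by rewrite ler_peMr.
  by lra.
have dK t : 0 <= t <= T ->
    der (fun t => bint f (act g x) (shear_time g t) - bint f x t) t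
    (f (act (ltri (m21 g) (shear_lam g t)) (horocycle_flow t x)) *
     shear_lam g t ^- 2 - f (horocycle_flow t x)).
  by move=> /l0 tl; exact: (derB (der_shear _ cf tl) (der_bint Gs cf _ _)).
have bK t : 0 <= t <= T ->
    `|f (act (ltri (m21 g) (shear_lam g t)) (horocycle_flow t x)) *
     shear_lam g t ^- 2 - f (horocycle_flow t x)| <= e / 2 + 10 * B * r.
  move=> tT; set y := horocycle_flow t x; set l := shear_lam g t.
  have ll := lr _ tT; have ll4 := l4 _ tT.
  have /(r1P)/(_ y) /= fy : SL2_close r1 1%g (ltri (m21 g) l).
    by apply: ltri_close => //; rewrite -/l in ll *; lra.
  set z := act _ y in fy *.
  have -> : f z * l ^- 2 - f y = (f z - f y) * l ^- 2 + f y * (l ^- 2 - 1) by ring.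
  apply: le_trans (ler_normD _ _) _; rewrite !normrM; apply: lerD.
    have /andP[i0 i2] := near1_invsq_le ll4; rewrite [`|l ^- 2|]ger0_norm//.
    have -> : e / 2 = e / 4 * 2 by field.
    by apply: ler_pM => //; exact: ltW.
  have -> : 10 * B * r = B * (10 * r) by ring.
  apply: ler_pM => //; apply: le_trans (near1_invsq ll4) _.
  by rewrite -/l in ll; lra.
have TT : 0 <= T <= T by rewrite T0 lexx.
have T00 : 0 <= (0 : R) <= T by rewrite lexx T0.
have := der_bound T0 dK bK; rewrite bint0// subr0 => H.
have H1 : `|bint f (act g x) (shear_time g T) - bint f (act g x) T| <= B * (8 * (r * T)).
  apply: le_trans (bint_lip Gs cf _ _ _ fB) _; rewrite ler_wpM2l ?(ltW B0)//.
  have lT := l0 _ TT.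
  have -> : shear_time g T - T = (shear_lam g T)^-1 *
      (T * (m11 g - 1) + T * (1 - shear_lam g T) - m12 g).
    by rewrite /shear_time; field.
  rewrite normrM; have /andP[i0 i2] := near1_inv_le (l4 _ TT); rewrite (gtr0_norm i0).
  have -> : 8 * (r * T) = 2 * (4 * (r * T)) by ring.
  apply: ler_pM => //; first exact: ltW.
  have n1 : `|T * (m11 g - 1)| <= r * T.
    by rewrite normrM (ger0_norm T0) mulrC ler_wpM2r.
  have n2 : `|T * (1 - shear_lam g T)| <= 2 * (r * T).
    by rewrite normrM (ger0_norm T0) mulrC mulrA ler_wpM2r// lr.
  apply: le_trans (ler_normB _ _) _; apply: le_trans (lerD (le_trans (ler_normD _ _) (lerD n1 n2)) br) _.
  by rewrite le_eqVlt; apply/orP; left; apply/eqP; ring.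
have H2 : `|bint f (act g x) (shear_time g 0)| <= B * (2 * (r * T)).
  apply: le_trans (bint_bound Gs cf _ _ fB) _; rewrite ler_wpM2l ?(ltW B0)//.
  rewrite /shear_time mul0r sub0r mulrC normrM normrN.
  have /andP[i0 i2] := near1_inv_le (l4 _ T00); rewrite (gtr0_norm i0).
  by apply: ler_pM => //; exact: ltW.
(* The substitution yields the integral along the second orbit from s(0) to s(T) instead of from 0
   to [T]; [H2] and [H1] are the costs of moving the two ends. *)
have -> : bint f (act g x) T - bint f x T =
  (bint f (act g x) (shear_time g T) - bint f x T - bint f (act g x) (shear_time g 0))
  - (bint f (act g x) (shear_time g T) - bint f (act g x) T)
  + bint f (act g x) (shear_time g 0) by ring.
have H3 : 40 * B * r * T <= e * T by rewrite ler_wpM2r.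
apply: le_trans (ler_normD _ _) _; apply: le_trans (lerD (le_trans (ler_normB _ _) (lerD H H1)) H2) _.
apply: le_trans (_ : e / 2 * T + 2^-1 * (e * T) <= _); last first.
  by rewrite le_eqVlt; apply/orP; left; apply/eqP; field.
apply: le_trans (_ : e / 2 * T + 2^-1 * (40 * B * r * T) <= _); last by rewrite lerD2l ler_wpM2l// invr_ge0.
by rewrite le_eqVlt; apply/orP; left; apply/eqP; field.
Qed.

End Shear.

(** * Mean convergence of horocycle averages *)

Section Integral.
Context {R : realType} {Gam : set (SL2 R)}.
Hypotheses (Gs : subgroup Gam) (Gc : cocompact Gam).
Local Notation X := (homspace Gam).
Variable mu : probability X R.
Implicit Types (f : X -> R) (g : SL2 R).

Lemma open_hom_measurable (U : set X) : open U -> measurable U.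
Proof. exact: sub_gen_smallest. Qed.

Lemma continuous_hom_measurable f (A : set X) : continuous f -> measurable A ->
  measurable_fun A f.
Proof.
move=> cf mA; apply: measurable_funS (@measurableT _ X) _ _ => // _.
apply: (measurability _ (RGenOInfty.measurableE R)) => // _ [_ [a ->] <-].
rewrite setTI; apply: open_hom_measurable.
by move/continuousP : cf; apply; exact: rray_open.
Qed.

Lemma continuous_hom_integrable f (A : set X) : continuous f -> measurable A ->
  mu.-integrable A (EFin \o f).
Proof.
move=> cf mA; apply: measurable_bounded_integrable => //.
- exact: le_lt_trans (probability_le1 mu mA) (ltry _).
- exact: continuous_hom_measurable.
have [B _ fB] := hom_bounded Gc cf.
by exists B; split; [exact: num_real|move=> M BM x _; apply: le_trans (fB x) (ltW BM)].
Qed.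

Section OnSet.
Variables (A : set X) (mA : measurable A).

Lemma hom_intD f h : continuous f -> continuous h ->
  \int[mu]_(x in A) (f x + h x) = \int[mu]_(x in A) f x + \int[mu]_(x in A) h x.
Proof. by move=> cf ch; rewrite RintegralD//; exact: continuous_hom_integrable. Qed.

Lemma hom_intZ f r : continuous f ->
  \int[mu]_(x in A) (r * f x) = r * \int[mu]_(x in A) f x.
Proof. by move=> cf; rewrite RintegralZl//; exact: continuous_hom_integrable. Qed.

Lemma hom_int_le f h : continuous f -> continuous h -> (forall x, f x <= h x) ->
  \int[mu]_(x in A) f x <= \int[mu]_(x in A) h x.
Proof. by move=> cf ch fh; apply: le_Rintegral => //; exact: continuous_hom_integrable. Qed.

Lemma hom_int_cst r : \int[mu]_(x in A) r = r * fine (mu A).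
Proof. by rewrite Rintegral_cst. Qed.

(** The version over an invariant set [A], and not only over the whole space, serves the proof of
    ergodicity. *)
Lemma hom_int_act f g : SL2_invariant mu -> act g @^-1` A = A -> continuous f ->
  \int[mu]_(x in A) f (act g x) = \int[mu]_(x in A) f x.
Proof.
move=> inv gA cf.
have mg : measurable_fun setT (@act R Gam g).
  move=> _; apply: (@measurability _ _ _ _ setT _ (@open X)) => // _ [U oU <-].
  rewrite setTI; apply: open_hom_measurable.
  by have /continuousP := @act_continuous _ _ Gs g; exact.
pose nu := pushforward mu (@act R Gam g).
rewrite /Rintegral; congr fine.
have -> : (\int[mu]_(x in A) (f (act g x))%:E =
    \int[pushforward mu (@act R Gam g)]_(x in A) (f x)%:E)%E.
  rewrite (@integral_pushforward _ _ _ _ _ _ mg)//.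
  - by rewrite gA.
  - apply/measurable_EFinP.
    exact: continuous_hom_measurable.
  - rewrite gA; apply: (@continuous_hom_integrable (f \o act g)) => // x.
    by apply: continuous_comp; [exact: act_continuous|exact: cf].
apply: eq_measure_integral => B mB _; exact: inv.
Qed.

End OnSet.
End Integral.

(** * Operations on continuous functions *)

Section ContinuousClosure.
Context {R : realType} {T : topologicalType}.
Implicit Types f h : T -> R.

Lemma hcont_cst (r : R) : continuous (fun _ : T => r).
Proof. by move=> x; exact: cvg_cst. Qed.

Lemma hcontD f h : continuous f -> continuous h -> continuous (fun x => f x + h x).
Proof. by move=> cf ch x; apply: cvgD; [exact: cf|exact: ch]. Qed.

Lemma hcontB f h : continuous f -> continuous h -> continuous (fun x => f x - h x).
Proof. by move=> cf ch x; apply: cvgB; [exact: cf|exact: ch]. Qed.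

Lemma hcontM f h : continuous f -> continuous h -> continuous (fun x => f x * h x).
Proof. by move=> cf ch x; apply: cvgM; [exact: cf|exact: ch]. Qed.

Lemma hcontZ (r : R) f : continuous f -> continuous (fun x => r * f x).
Proof. by move=> cf; apply: hcontM => //; exact: hcont_cst. Qed.

Lemma hcont_norm f : continuous f -> continuous (fun x => `|f x|).
Proof. by move=> cf x; apply: cvg_norm; exact: cf. Qed.

Lemma hcont_sum n (F : nat -> T -> R) : (forall i, continuous (F i)) ->
  continuous (fun x => \sum_(i < n) F i x).
Proof.
move=> cF; elim: n => [|n IH].
  by under [X in continuous X]eq_fun do rewrite big_ord0; exact: hcont_cst.
by under [X in continuous X]eq_fun do rewrite big_ord_recr /=; exact: hcontD.
Qed.

End ContinuousClosure.

Lemma exists_nat_ge (R : archiRealFieldType) (x : R) : exists n, x <= n%:R.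
Proof.
exists (Num.bound `|x|); apply: le_trans (ler_norm x) _; apply: ltW.
exact: archi_boundP.
Qed.

Section Mautner.
Context {R : realType} {Gam : set (SL2 R)}.
Hypotheses (Gs : subgroup Gam) (Gc : cocompact Gam).
Local Notation X := (homspace Gam).
Variables (mu : probability X R) (inv : SL2_invariant mu).
Implicit Types (f k : X -> R) (g h : SL2 R) (n m : nat) (e : R).

Lemma hcont_act f g : continuous f -> continuous (fun x => f (act g x)).
Proof.
by move=> cf x; apply: (@continuous_comp _ _ _ (act g) f);
  [exact: act_continuous|exact: cf].
Qed.

Definition nrm1 f := \int[mu]_x `|f x|.
Definition nrm2 f := \int[mu]_x (f x * f x).

Lemma mu1 : fine (mu setT) = 1.
Proof. by rewrite probability_setT. Qed.

Lemma hom_int_one r : \int[mu]_x r = r.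
Proof. by rewrite hom_int_cst// mu1 mulr1. Qed.

Lemma hom_int_actT f g : continuous f -> \int[mu]_x f (act g x) = \int[mu]_x f x.
Proof. by move=> cf; rewrite hom_int_act. Qed.

Lemma nrm1_triangle f k l : continuous f -> continuous k -> continuous l ->
  (forall x, `|f x| <= `|k x| + `|l x|) -> nrm1 f <= nrm1 k + nrm1 l.
Proof.
move=> cf ck cl H; rewrite /nrm1 -hom_intD//; try exact: hcont_norm.
by apply: hom_int_le => //; [exact: hcont_norm|by apply: hcontD; exact: hcont_norm].
Qed.

Lemma nrm1_le f e : continuous f -> (forall x, `|f x| <= e) -> nrm1 f <= e.
Proof.
move=> cf fe; rewrite -[leRHS]hom_int_one.
by apply: hom_int_le => //; [exact: hcont_norm|exact: hcont_cst].
Qed.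

Lemma nrm1_act f g : continuous f -> nrm1 (fun x => f (act g x)) = nrm1 f.
Proof.
move=> cf; rewrite /nrm1 (@hom_int_actT (fun x => `|f x|))//.
exact: hcont_norm.
Qed.

Lemma nrm1_eq f k : (forall x, `|f x| = `|k x|) -> nrm1 f = nrm1 k.
Proof. by move=> fk; apply: eq_Rintegral => x _; rewrite fk. Qed.

(** Takes the place of the Cauchy-Schwarz inequality: pointwise, y <= e + y^2 / e. *)
Lemma nrm1_nrm2 f e : continuous f -> 0 < e -> nrm1 f <= e + e^-1 * nrm2 f.
Proof.
move=> cf e0; have cff := hcontM cf cf.
rewrite -{1}[e]hom_int_one /nrm2 -hom_intZ// -hom_intD//;
  [|exact: hcont_cst|exact: hcontZ].
apply: hom_int_le => //; first exact: hcont_norm.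
  by apply: hcontD; [exact: hcont_cst|exact: hcontZ].
move=> x; rewrite -[f x * f x]expr2 -real_normK ?num_real// expr2; set y := `|f x|.
rewrite -(ler_pM2l e0) mulrDr mulrA mulfV ?gt_eqF// mul1r.
have y0 : 0 <= y by exact: normr_ge0.
rewrite -subr_ge0; have -> : e * e + y * y - e * y = (e - y / 2) ^+ 2 + 3 / 4 * (y * y) by field.
by rewrite addr_ge0 ?sqr_ge0// mulr_ge0// ?mulr_ge0//; lra.
Qed.

Lemma nrm2_ge0 f : 0 <= nrm2 f.
Proof. by apply: Rintegral_ge0 => x _; rewrite -expr2 sqr_ge0. Qed.

Lemma nrm2_near f k B e : continuous f -> continuous k -> 
  (forall x, `|f x| <= B) -> (forall x, `|k x| <= B) ->
  (forall x, `|f x - k x| <= e) -> nrm2 f <= nrm2 k + 2 * B * e.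
Proof.
move=> cf ck fB kB fk; have cff := hcontM cf cf; have ckk := hcontM ck ck.
rewrite -[2 * B * e]hom_int_one -hom_intD//;
  last exact: hcont_cst.
apply: hom_int_le => //; first by apply: hcontD => //; exact: hcont_cst.
move=> x; have -> : f x * f x = k x * k x + (f x - k x) * (f x + k x) by ring.
rewrite lerD2l; apply: le_trans (ler_norm _) _; rewrite normrM mulrC.
apply: ler_pM => //; apply: le_trans (ler_normD _ _) _.
by have := fB x; have := kB x; lra.
Qed.

(** * The mean ergodic theorem for averages at integer times *)

Section Averages.
Variables (k : X -> R) (ck : continuous k) (B : R) (B0 : 0 < B)
  (kB : forall x, `|k x| <= B).

(** Integer times require only finite sums. Applied to the integrals of [f] over unit time, these
    become the averages of [f] over [[0, n]], see [avg_bint]. *)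
Definition avg n f x : R := n%:R^-1 * \sum_(i < n) f (horocycle_flow i%:R x).

Lemma avg_continuous n f : continuous f -> continuous (avg n f).
Proof.
move=> cf; apply: hcontZ; apply: (@hcont_sum _ _ n (fun i x => f (horocycle_flow i%:R x))) => i.
exact: hcont_act.
Qed.

Lemma avg_bound n f C : 0 <= C -> (forall x, `|f x| <= C) -> forall x, `|avg n f x| <= C.
Proof.
move=> C0 fC x; rewrite /avg normrM ger0_norm ?invr_ge0//.
case: n => [|n]; first by rewrite invr0 mul0r.
rewrite mulrC ler_pdivrMr// mulr_natr.
apply: le_trans (ler_norm_sum _ _ _) _.
by rewrite -[X in _ *+ X]card_ord -sumr_const ler_sum.
Qed.

Lemma avg_shift1 n f C x : 0 <= C -> (forall x, `|f x| <= C) ->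
  `|avg n f (horocycle_flow 1 x) - avg n f x| <= n%:R^-1 * (2 * C).
Proof.
move=> C0 fC; rewrite /avg -mulrBr normrM ger0_norm ?invr_ge0// ler_wpM2l ?invr_ge0//.
have -> : \sum_(i < n) f (horocycle_flow i%:R (horocycle_flow 1 x)) -
    \sum_(i < n) f (horocycle_flow i%:R x) =
    f (horocycle_flow n%:R x) - f (horocycle_flow 0%:R x).
  under eq_bigr do rewrite -hflowD natr1.
  rewrite -sumrB -(big_mkord xpredT (fun i => f (horocycle_flow i.+1%:R x) - f (horocycle_flow i%:R x))).
  by rewrite telescope_sumr.
by apply: le_trans (ler_normB _ _) _; rewrite mulr2n mulrDl mul1r lerD.
Qed.

Lemma avg_shift n f C j x : 0 <= C -> (forall x, `|f x| <= C) ->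
  `|avg n f (horocycle_flow j%:R x) - avg n f x| <= n%:R^-1 * (2 * C) * j%:R.
Proof.
move=> C0 fC; elim: j => [|j IH]; first by rewrite hflow0 subrr normr0 mulr0.
rewrite -natr1 mulrDr mulr1 (_ : horocycle_flow (j%:R + 1) x =
  horocycle_flow 1 (horocycle_flow j%:R x)); last by rewrite addrC hflowD.
have := avg_shift1 n (horocycle_flow j%:R x) C0 fC.
move: IH; set u := avg n f x; set v := avg n f (horocycle_flow j%:R x);
  set w := avg n f (horocycle_flow 1 _) => h1 h2.
have -> : w - u = (w - v) + (v - u) by ring.
by apply: le_trans (ler_normD _ _) _; rewrite [leRHS]addrC lerD.
Qed.

Lemma avg_comm n m f x : avg n (avg m f) x = avg m (avg n f) x.
Proof.
rewrite /avg -!mulr_sumr mulrCA; congr (_ * (_ * _)).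
by rewrite exchange_big; do 2 apply: eq_bigr => ? _; rewrite -!hflowD addrC.
Qed.

Lemma avg_drift n m f C x : 0 <= C -> (forall x, `|f x| <= C) -> (0 < m)%N ->
  `|avg m (avg n f) x - avg n f x| <= n%:R^-1 * (2 * C) * m%:R.
Proof.
move=> C0 fC m0; have m0' : (m%:R : R) != 0 by rewrite pnatr_eq0 -lt0n.
have -> : avg m (avg n f) x - avg n f x =
    m%:R^-1 * \sum_(i < m) (avg n f (horocycle_flow i%:R x) - avg n f x).
  rewrite sumrB mulrBr {1}/avg; congr (_ - _).
  by rewrite sumr_const card_ord -(mulr_natl (avg n f x)) mulrA mulVf// mul1r.
rewrite normrM ger0_norm ?invr_ge0// mulrC ler_pdivrMr ?ltr0n//.
apply: le_trans (ler_norm_sum _ _ _) _.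
set A := n%:R^-1 * (2 * C) * m%:R.
have -> : A * m%:R = \sum_(i < m) A by rewrite sumr_const card_ord mulr_natr.
apply: ler_sum => i _; apply: le_trans (avg_shift _ _ _ C0 fC) _.
by rewrite ler_wpM2l ?mulr_ge0 ?invr_ge0// ler_nat ltnW.
Qed.

Lemma hom_int_avg (A : set X) n f : measurable A ->
  (forall t, horocycle_flow t @^-1` A = A) -> continuous f -> (0 < n)%N ->
  \int[mu]_(x in A) avg n f x = \int[mu]_(x in A) f x.
Proof.
move=> mA iA cf n0; have cfi i : continuous (fun x => f (horocycle_flow i x)).
  exact: hcont_act.
have cS m : continuous (fun x => \sum_(i < m) f (horocycle_flow i%:R x)).
  exact: (@hcont_sum _ _ m (fun i x => f (horocycle_flow i%:R x))).
rewrite /avg hom_intZ//.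
suff -> m : \int[mu]_(x in A) (\sum_(i < m) f (horocycle_flow i%:R x)) =
    m%:R * \int[mu]_(x in A) f x.
  by rewrite mulrA mulVf ?mul1r// pnatr_eq0 -lt0n.
elim: m => [|m IH].
  under eq_Rintegral do rewrite big_ord0.
  by rewrite hom_int_cst// !mul0r.
under eq_Rintegral do rewrite big_ord_recr /=.
rewrite hom_intD//; last exact: cS.
rewrite IH (hom_int_act Gs Gc mA inv (iA _))//.
by rewrite -natr1 mulrDl mul1r.
Qed.

(** The variance of the [n] samples at [x] is nonnegative, so the square of the average is at most
    the average of the squares; the latter has the same integral as the square of [f] by
    invariance. *)
Lemma nrm2_avg n f : continuous f -> (0 < n)%N -> nrm2 (avg n f) <= nrm2 f.
Proof.
move=> cf n0; have cff := hcontM cf cf; have ca := @avg_continuous n f cf.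
rewrite /nrm2 -(@hom_int_avg setT n (fun x => f x * f x))//.
apply: hom_int_le => //; [exact: hcontM|exact: (@avg_continuous n (fun x => f x * f x))|].
move=> x; have n0' : 0 < n%:R :> R by rewrite ltr0n.
have sE : \sum_(i < n) f (horocycle_flow i%:R x) = n%:R * avg n f x.
  by rewrite /avg mulrA mulfV ?mul1r// gt_eqF.
set s := avg n f x in sE *; rewrite /avg.
have : 0 <= \sum_(i < n) (f (horocycle_flow i%:R x) - s) ^+ 2.
  by apply: sumr_ge0 => i _; exact: sqr_ge0.
pose S := \sum_(i < n) f (horocycle_flow i%:R x) * f (horocycle_flow i%:R x).
have -> : \sum_(i < n) (f (horocycle_flow i%:R x) - s) ^+ 2 =
    S - 2 * s * (n%:R * s) + n%:R * (s * s).
  rewrite -sE mulr_sumr -sumrB.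
  have -> : n%:R * (s * s) = \sum_(i < n) s * s.
    by rewrite sumr_const card_ord mulr_natl.
  by rewrite -big_split; apply: eq_bigr => i _ /=; ring.
by move=> H; rewrite -/S [_ * S]mulrC ler_pdivlMr//; lra.
Qed.

Lemma nrm2_parallelogram (p q : X -> R) : continuous p -> continuous q ->
  nrm2 (fun x => p x - q x) + 4 * nrm2 (fun x => 2^-1 * (p x + q x)) =
  2 * nrm2 p + 2 * nrm2 q.
Proof.
move=> cp cq; have cpp := hcontM cp cp; have cqq := hcontM cq cq.
have cB := hcontB cp cq; have cBB := hcontM cB cB.
have cD := @hcontZ _ _ (2^-1 : R) _ (hcontD cp cq); have cDD := hcontM cD cD.
rewrite /nrm2 -!hom_intZ// -!hom_intD//; [|exact: hcontZ..].
by apply: eq_Rintegral => x _; field.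
Qed.

(** Up to an error of order [m / n], [avg n k] equals [avg n (avg m k)], and averaging contracts the
    norm. Thus the norms for large [n] come close to their infimum. *)
Lemma nrm2_avg_le n m : (0 < n)%N -> (0 < m)%N ->
  nrm2 (avg n k) <= nrm2 (avg m k) + 2 * B * (n%:R^-1 * (2 * B) * m%:R).
Proof.
move=> n0 m0; have cn := @avg_continuous n k ck; have cm := @avg_continuous m k ck.
have cmn := @avg_continuous m _ cn.
have bn := avg_bound n (ltW B0) kB; have bmn := avg_bound m (ltW B0) bn.
apply: le_trans (nrm2_near cn cmn bn bmn (e := n%:R^-1 * (2 * B) * m%:R) _) _.
  by move=> x; rewrite distrC; apply: avg_drift => //; exact: ltW.
rewrite lerD2r (_ : avg m (avg n k) = avg n (avg m k)); first exact: nrm2_avg.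
by apply/funext => x; exact: avg_comm.
Qed.

(** For [r] far beyond [n] and [m], the average of the midpoint over [r] steps is nearly [avg r k].
    Hence the midpoint, too, has norm at least the infimum, as the parallelogram argument
    requires. *)
Lemma nrm2_avg_half n m r : (0 < n)%N -> (0 < m)%N -> (0 < r)%N ->
  nrm2 (avg r k) <= nrm2 (fun x => 2^-1 * (avg n k x + avg m k x)) +
    2 * B * (r%:R^-1 * (2 * B) * (n%:R + m%:R)).
Proof.
move=> n0 m0 r0; have B0' := ltW B0; have bn i := avg_bound i B0' kB.
have cav i : continuous (avg i k) by exact: avg_continuous.
pose h x := 2^-1 * (avg n k x + avg m k x).
have ch : continuous h by apply: hcontZ; exact: hcontD.
have hB x : `|h x| <= B.
  rewrite normrM ger0_norm ?invr_ge0// mulrC ler_pdivrMr//.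
  by apply: le_trans (ler_normD _ _) _; have := bn n x; have := bn m x; lra.
have hE x : avg r h x = 2^-1 * (avg n (avg r k) x + avg m (avg r k) x).
  rewrite !(avg_comm _ r) /h {1 4 6}/avg -!mulrDr -big_split /= mulrCA; congr (_ * _).
  by rewrite mulr_sumr.
have crh := @avg_continuous r h ch.
apply: le_trans (nrm2_near (cav r) crh (bn r) (avg_bound r B0' hB)
  (e := r%:R^-1 * (2 * B) * (n%:R + m%:R)) _) _; last first.
  by rewrite lerD2r; exact: nrm2_avg.
move=> x; rewrite hE.
have h1 := avg_drift r x B0' kB n0; have h2 := avg_drift r x B0' kB m0.
have b0 : 0 <= r%:R^-1 * (2 * B) by rewrite mulr_ge0 ?invr_ge0// mulr_ge0.
have n0' : 0 <= r%:R^-1 * (2 * B) * n%:R by rewrite mulr_ge0.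
have m0' : 0 <= r%:R^-1 * (2 * B) * m%:R by rewrite mulr_ge0.
rewrite (mulrDr (r%:R^-1 * (2 * B))); set u := _ * n%:R in n0' h1 *; set v := _ * m%:R in m0' h2 *.
move: h1 h2; rewrite !ler_norml => /andP[? ?] /andP[? ?].
by apply/andP; split; lra.
Qed.

Lemma avg_cauchy2 e : 0 < e -> exists2 n0, (0 < n0)%N & forall n m,
  (n0 <= n)%N -> (n0 <= m)%N -> nrm2 (fun x => avg n k x - avg m k x) <= e.
Proof.
move=> e0.
(* By the parallelogram identity, averages whose norm is close to the infimum
   are close to each other *)
pose S := [set nrm2 (avg n k) | n in [set n | (0 < n)%N]].
have hS : has_inf S.
  split; first by exists (nrm2 (avg 1 k)), 1%N.
  by exists 0 => _ [n _ <-]; exact: nrm2_ge0.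
have lbS n : (0 < n)%N -> inf S <= nrm2 (avg n k).
  by move=> n0; apply: ge_inf; [case: hS|exists n].
(* Each of the two averages exceeds the infimum by at most twice [e / 8], once for [m0] and once for
   the drift; the parallelogram identity doubles both excesses, which makes [e]. *)
have e80 : 0 < e / 8 by lra.
have [_ [m0 /= m00 <-] mS] := inf_adherent e80 hS.
have [n0 n00 n0P] : exists2 n0, (0 < n0)%N &
    forall n, (n0 <= n)%N -> 2 * B * (n%:R^-1 * (2 * B) * m0%:R) <= e / 8.
  have [n0 H] : exists n0, 2 * B * (2 * B) * m0%:R / (e / 8) <= n0%:R.
    exact: exists_nat_ge.
  exists n0.+1 => // n nn; have n0' : (0 : R) < n%:R by rewrite ltr0n (leq_trans _ nn).
  have -> : 2 * B * (n%:R^-1 * (2 * B) * m0%:R) = 2 * B * (2 * B) * m0%:R / n%:R by ring.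
  rewrite ler_pdivrMr// [leRHS]mulrC -ler_pdivrMr//; apply: le_trans H _.
  by rewrite ler_nat ltnW.
exists n0 => // n m nn nm.
have np := leq_trans n00 nn; have mp := leq_trans n00 nm.
have cn := @avg_continuous n k ck; have cm := @avg_continuous m k ck.
have H1 : nrm2 (avg n k) <= nrm2 (avg m0 k) + e / 8.
  by apply: le_trans (nrm2_avg_le np m00) _; rewrite lerD2l; exact: n0P.
have H2 : nrm2 (avg m k) <= nrm2 (avg m0 k) + e / 8.
  by apply: le_trans (nrm2_avg_le mp m00) _; rewrite lerD2l; exact: n0P.
have H3 : inf S <= nrm2 (fun x => 2^-1 * (avg n k x + avg m k x)).
  apply/ler_addgt0Pr => d d0.
  have [r H] : exists r, 2 * B * (2 * B) * (n%:R + m%:R) / d <= r%:R.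
    exact: exists_nat_ge.
  apply: le_trans (lbS r.+1 _) _ => //; apply: le_trans (nrm2_avg_half np mp _) _ => //.
  rewrite lerD2l.
  have -> : 2 * B * (r.+1%:R^-1 * (2 * B) * (n%:R + m%:R)) =
    2 * B * (2 * B) * (n%:R + m%:R) / r.+1%:R by ring.
  rewrite ler_pdivrMr// [leRHS]mulrC -ler_pdivrMr//; apply: le_trans H _.
  by rewrite ler_nat.
have := nrm2_parallelogram cn cm; lra.
Qed.

Lemma avg_cauchy1 e : 0 < e -> exists2 n0, (0 < n0)%N & forall n m,
  (n0 <= n)%N -> (n0 <= m)%N -> nrm1 (fun x => avg n k x - avg m k x) <= e.
Proof.
move=> e0; have e2 : 0 < e / 2 by lra.
have [n0 n00 n0P] := avg_cauchy2 (mulr_gt0 e2 e2).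
exists n0 => // n m nn nm.
have cnm := hcontB (@avg_continuous n k ck) (@avg_continuous m k ck).
apply: le_trans (nrm1_nrm2 cnm e2) _.
have : (e / 2)^-1 * nrm2 (fun x => avg n k x - avg m k x) <= e / 2.
  by rewrite ler_pdivrMl//; exact: n0P.
lra.
Qed.

End Averages.
End Mautner.

(** * The Mautner phenomenon *)

Section Invariance.
Context {R : realType} {Gam : set (SL2 R)}.
Hypotheses (Gs : subgroup Gam) (Gc : cocompact Gam).
Local Notation X := (homspace Gam).
Variables (mu : probability X R) (inv : SL2_invariant mu).
Variables (k : X -> R) (ck : continuous k) (B : R) (B0 : 0 < B)
  (kB : forall x, `|k x| <= B).
Implicit Types (g h : SL2 R) (n m : nat) (e : R).

Let ca n : continuous (avg n k).
Proof. exact: avg_continuous. Qed.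

Let cag n g : continuous (fun x => avg n k (act g x)).
Proof. exact: hcont_act. Qed.

(** No limit of the averages is formed: its invariance under [g] is expressed by the decay of this
    defect, which is subadditive and symmetric in [g] because [mu] is invariant. *)
Definition defect n g := nrm1 mu (fun x => avg n k (act g x) - avg n k x).

Lemma defectM n g h : defect n (g * h)%g <= defect n g + defect n h.
Proof.
rewrite /defect.
rewrite -(@nrm1_act _ _ Gs Gc mu inv (fun x => avg n k (act g x) - avg n k x) h);
  last exact: hcontB.
have cgh := @hcont_act _ _ Gs _ h (hcontB (@cag n g) (@ca n)).
apply: nrm1_triangle => //; [exact: hcontB|exact: hcontB|].
move=> x; rewrite -actM; apply: le_trans (ler_normD _ _).
by rewrite addrA subrK.
Qed.

Lemma defectV n g : defect n (g^-1)%g = defect n g.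
Proof.
rewrite /defect -(@nrm1_act _ _ Gs Gc mu inv _ g); last exact: hcontB.
by apply: nrm1_eq => x; rewrite act_invK distrC.
Qed.

Lemma defect_le n m g :
  defect n g <= defect m g + 2 * nrm1 mu (fun x => avg n k x - avg m k x).
Proof.
have cd := hcontB (@ca n) (@ca m).
have cg := @hcont_act _ _ Gs _ g cd.
have -> : 2 * nrm1 mu (fun x => avg n k x - avg m k x) =
    nrm1 mu (fun x => avg n k (act g x) - avg m k (act g x)) +
    nrm1 mu (fun x => avg n k x - avg m k x).
  by rewrite (@nrm1_act _ _ Gs Gc mu inv _ g cd) mulr2n mulrDl !mul1r.
pose l x := `|avg n k (act g x) - avg m k (act g x)| + `|avg n k x - avg m k x|.
have cl : continuous l by apply: hcontD; exact: hcont_norm.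
apply: le_trans (_ : defect m g + nrm1 mu l <= _).
  apply: nrm1_triangle => //; [exact: hcontB|exact: hcontB|].
  move=> x; rewrite [`|l x|]ger0_norm ?addr_ge0//.
  have -> : avg n k (act g x) - avg n k x = (avg m k (act g x) - avg m k x) +
    ((avg n k (act g x) - avg m k (act g x)) - (avg n k x - avg m k x)) by ring.
  by apply: le_trans (ler_normD _ _) _; rewrite lerD2l ler_normB.
rewrite lerD2l; have cdn := hcont_norm cd; have cgn := hcont_norm cg.
rewrite -[in leRHS](@nrm1_eq _ _ mu _ _ (fun x => normr_id (avg n k (act g x) - avg m k (act g x)))).
rewrite -[X in _ <= _ + X](@nrm1_eq _ _ mu _ _ (fun x => normr_id (avg n k x - avg m k x))).
apply: nrm1_triangle => // x.
by rewrite [`|l x|]ger0_norm ?addr_ge0// !normr_id.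
Qed.

Lemma defect_near1 n e : 0 < e ->
  exists2 r, 0 < r & forall g, SL2_close r 1%g g -> defect n g <= e.
Proof.
move=> e0; have /nbhs_SL2P[r r0 rP] := hom_unif Gs Gc (@ca n) e0.
exists r => // g /rP /= gP; apply: nrm1_le => //; first exact: hcontB.
by move=> x; apply: ltW.
Qed.

Lemma defect_horo_nat n j : (0 < n)%N -> defect n (horo j%:R) <= 2 * B * j%:R / n%:R.
Proof.
move=> n0; apply: nrm1_le => //; first exact: hcontB.
move=> x; apply: le_trans (avg_shift n j x (ltW B0) kB) _.
by rewrite le_eqVlt; apply/orP; left; apply/eqP; ring.
Qed.

Lemma defectM4 n (a b c d : SL2 R) (x y : R) : defect n a <= x -> defect n b <= y ->
  defect n c <= x -> defect n d <= y -> defect n (a * b * c * d^-1)%g <= 2 * (x + y).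
Proof.
move=> ax by' cx dy; apply: le_trans (defectM _ _ _) _; rewrite defectV.
have -> : 2 * (x + y) = x + y + x + y by ring.
apply: lerD => //; apply: le_trans (defectM _ _ _) _; apply: lerD => //.
by apply: le_trans (defectM _ _ _) _; exact: lerD.
Qed.

Definition vanishing g :=
  forall e, 0 < e -> exists n0, forall n, (n0 <= n)%N -> defect n g <= e.

Lemma vanishingM g h : vanishing g -> vanishing h -> vanishing (g * h)%g.
Proof.
move=> vg vh e e0; have e2 : 0 < e / 2 by lra.
have [n1 n1P] := vg _ e2; have [n2 n2P] := vh _ e2.
exists (maxn n1 n2) => n; rewrite geq_max => /andP[h1 h2].
apply: le_trans (defectM _ _ _) _; have := n1P _ h1; have := n2P _ h2; lra.
Qed.

Lemma vanishingV g : vanishing g -> vanishing (g^-1)%g.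
Proof. by move=> vg e /vg[n0 H]; exists n0 => n /H; rewrite defectV. Qed.

Lemma vanishing_horo_nat j : vanishing (horo j%:R).
Proof.
move=> e e0; have [n0 H] := exists_nat_ge (2 * B * j%:R / e).
exists n0.+1 => n nn; have np : (0 < n)%N by exact: leq_trans nn.
have np' : 0 < n%:R :> R by rewrite ltr0n.
apply: le_trans (defect_horo_nat _ np) _.
rewrite ler_pdivrMr// [leRHS]mulrC -ler_pdivrMr//; apply: le_trans H _.
by rewrite ler_nat ltnW.
Qed.

(** Translates of [avg n k - avg m k] have the same norm, so the bound is uniform in [g]. Smallness
    near 1 at the single index [n0], which is mere continuity, is thereby transferred to all later
    indices. *)
Lemma defect_cauchy e : 0 < e -> exists2 n0, (0 < n0)%N & forall n m g,
  (n0 <= n)%N -> (n0 <= m)%N -> defect n g <= defect m g + e.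
Proof.
move=> e0; have e2 : 0 < e / 2 by lra.
have [n0 n00 n0P] := avg_cauchy1 Gs Gc inv ck B0 kB e2.
exists n0 => // n m g nn nm; apply: le_trans (defect_le n m g) _.
by rewrite lerD2l -ler_pdivlMl// mulrC; exact: n0P.
Qed.

(* Mautner phenomenon: [diag(2, 1/2)] is a product of horocyclic elements and
   of elements arbitrarily close to the identity *)
Lemma vanishing_dil2 : vanishing (dil 2^-1).
Proof.
move=> e e0; have e8 : 0 < e / 8 by lra.
have [n0 n00 n0P] := defect_cauchy e8.
have [r r0 rP] := defect_near1 n0 e8.
have [m mP] := exists_nat_ge (r^-1).
have m1 : 0 < m.+1%:R :> R by [].
have mr : (m.+1%:R)^-1 < r.
  rewrite invf_plt ?posrE//; apply: le_lt_trans mP _; by rewrite ltr_nat.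
(* This [c] makes the upper left entry of [horo (2 * m.+1)%:R * vert c] equal to 2;
   [vert (- (c / 2))] then clears the lower left entry and the last factor the upper right one. The
   horocyclic times are integers because only these are known to be vanishing so far. *)
pose c : R := (2 * m.+1%:R)^-1.
have vsmall d : `|d| < r -> forall n, (n0 <= n)%N -> defect n (vert d) <= e / 4.
  move=> dr n nn; apply: le_trans (n0P n n0 _ nn (leqnn _)) _.
  have : defect n0 (vert d) <= e / 8; last by lra.
  apply: rP; apply/SL2_closeP; rewrite !oneSL2E !vertE !subrr normr0.
  by rewrite sub0r normrN.
have cr : `|c| < r.
  apply: le_lt_trans mr; rewrite ger0_norm ?invr_ge0// lef_pV2 ?posrE ?mulr_gt0//.
  by rewrite ler_peMl// ler1n.
have c2r : `|- (c / 2)| < r.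
  apply: le_lt_trans cr; rewrite normrN normrM [`|2^-1|]ger0_norm ?invr_ge0//.
  by rewrite ler_piMr// invf_le1// ler1n.
have E : dil 2^-1 = (vert (- (c / 2)) * horo (2 * m.+1)%:R * vert c *
    (horo m.+1%:R)^-1)%g :> SL2 R.
  apply: (mulIg (horo m.+1%:R)); rewrite mulgVK.
  have h0 : (2^-1 : R) != 0 by rewrite invr_eq0.
  by apply: SL2P; rewrite !mulSL2E !horoE !vertE !(dilE h0) /c natrM; field.
have [n1 n1P] := vanishing_horo_nat (2 * m.+1) e8.
have [n2 n2P] := vanishing_horo_nat m.+1 e8.
exists (maxn n0 (maxn n1 n2)) => n; rewrite !geq_max => /andP[h0 /andP[h1 h2]].
rewrite E; have -> : e = 2 * (e / 4 + e / 4) by field.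
have n1P' : defect n (horo (2 * m.+1)%:R) <= e / 4 by apply: le_trans (n1P _ h1) _; lra.
have n2P' : defect n (horo m.+1%:R) <= e / 4 by apply: le_trans (n2P _ h2) _; lra.
exact: defectM4 (vsmall _ c2r _ h0) n1P' (vsmall _ cr _ h0) n2P'.
Qed.

Lemma dilM (a b : R) : a != 0 -> b != 0 -> dil (a * b) = (dil a * dil b)%g.
Proof.
move=> a0 b0; have ab0 : a * b != 0 by rewrite mulf_neq0.
by apply: SL2P; rewrite !mulSL2E !(dilE ab0) !(dilE a0) !(dilE b0); field;
  rewrite ?a0 ?b0.
Qed.

Lemma vanishing_dil j : vanishing (dil (2^-1 ^+ j)).
Proof.
elim: j => [|j IH].
  have -> : dil (2^-1 ^+ 0) = horo 0%:R :> SL2 R.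
    by apply: SL2P; rewrite !horoE !(dilE (oner_neq0 R)) ?invr1.
  exact: vanishing_horo_nat.
rewrite exprS dilM ?expf_neq0//.
exact: (vanishingM vanishing_dil2 IH).
Qed.

(** The defect of [g] is at most that of its conjugate plus twice that of [a], and the conjugate is
    controlled by its closeness to 1. *)
Lemma vanishing_conj g : (forall r, 0 < r -> exists2 a, vanishing a &
  SL2_close r 1%g (a * g * a^-1)%g) -> vanishing g.
Proof.
move=> H e e0; have e4 : 0 < e / 4 by lra.
have [n0 n00 n0P] := defect_cauchy e4; have [r r0 rP] := defect_near1 n0 e4.
have [a va aP] := H _ r0; have [n1 n1P] := va _ e4.
exists (maxn n0 n1) => n; rewrite geq_max => /andP[h0 h1].
have -> : g = (a^-1 * (a * g * a^-1) * a)%g by rewrite -!mulgA mulVg mulg1 mulKg.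
have := defectM n (a^-1 * (a * g * a^-1))%g a; have := defectM n (a^-1)%g (a * g * a^-1)%g.
rewrite defectV; have := n1P _ h1; have := n0P _ _ (a * g * a^-1)%g h0 (leqnn n0).
have := rP _ aP; lra.
Qed.

Lemma exists_half_pow (r x : R) : 0 < r -> exists j, `|2^-1 ^+ j * (2^-1 ^+ j) * x| < r.
Proof.
move=> r0; have [j jP] := exists_nat_ge (`|x| / r).
exists j.+1; rewrite normrM ger0_norm ?mulr_ge0 ?exprn_ge0 ?invr_ge0//.
rewrite exprVn -invfM mulrC ltr_pdivrMr ?mulr_gt0 ?exprn_gt0//.
rewrite -ltr_pdivrMl// mulrC; apply: le_lt_trans jP _.
have h1 : j.+1%:R <= 2 ^+ j.+1 :> R by rewrite -natrX ler_nat ltnW// ltn_expl.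
have h2 : 1 <= 2 ^+ j.+1 :> R by rewrite exprn_ege1// ler1n.
apply: lt_le_trans (_ : j.+1%:R <= _); first by rewrite ltr_nat.
by apply: le_trans h1 _; rewrite ler_peMr// (le_trans ler01).
Qed.

Lemma vanishing_vert c : vanishing (vert c).
Proof.
apply: vanishing_conj => r r0; have [j jP] := exists_half_pow c r0.
exists (dil (2^-1 ^+ j)); first exact: vanishing_dil.
have a0 : (2^-1 ^+ j : R) != 0 by rewrite expf_neq0.
have -> : (dil (2^-1 ^+ j) * vert c * (dil (2^-1 ^+ j))^-1)%g =
    vert (2^-1 ^+ j * 2^-1 ^+ j * c) :> SL2 R.
  apply: (mulIg (dil (2^-1 ^+ j))); rewrite mulgVK.
  move: (2^-1 ^+ j) a0 => a a0.
  by apply: SL2P; rewrite !mulSL2E !vertE !(dilE a0); field.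
by apply/SL2_closeP; rewrite !oneSL2E !vertE !subrr normr0 sub0r normrN.
Qed.

(** Telescoping only handles integer times. For real [s], the diagonal elements, already known to be
    vanishing, contract the horocyclic element to 1. *)
Lemma vanishing_horo s : vanishing (horo s).
Proof.
apply: vanishing_conj => r r0; have [j jP] := exists_half_pow s r0.
exists ((dil (2^-1 ^+ j))^-1)%g; first by apply: vanishingV; exact: vanishing_dil.
have a0 : (2^-1 ^+ j : R) != 0 by rewrite expf_neq0.
have -> : ((dil (2^-1 ^+ j))^-1 * horo s * (dil (2^-1 ^+ j))^-1^-1)%g =
    horo (2^-1 ^+ j * 2^-1 ^+ j * s) :> SL2 R.
  rewrite invgK -mulgA; apply: (mulgI (dil (2^-1 ^+ j))); rewrite mulVKg.
  move: (2^-1 ^+ j) a0 => a a0.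
  by apply: SL2P; rewrite !mulSL2E !horoE !(dilE a0); field.
by apply/SL2_closeP; rewrite !oneSL2E !horoE !subrr normr0 sub0r normrN.
Qed.

Lemma vanishing_all g : vanishing g.
Proof.
(* With a nonzero lower left entry, [h] is a product of an upper, a lower and an upper unipotent
   element; if the entry of [g] is zero, multiplication by [vert 1] makes it nonzero. *)
have low h : m21 h != 0 -> vanishing h.
  move=> c0; have e := SL2_det h.
  have -> : h = (horo ((m11 h - 1) / m21 h) * vert (m21 h) *
      horo ((m22 h - 1) / m21 h))%g.
    apply: SL2P; rewrite !mulSL2E !horoE !vertE; try by field.
    apply: (mulfI c0); transitivity (m11 h * m22 h - 1); last by field.
    by rewrite -e; ring.
  exact: vanishingM (vanishingM (@vanishing_horo _) (@vanishing_vert _)) (@vanishing_horo _).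
have [c0|] := eqVneq (m21 g) 0; last exact: low.
have -> : g = ((vert 1)^-1 * (vert 1 * g))%g by rewrite mulKg.
apply: (vanishingM (vanishingV (@vanishing_vert 1))); apply: low; rewrite m21M !vertE c0 mulr0 addr0 mul1r.
by have := SL2_det g; rewrite c0 mulr0 subr0; apply: contra_eq_neq => ->; rewrite mul0r eq_sym oner_eq0.
Qed.

(** The threshold is that of [defect_cauchy] and so does not depend on [g]. This matters because [g]
    will be conjugated by an element that varies with [n]. *)
Lemma vanishing_uniform e : 0 < e ->
  exists2 n0, (0 < n0)%N & forall n g, (n0 <= n)%N -> defect n g <= e.
Proof.
move=> e0; have e2 : 0 < e / 2 by lra.
have [n0 n00 n0P] := defect_cauchy e2; exists n0 => // n g nn.
have [n1 n1P] := vanishing_all g e2.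
have := n0P n (maxn n0 n1) g nn (leq_maxl _ _); have := n1P _ (leq_maxr n0 n1); lra.
Qed.

End Invariance.

(** * Unique ergodicity *)

Section Support.
Context {R : realType} {Gam : set (SL2 R)}.
Hypotheses (Gs : subgroup Gam) (Gc : cocompact Gam).
Local Notation X := (homspace Gam).
Variables (mu : probability X R) (inv : SL2_invariant mu).

(* The null sets are directed, so by compactness a null open set, whose
   translates cover the space, would make the whole space null *)
Lemma open_hom_gt0 (U : set X) x : open U -> U x -> (0 < mu U)%E.
Proof.
move=> oU Ux; rewrite lt_neqAle measure_ge0 andbT eq_sym; apply/negP => /eqP U0.
pose null := [set N : set X | measurable N /\ mu N = 0%E].
pose F := filter_from null (fun N => [set M | N `<=` M]).
have FF : Filter F.
  apply: filter_from_filter; first by exists set0; split.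
  move=> A B [mA A0] [mB B0]; exists (A `|` B); last first.
    by move=> M ABM; split; apply: subset_trans ABM; [exact: subsetUl|exact: subsetUr].
  by split; [exact: measurableU|rewrite measureU0].
have := @near_hom _ _ Gc _ F (fun N x => N x) FF.
case=> [y|N [mN N0] /(_ N)].
  pose g : SL2 R := (repr y * (repr x)^-1)%g.
  have gx : act g x = y.
    by rewrite -[x in act _ x]cls_repr act_cls mulgVK cls_repr.
  pose V := act (g^-1)%g @^-1` U.
  have oV : open V by have /continuousP := @act_continuous _ _ Gs (g^-1)%g; exact.
  exists (V, [set M | V `<=` M]); last by move=> [z M] /= [Vz]; exact.
  split => /=.
    by apply: open_nbhs_nbhs; split => //; rewrite /V /= -gx act_invK.
  exists V => //; split; first exact: open_hom_measurable.
  by rewrite /= /V inv//; exact: open_hom_measurable.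
move=> /(_ (@subset_refl _ N)) NT.
have := probability_setT mu; rewrite (_ : setT = N); last by apply/esym/seteqP; split.
by rewrite N0 => /esym/eqP; rewrite onee_eq0.
Qed.

Lemma nrm1_lower (h : X -> R) (E : set X) (c : R) : continuous h -> open E ->
  0 <= c -> (forall x, E x -> c <= `|h x|) -> c * fine (mu E) <= nrm1 mu h.
Proof.
move=> ch oE c0 cE; have mE := open_hom_measurable oE.
rewrite -hom_int_cst// /nrm1; have cn := hcont_norm ch.
apply: le_trans (_ : \int[mu]_(x in E) `|h x| <= _).
  by apply: le_Rintegral => //; apply: continuous_hom_integrable => //; exact: hcont_cst.
have := @Rintegral_ge0 _ _ _ mu (~` E) (fun x => `|h x|) (fun x _ => normr_ge0 _).
rewrite -(setUv E) Rintegral_setU//; first by rewrite lerDl.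
- exact: measurableC.
- by rewrite setUv; exact: continuous_hom_integrable.
- by apply/disj_setPCl.
Qed.

End Support.

(** * Equidistribution of all orbits, uniformly in the starting point *)

Section Equidistribution.
Context {R : realType} {Gam : set (SL2 R)}.
Hypotheses (Gs : subgroup Gam) (Gc : cocompact Gam).
Local Notation X := (homspace Gam).
Variables (mu : probability X R) (inv : SL2_invariant mu).
Variables (f : X -> R) (cf : continuous f).

Let k x := bint f x 1.

Let ck : continuous k.
Proof. exact: bint_continuous. Qed.

Lemma avg_bint n x : avg n k x = n%:R^-1 * bint f x n%:R.
Proof.
rewrite /avg; congr (_ * _); elim: n => [|n IH].
  by rewrite big_ord0 bint0.
by rewrite big_ord_recr /= IH -natr1 bintD.
Qed.

(** A replacement for Fubini: by invariance the integral of [bint f x t] is additive over the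
    multiples of a short time [d], and for small [d] the quotient [bint f x d / d] is uniformly
    close to [f x]. *)
Lemma hom_int_bint (A : set X) : measurable A ->
  (forall t, horocycle_flow t @^-1` A = A) ->
  \int[mu]_(x in A) bint f x 1 = \int[mu]_(x in A) f x.
Proof.
move=> mA iA; set J := \int[mu]_(x in A) f x.
have muA1 : 0 <= fine (mu A) <= 1.
  rewrite fine_ge0//= -[leRHS]/(fine 1%E) fine_le//.
  - by rewrite ge0_fin_numE// (le_lt_trans (probability_le1 _ mA)) ?ltry.
  - exact: probability_le1.
have cb t : continuous (fun x => bint f x t) by exact: bint_continuous.
suff H : `|\int[mu]_(x in A) bint f x 1 - J| <= 0.
  by apply/eqP; rewrite -subr_eq0 -normr_le0.
apply/ler_addgt0Pr => e e0; rewrite add0r.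
have /nbhs_SL2P[r r0 rP] := hom_unif Gs Gc cf e0.
have [m mP] := exists_nat_ge (r^-1).
pose d : R := (m.+1%:R)^-1.
have d0 : 0 < d by rewrite invr_gt0.
have dr : d < r.
  by rewrite invf_plt ?posrE//; apply: le_lt_trans mP _; rewrite ltr_nat.
have md : m.+1%:R * d = 1 by rewrite mulfV.
have near_f x : `|m.+1%:R * bint f x d - f x| <= e.
  have dG t : 0 <= t <= d -> der (fun t => bint f x t - t * f x) t
      (f (horocycle_flow t x) - f x).
    move=> _; apply: der_eq (derB (der_bint Gs cf _ _) (derM (der_id _) (der_cst _ _))) _.
    by rewrite mulr0 addr0 mul1r.
  have bG t : 0 <= t <= d -> `|f (horocycle_flow t x) - f x| <= e.
    move=> /andP[t0 td]; apply/ltW/rP/SL2_closeP.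
    rewrite !oneSL2E !horoE !subrr normr0 sub0r normrN ger0_norm//.
    by rewrite (le_lt_trans td).
  have := der_bound (ltW d0) dG bG; rewrite bint0// mul0r !subr0 => H.
  have -> : m.+1%:R * bint f x d - f x = m.+1%:R * (bint f x d - d * f x).
    by rewrite mulrBr mulrA md mul1r.
  by rewrite normrM ger0_norm// mulrC -ler_pdivlMr// -/d mulrC.
have intd n : \int[mu]_(x in A) bint f x (n%:R * d) =
    n%:R * \int[mu]_(x in A) bint f x d.
  elim: n => [|n IH].
    under eq_Rintegral do rewrite mul0r bint0//.
    by rewrite hom_int_cst// !mul0r.
  under eq_Rintegral do rewrite -natr1 mulrDl mul1r bintD//.
  have cbd := @hcont_act _ _ Gs (fun x => bint f x d) (horo (n%:R * d)) (cb d).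
  rewrite (hom_intD Gc mu mA (cb (n%:R * d)) cbd).
  rewrite IH (@hom_int_act _ _ Gs Gc mu A mA (fun x => bint f x d) (horo (n%:R * d)) inv (iA _) (cb d)).
  by rewrite -natr1 mulrDl mul1r.
have -> : \int[mu]_(x in A) bint f x 1 = \int[mu]_(x in A) (m.+1%:R * bint f x d).
  by have := intd m.+1; rewrite md => ->; rewrite (hom_intZ Gc mu mA _ (cb d)).
have cm := @hcontZ _ _ (m.+1%:R : R) _ (cb d).
have eA : e * fine (mu A) <= e by have /andP[? ?] := muA1; rewrite ler_piMr ?(ltW e0).
rewrite ler_norml; apply/andP; split.
  rewrite lerBrDr addrC; apply: le_trans (_ : J + - e * fine (mu A) <= _).
    by rewrite lerD2l mulNr lerN2.
  rewrite -hom_int_cst// /J -hom_intD//; last exact: hcont_cst.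
  apply: hom_int_le => //; first by apply: hcontD => //; exact: hcont_cst.
  by move=> x; have := near_f x; rewrite ler_norml => /andP[? ?]; lra.
rewrite lerBlDr addrC; apply: le_trans (_ : J + e * fine (mu A) <= _); last first.
  by rewrite lerD2l.
rewrite -hom_int_cst// /J -hom_intD//; last exact: hcont_cst.
apply: hom_int_le => //; first by apply: hcontD => //; exact: hcont_cst.
by move=> x; have := near_f x; rewrite ler_norml => /andP[? ?]; lra.
Qed.

(** Conjugation by [dn n] multiplies the upper right entry by [n] and divides the lower left one by
    [n]: these are the scales of [bint_equicontinuous] at time [n]. *)
Let dn n : SL2 R := dil (Num.sqrt n%:R)^-1.
Let F n x := avg n k (act (dn n) x).

Let F_equicontinuous e : 0 < e -> exists2 r, 0 < r & forall n g x, (0 < n)%N ->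
  SL2_close r 1%g g -> `|F n (act g x) - F n x| <= e.
Proof.
move=> e0; have [r r0 rP] := bint_equicontinuous Gs Gc cf e0.
exists r => // n g x n0 /SL2_closeP; rewrite !oneSL2E => -[g11 g12 g21 g22].
have n0' : 0 < n%:R :> R by rewrite ltr0n.
have n1 : 1 <= n%:R :> R by rewrite ler1n.
have s0 : Num.sqrt n%:R != 0 :> R by rewrite gt_eqF// sqrtr_gt0.
have s20 : (Num.sqrt n%:R)^-1 != 0 :> R by rewrite invr_eq0.
have ss : Num.sqrt n%:R * Num.sqrt n%:R = n%:R :> R by rewrite -expr2 sqr_sqrtr// ltW.
pose a : R := Num.sqrt n%:R; rewrite -/a in s0 s20 ss.
pose g' : SL2 R := sl2 (m11 g) (n%:R * m12 g) (m21 g / n%:R) (m22 g).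
have dg' : m11 g * m22 g - n%:R * m12 g * (m21 g / n%:R) = 1.
  by rewrite -[RHS](SL2_det g); field; rewrite gt_eqF.
have E : (dil a^-1 * g = g' * dil a^-1)%g.
  apply: SL2P; rewrite !mulSL2E !(dilE s20) !(sl2E dg') -?ss; by field.
rewrite /F /dn -/a actM E -actM !avg_bint -mulrBr normrM ger0_norm ?invr_ge0//.
rewrite mulrC ler_pdivrMr//; apply: rP => //; rewrite !(sl2E dg').
- by rewrite distrC ltW.
- by move: g12; rewrite sub0r normrN normrM (ger0_norm (ltW n0')) mulrC => /ltW g12; rewrite ler_wpM2r// ltW.
- move: g21; rewrite sub0r normrN normrM (@ger0_norm _ n%:R^-1) ?invr_ge0 ?(ltW n0')//.
  by rewrite mulrVK ?unitfE ?gt_eqF// => /ltW.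
- by rewrite distrC ltW.
Qed.

Let cF n : continuous (F n).
Proof. by apply: (hcont_act Gs); exact: avg_continuous. Qed.

Let F_invariant e : 0 < e -> exists2 n0, (0 < n0)%N & forall n g, (n0 <= n)%N ->
  nrm1 mu (fun x => F n (act g x) - F n x) <= e.
Proof.
have [B B0 kB] := hom_bounded Gc ck.
move=> /(vanishing_uniform Gs Gc inv ck B0 kB)[n0 n00 n0P].
exists n0; first exact: n00.
move=> n g nn; set d := dn n.
have cn : continuous (avg n k) by exact: avg_continuous.
apply: le_trans (n0P n (d * g * d^-1)%g nn); rewrite /defect.
rewrite -(@nrm1_act _ _ Gs Gc mu inv
  (fun x => avg n k (act (d * g * d^-1)%g x) - avg n k x) d); last first.
  by apply: hcontB; [exact: hcont_act|exact: cn].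
by rewrite le_eqVlt; apply/orP; left; apply/eqP/nrm1_eq => x;
  rewrite /F -/d !actM mulgVK.
Qed.

(** Let [g] carry [x0] to [x]. On an open set [E] around [x0], equicontinuity replaces [F n y] by
    [F n x0] and [F n (act g y)] by [F n x], up to [e] each; a gap above [3 * e] would then
    contribute more than [e * mu E] to an L^1 norm that tends to 0. Since [E] is the same for all
    [n], a threshold exists at each [x], and compactness makes it uniform. *)
Let F_near x0 e : 0 < e -> exists2 n0, (0 < n0)%N & forall n x, (n0 <= n)%N ->
  `|F n x - F n x0| <= 4 * e.
Proof.
move=> e0; have [r r0 rP] := F_equicontinuous e0.
have [n0 _ n0P] : \forall n \near \oo, forall x, `|F n x - F n x0| <= 4 * e.
  apply: (near_hom Gc) => x.
  pose g : SL2 R := (repr x * (repr x0)^-1)%g.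
  have gx : act g x0 = x.
    by rewrite -[x0 in act _ x0]cls_repr act_cls mulgVK cls_repr.
  have nV (y : X) : nbhs y [set z | exists2 b, SL2_close r 1%g b & z = act b y].
    apply: (nbhs_homP Gs y _).2; apply/nbhs_SL2P; exists r => // b br.
    by exists b.
  have : nbhs x0 ([set z | exists2 b, SL2_close r 1%g b & z = act b x0] `&`
      act g @^-1` [set z | exists2 b, SL2_close r 1%g b & z = act b x]).
    apply: filterI => //; apply: (@act_continuous _ _ Gs g).
    by rewrite gx; exact: nV.
  rewrite nbhsE => -[E [oE Ex0] EP].
  have E0 : 0 < fine (mu E).
    rewrite fine_gt0// (open_hom_gt0 Gs Gc inv oE Ex0)/=.
    by rewrite (le_lt_trans (probability_le1 _ _)) ?ltry//; exact: open_hom_measurable.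
  have [n0 n00 n0P] := F_invariant (mulr_gt0 e0 E0).
  exists ([set z | exists2 b, SL2_close r 1%g b & z = act b x], [set n | (n0 <= n)%N]).
    by split => //=; exact: nbhs_infty_ge.
  move=> [_ n] /= [[b br ->] nn]; have np : (0 < n)%N by exact: leq_trans nn.
  have h1 := rP _ _ x np br.
  have h2 : `|F n x - F n x0| <= 3 * e.
    rewrite leNgt; apply/negP => h3.
    have := @nrm1_lower _ _ Gc mu (fun y => F n (act g y) - F n y) E (`|F n x - F n x0| - 2 * e).
    have cFg := hcontB (@hcont_act _ _ Gs (F n) g (@cF n)) (@cF n).
    move=> /(_ cFg oE) H.
    have {}H : (`|F n x - F n x0| - 2 * e) * fine (mu E) <= e * fine (mu E).
      apply: le_trans (n0P n g nn); apply: H; first lra.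
      move=> y /EP[/= [b1 b1r yE] [b2 b2r gyE]].
      have k1 := rP _ _ x0 np b1r; have k2 := rP _ _ x np b2r; rewrite -yE in k1; rewrite -gyE in k2.
      have : `|F n x - F n x0| <= `|F n (act g y) - F n y| + e + e; last lra.
      have -> : F n x - F n x0 = (F n (act g y) - F n y) - (F n (act g y) - F n x) + (F n y - F n x0).
        by ring.
      apply: le_trans (ler_normD _ _) _; apply: lerD => //.
      by apply: le_trans (ler_normB _ _) _; apply: lerD.
    by move: H; rewrite ler_pM2r//; lra.
  have -> : F n (act b x) - F n x0 = (F n (act b x) - F n x) + (F n x - F n x0) by ring.
  by apply: le_trans (ler_normD _ _) _; lra.
by exists n0.+1 => // n x nn; apply: n0P => //=; exact: ltnW.
Qed.

(** [F n] is nearly constant, hence close to its mean, which is that of [f]. Uniformity is essential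
    here: [avg n k] at [x] is [F n] at the inverse image of [x] under [dn n], a point that moves
    with [n]. *)
Lemma equidistribution_nat e : 0 < e -> exists n0, forall n x, (n0 <= n)%N ->
  `|bint f x n%:R - n%:R * \int[mu]_x f x| <= e * n%:R.
Proof.
move=> e0; have e8 : 0 < e / 8 by lra.
have [n0 n00 n0P] := F_near (cls Gam 1%g) e8.
exists n0 => n x nn; have np : (0 < n)%N by exact: leq_trans nn.
set x0 := cls Gam 1%g in n0P.
have F0 : `|\int[mu]_x f x - F n x0| <= e / 2.
  have -> : \int[mu]_x f x = \int[mu]_x F n x.
    rewrite -hom_int_bint// -(hom_int_avg Gs Gc inv measurableT (fun=> erefl) ck np).
    by rewrite -(@hom_int_actT _ _ Gs Gc mu inv (avg n k) (dn n) (@avg_continuous _ _ Gs n k ck)).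
  rewrite ler_norml; apply/andP; split.
    rewrite lerBrDr -(hom_int_one mu (_ + _)).
    apply: hom_int_le => //; first exact: hcont_cst.
    by move=> y; have := n0P n y nn; rewrite ler_norml => /andP[? ?]; lra.
  rewrite lerBlDr -[leRHS](hom_int_one mu).
  apply: hom_int_le => //; first exact: hcont_cst.
  by move=> y; have := n0P n y nn; rewrite ler_norml => /andP[? ?]; lra.
have n0' : 0 < n%:R :> R by rewrite ltr0n.
have Fx : `|n%:R^-1 * bint f x n%:R - F n x0| <= e / 2.
  rewrite -avg_bint; have := n0P n (act (dn n)^-1%g x) nn.
  by rewrite {1}/F act_Kinv; lra.
have -> : bint f x n%:R - n%:R * \int[mu]_x f x =
    n%:R * ((n%:R^-1 * bint f x n%:R - F n x0) - (\int[mu]_x f x - F n x0)).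
  by field; rewrite gt_eqF.
rewrite normrM (gtr0_norm n0') mulrC ler_wpM2r ?(ltW n0')//.
by apply: le_trans (ler_normB _ _) _; lra.
Qed.

(** [C] absorbs the times below the threshold and the fractional part of [t]; the bound then holds
    from time 0 on, as needed when it is integrated in [drift_estimate]. *)
Theorem equidistribution e : 0 < e -> exists2 C, 0 <= C & forall t x, 0 <= t ->
  `|bint f x t - t * \int[mu]_x f x| <= e * t + C.
Proof.
move=> e0; have [n0 n0P] := equidistribution_nat e0.
have [B B0 fB] := hom_bounded Gc cf; set I := \int[mu]_x f x in n0P *.
exists ((B + `|I|) * (1 + n0%:R)) => [|t x t0].
  by rewrite mulr_ge0 ?addr_ge0 ?(ltW B0).
have BI : 0 <= B + `|I| by rewrite addr_ge0 ?(ltW B0).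
pose n := Num.truncn t.
have /andP[nt tn] : n%:R <= t < n.+1%:R by exact: truncn_itv.
have ht : `|(bint f x t - t * I) - (bint f x n%:R - n%:R * I)| <= B + `|I|.
  have -> : (bint f x t - t * I) - (bint f x n%:R - n%:R * I) =
    (bint f x t - bint f x n%:R) - (t - n%:R) * I by ring.
  have tn1 : `|t - n%:R| <= 1.
    by rewrite ger0_norm ?subr_ge0//; rewrite -natr1 in tn; lra.
  apply: le_trans (ler_normB _ _) _; apply: lerD.
    apply: le_trans (bint_lip Gs cf _ _ _ fB) _.
    by rewrite ler_piMr ?(ltW B0).
  by rewrite normrM ler_piMl.
have hn : `|bint f x n%:R - n%:R * I| <= e * t + (B + `|I|) * n0%:R.
  have [nn|/ltnW nn] := leqP n0 n.
    apply: le_trans (n0P _ _ nn) _.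
    have : e * n%:R <= e * t by rewrite ler_pM2l.
    have : 0 <= (B + `|I|) * n0%:R by rewrite mulr_ge0.
    lra.
  have h0 : 0 <= e * t by rewrite mulr_ge0 ?(ltW e0).
  apply: le_trans (_ : (B + `|I|) * n0%:R <= _); last by lra.
  apply: le_trans (_ : (B + `|I|) * n%:R <= _); last by rewrite ler_wpM2l// ler_nat.
  apply: le_trans (ler_normB _ _) _; rewrite mulrDl; apply: lerD.
    by apply: le_trans (bint_bound Gs cf _ _ fB) _; rewrite ger0_norm.
  by rewrite normrM mulrC (@ger0_norm _ n%:R).
have -> : bint f x t - t * I = (bint f x t - t * I) - (bint f x n%:R - n%:R * I) +
  (bint f x n%:R - n%:R * I) by ring.
by apply: le_trans (ler_normD _ _) _; rewrite mulrDr mulr1; lra.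
Qed.

End Equidistribution.

(** * The quotient metric *)

Section QuotientMetric.
Context {R : realType} {Gam : set (SL2 R)}.
Hypothesis Gs : subgroup Gam.
Local Notation X := (homspace Gam).
Variables (dG : SL2 R -> SL2 R -> R) (dGP : right_invariant_metric dG).
Local Notation d := (@quot_dist R dG Gam).
Implicit Types (x y z : X) (g h b : SL2 R).

Let dG_ge0 g h : 0 <= dG g h. Proof. by have [[+ _ _ _] _ _] := dGP. Qed.
Let dG_sym g h : dG g h = dG h g. Proof. by have [[_ _ + _] _ _] := dGP. Qed.
Let dG_tri g h b : dG g b <= dG g h + dG h b. Proof. by have [[_ _ _ +] _ _] := dGP. Qed.
Let dG_eq0 g h : dG g h = 0 <-> g = h. Proof. by have [[_ + _ _] _ _] := dGP. Qed.
Let dG_inv g h b : dG (g * b)%g (h * b)%g = dG g h. Proof. by have [_ _ +] := dGP. Qed.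

Lemma quot_dist_has_inf x y :
  has_inf [set r | exists g h, [/\ cls Gam g = x, cls Gam h = y & r = dG g h]].
Proof.
split; first by exists (dG (repr x) (repr y)), (repr x), (repr y); rewrite !cls_repr.
by exists 0 => _ [g [h [_ _ ->]]].
Qed.

Lemma quot_dist_ge0 x y : 0 <= d x y.
Proof.
apply: lb_le_inf; first by case: (quot_dist_has_inf x y).
by move=> _ [g [h [_ _ ->]]].
Qed.

Lemma quot_dist_act b x : d x (act b x) <= dG 1%g b.
Proof.
apply: ge_inf; first by case: (quot_dist_has_inf x (act b x)).
exists (repr x), (b * repr x)%g; split; rewrite ?cls_repr//.
by rewrite -{1}[repr x]mul1g dG_inv.
Qed.

(** By right invariance [dG g h] is [dG 1 (h * g^-1)], so the infimum runs over the group elements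
    that carry [x] to [y]. *)
Lemma quot_dist_lt r x y : d x y < r -> exists2 b, dG 1%g b < r & y = act b x.
Proof.
move=> /(inf_lt (quot_dist_has_inf x y).1)[_ [g [h [<- <- ->]]] ghr].
exists (h * g^-1)%g; first by rewrite -(dG_inv _ _ g) mul1g mulgVK.
by rewrite act_cls mulgVK.
Qed.

Lemma near1_dG r : 0 < r -> exists2 e, 0 < e & forall b, SL2_close e 1%g b -> dG 1%g b < r.
Proof.
have [_ top _] := dGP => r0; have : nbhs (1%g : SL2 R) [set b | dG 1%g b < r].
  by apply/top; exists r.
by move=> /nbhs_SL2P[e e0 eP]; exists e.
Qed.

Lemma dG_near1 e : 0 < e -> exists2 r, 0 < r & forall b, dG 1%g b < r -> SL2_close e 1%g b.
Proof.
have [_ top _] := dGP => e0; have : nbhs (1%g : SL2 R) (SL2_close e 1%g).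
  by apply/nbhs_SL2P; exists e.
by move=> /top[r r0 rP]; exists r.
Qed.

(** The stabilizer of [y] is the conjugate of [Gam] by a representative of [y], hence discrete. *)
Lemma stabilizer_isolated y : isolated Gam = Gam -> exists2 r, 0 < r &
  forall b, dG 1%g b < r -> act b y = y -> b = 1%g.
Proof.
move=> iG; have [G1 _ _] := Gs; have [_ top _] := dGP.
have [_ [V nV VG]] : isolated Gam 1%g by rewrite iG.
pose h := repr y.
have : (fun b : SL2 R => (h^-1 * b * h)%g : SL2 R) @ (1%g : SL2 R) --> (1%g : SL2 R).
  have -> : (1%g : SL2 R) = (h^-1 * 1 * h)%g :> SL2 R by rewrite mulg1 mulVg.
  rewrite {1}mulg1 mulVg.
  apply: (@cvg_mulSL2r _ _ (nbhs (1%g : SL2 R)) (nbhs_filter _)).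
  exact: mulSL2l_continuous.
move=> /(_ _ nV) /top[r r0 rP]; exists r => // b br.
rewrite -(cls_repr y) act_cls => /esym/(cls_eqP Gs); rewrite -/h mulgA => Gb.
have : (V `&` Gam) (h^-1 * b * h)%g by split => //; exact: rP.
rewrite VG /= => /(congr1 (fun u => h * u * h^-1)%g).
by rewrite !mulgA mulgV mul1g mulgK mulg1 mulgV.
Qed.

Lemma quot_dist_metric : isolated Gam = Gam -> is_metric d.
Proof.
move=> iG; have dlt x y e : 0 < e -> exists2 b, dG 1%g b < d x y + e & y = act b x.
  by move=> e0; apply: quot_dist_lt; rewrite ltrDl.
have dV b : dG 1%g (b^-1)%g = dG 1%g b.
  by rewrite -(dG_inv _ _ b) mul1g mulVg dG_sym.
have dsym x y : d x y <= d y x.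
  apply/ler_addgt0Pr => e e0; have [b bd xE] := dlt y x e e0.
  apply: le_trans (ltW bd); rewrite {1}xE -{2}(act_invK b y) -dV.
  exact: quot_dist_act.
split.
- exact: quot_dist_ge0.
- move=> x y; split=> [xy|->]; last first.
    apply/eqP; rewrite eq_le quot_dist_ge0 andbT -{2}(act1 y).
    by apply: le_trans (quot_dist_act _ _) _; rewrite (dG_eq0 1%g 1%g).2.
  have [r r0 rP] := stabilizer_isolated y iG.
  have r2 : 0 < r / 2 by lra.
  have [b1 b1r y1] : exists2 b, dG 1%g b < r / 2 & y = act b x.
    by apply: quot_dist_lt; rewrite xy.
  have [b10|b10] := pselect (b1 = 1%g); first by rewrite y1 b10 act1.
  have b1p : 0 < dG 1%g b1.
    by rewrite lt_neqAle dG_ge0 andbT eq_sym; apply/eqP => /dG_eq0/esym.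
  (* Distance 0 provides a second, strictly smaller element that carries [x] to [y]. Then
     [b2 * b1^-1] is small and fixes [y], so discreteness forces [b2 = b1], a contradiction. *)
  have [b2 b2r y2] : exists2 b, dG 1%g b < dG 1%g b1 & y = act b x.
    by apply: quot_dist_lt; rewrite xy.
  have : (b2 * b1^-1)%g = 1%g.
    apply: rP; last by rewrite {1}y1 actM mulgVK -y2.
    rewrite -(dG_inv _ _ b1) mul1g mulgVK.
    by apply: le_lt_trans (dG_tri _ 1%g _) _; rewrite dG_sym; lra.
  move=> /(congr1 (fun u => u * b1)%g); rewrite mulgVK mul1g => b12.
  by rewrite b12 ltxx in b2r.
- by move=> x y; apply/eqP; rewrite eq_le !dsym.
- move=> x y z; apply/ler_addgt0Pr => e e0; have e2 : 0 < e / 2 by lra.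
  have [b1 b1d y1] := dlt x y _ e2; have [b2 b2d z2] := dlt y z _ e2.
  rewrite {1}z2 {1}y1 actM; apply: le_trans (quot_dist_act _ _) _.
  apply: le_trans (dG_tri _ b1 _) _; rewrite -{2}(mul1g b1) dG_inv; lra.
Qed.

Lemma quot_dist_near e : 0 < e -> exists2 r, 0 < r &
  forall b x, SL2_close r 1%g b -> d x (act b x) < e.
Proof.
move=> /near1_dG[r r0 rP]; exists r => // b x /rP.
exact: le_lt_trans (quot_dist_act _ _).
Qed.

Lemma quot_dist_close e : 0 < e -> exists2 r, 0 < r &
  forall x y, d x y < r -> exists2 b, SL2_close e 1%g b & y = act b x.
Proof.
move=> /dG_near1[r r0 rP]; exists r => // x y /quot_dist_lt[b br ->].
by exists b => //; exact: rP.
Qed.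

End QuotientMetric.

(** * The time change *)

Section TimeChange.
Context {R : realType} {Gam : set (SL2 R)}.
Hypotheses (Gs : subgroup Gam) (Gc : cocompact Gam).
Local Notation X := (homspace Gam).
Variables (tau : X -> R) (ct : continuous tau).
Variables (m : R) (m0 : 0 < m) (mtau : forall x, m <= tau x).
Implicit Types (x y : X) (s t u : R).
Local Notation T := (time_change tau).

Lemma bint_growth x s t : s <= t -> m * (t - s) <= bint tau x t - bint tau x s.
Proof.
move=> st; have [c _ ->] := der_MVT st (fun u _ => der_bint Gs ct x u).
by rewrite ler_wpM2r ?subr_ge0.
Qed.

Lemma bint_expand x s t : m * `|t - s| <= `|bint tau x t - bint tau x s|.
Proof.
wlog st : s t / s <= t => [H|].
  by have [|/ltW] := leP s t; [exact: H|rewrite (distrC t) (distrC (bint _ _ t)); exact: H].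
rewrite [`|t - s|]ger0_norm ?subr_ge0//.
exact: le_trans (bint_growth x st) (ler_norm _).
Qed.

Lemma bint_inj x : injective (bint tau x).
Proof.
move=> s t st; have := bint_expand x t s; rewrite st subrr normr0.
by rewrite pmulr_rle0// normr_le0 subr_eq0 => /eqP.
Qed.

Lemma bint_surj x t : exists s, bint tau x s = t.
Proof.
pose b := `|t| / m; have b0 : 0 <= b by rewrite divr_ge0// ltW.
have bm : m * b = `|t| by rewrite /b mulrC divfK// gt_eqF.
have h1 : t <= bint tau x b.
  have := bint_growth x b0; rewrite bint0// !subr0 bm; apply: le_trans.
  exact: ler_norm.
have h2 : bint tau x (- b) <= t.
  have := @bint_growth x (- b) 0; rewrite oppr_le0 bint0// !sub0r opprK bm.
  by move=> /(_ b0); have := ler_norm (- t); rewrite normrN; lra.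
have [|||c _ cE] := @IVT R (bint tau x) (- b) b t; last by exists c.
- by rewrite ge0_cp.
- by apply: der_within => s _; exists (tau (horocycle_flow s x)); exact: der_bint.
- by rewrite ge_min h2 /= le_max h1 orbT.
Qed.

Local Notation alpha := (time_alpha tau).

Lemma bint_alpha x t : bint tau x (alpha x t) = t.
Proof. by have [s sE] := bint_surj x t; apply: (@xgetPex _ 0 [set a | bint tau x a = t]); exists s. Qed.

Lemma alpha_bint x s : alpha x (bint tau x s) = s.
Proof. by apply: (@bint_inj x); rewrite bint_alpha. Qed.

Lemma time_change_bint x s : T (bint tau x s) x = horocycle_flow s x.
Proof. by rewrite /time_change alpha_bint. Qed.

Lemma time_changeE x t : T t x = horocycle_flow (alpha x t) x.
Proof. by []. Qed.

Lemma alpha0 x : alpha x 0 = 0.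
Proof. by rewrite -{1}(bint0 Gs ct x) alpha_bint. Qed.

Lemma time_change0 x : T 0 x = x.
Proof. by rewrite time_changeE alpha0 hflow0. Qed.

Lemma alphaD x s t : alpha x (s + t) = alpha x t + alpha (T t x) s.
Proof.
by apply: (@bint_inj x); rewrite bint_alpha bintD// bint_alpha -time_changeE bint_alpha addrC.
Qed.

Lemma time_changeD s t x : T (s + t) x = T s (T t x).
Proof. by rewrite !time_changeE alphaD addrC hflowD. Qed.

Lemma alpha_lip x s t : `|alpha x s - alpha x t| <= `|s - t| / m.
Proof. by rewrite ler_pdivlMr// mulrC; have := bint_expand x (alpha x t) (alpha x s); rewrite !bint_alpha. Qed.

Lemma alpha_le x s t : s <= t -> alpha x s <= alpha x t.
Proof.
move=> st; rewrite leNgt; apply/negP => ts; have := bint_growth x (ltW ts).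
rewrite !bint_alpha => H; have : 0 < m * (alpha x s - alpha x t) by rewrite mulr_gt0// subr_gt0.
lra.
Qed.

(** The clocks expand distances by at least [m] at every starting point, so the error of [alpha] is
    at most [m^-1] times that of the clock at the fixed time [alpha x t], where continuity in the
    starting point is known. *)
Lemma cvg_alpha {I : Type} (F : set_system I) {FF : Filter F}
    (f : I -> R) (f' : I -> X) t x : f @ F --> t -> f' @ F --> x ->
  (fun i => alpha (f' i) (f i)) @ F --> alpha x t.
Proof.
move=> ft fx.
have c1 : (fun i => bint tau (f' i) (alpha x t)) @ F --> t.
  rewrite -{2}(bint_alpha x t).
  exact: (cvg_comp _ _ fx (@bint_continuous _ _ Gs tau ct (alpha x t) x)).
have : (fun i => `|f i - bint tau (f' i) (alpha x t)| / m) @ F --> `|t - t| / m.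
  by apply: cvgMl; apply: cvg_norm; exact: cvgB.
rewrite subrr normr0 mul0r => c2.
apply/subr_cvg0; apply: norm_cvg0; apply: squeeze_cvgr (cvg_cst (0 : R)) c2.
near=> i; rewrite normr_ge0 /= ler_pdivlMr// mulrC.
have := bint_expand (f' i) (alpha x t) (alpha (f' i) (f i)).
by rewrite bint_alpha.
Unshelve. all: by end_near. Qed.

Lemma cvg_time_change {I : Type} (F : set_system I) {FF : Filter F}
    (f : I -> R) (f' : I -> X) t x : f @ F --> t -> f' @ F --> x ->
  (fun i => T (f i) (f' i)) @ F --> T t x.
Proof. by move=> ft fx; apply: (cvg_hflow Gs) => //; exact: cvg_alpha. Qed.

Lemma time_change_continuous t : continuous (T t).
Proof.
move=> x; apply: (@cvg_time_change _ (nbhs x) (nbhs_filter x)); first exact: cvg_cst.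
by move=> ?.
Qed.

Lemma orbit_time_change_continuous x : continuous (fun t => T t x).
Proof.
move=> t; apply: (@cvg_time_change _ (nbhs t) (nbhs_filter t)); first by move=> ?.
exact: cvg_cst.
Qed.

(* Open sets of the product are countable unions of rectangles with rational
   bases *)
Lemma time_change_measurable :
  measurable_fun setT (fun z : R * X => T z.1 z.2).
Proof.
move=> _; apply: (@measurability _ _ _ _ setT _ (@open X)) => // _ [U oU <-].
rewrite setTI; pose V (p q : rat) := (interior
  [set x : X | forall t, ratr p < t < ratr q -> U (T t x)] : set X).
rewrite (_ : _ @^-1` _ = \bigcup_(p : rat) \bigcup_(q : rat)
    (`]ratr p, ratr q[%classic `*` V p q)); last first.
  apply/seteqP; split => [[t x] /= Utx|[t x] [p _] [q _] [/= + /interior_subset]]; last first.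
    by rewrite in_itv /= => tp; exact.
  have : (fun z : R * X => T z.1 z.2) @ (t, x) --> T t x.
    by apply: cvg_time_change; [exact: cvg_fst|exact: cvg_snd].
  move=> /(_ U (open_nbhs_nbhs (conj oU Utx))) [[A W] /= [nA nW] AW].
  have [e /= e0 eA] := (nbhs_ballP _ _).1 nA.
  have [p1 /andP[p1t tp1]] : exists q : rat, t - e < ratr q < t.
    by have [q] := @rat_in_itvoo R (t - e) t ltac:(lra); rewrite in_itv; exists q.
  have [p2 /andP[p2t tp2]] : exists q : rat, t < ratr q < t + e.
    by have [q] := @rat_in_itvoo R t (t + e) ltac:(lra); rewrite in_itv; exists q.
  exists p1 => //; exists p2 => //; split; first by rewrite /= in_itv /= tp1 p2t.
  rewrite /V /interior /=; apply: filterS nW => y Wy s /andP[s1 s2].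
  apply: (AW (s, y)); split => //=; apply: eA; rewrite /ball /= ltr_norml.
  by apply/andP; split; lra.
do 2 apply: bigcupT_measurable_rat => ?; apply: measurableX => //.
by apply: sub_gen_smallest; exact: open_interior.
Qed.

End TimeChange.

(** * Approximation of open sets by continuous functions *)

Section OpenApproximation.
Context {R : realType} {Gam : set (SL2 R)}.
Hypotheses (Gs : subgroup Gam) (Gc : cocompact Gam).
Local Notation X := (homspace Gam).
Variables (dG : SL2 R -> SL2 R -> R) (dGP : right_invariant_metric dG).

Let dG_ge0 g h : 0 <= dG g h. Proof. by have [[+ _ _ _] _ _] := dGP. Qed.
Let dG_sym g h : dG g h = dG h g. Proof. by have [[_ _ + _] _ _] := dGP. Qed.
Let dG_tri g h b : dG g b <= dG g h + dG h b. Proof. by have [[_ _ _ +] _ _] := dGP. Qed.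
Let dG_eq0 g h : dG g h = 0 <-> g = h. Proof. by have [[_ + _ _] _ _] := dGP. Qed.
Let dG_inv g h b : dG (g * b)%g (h * b)%g = dG g h. Proof. by have [_ _ +] := dGP. Qed.

Let S (U : set X) (x : X) := [set r | exists2 b : SL2 R, ~ U (act b x) & r = dG 1%g b]
  `|` [set 1 : R].

(* The distance from [x] to the complement of [U], truncated at 1 so that it is
   also meaningful for the whole space *)
Let phi U x := inf (S U x).

Let hS U x : has_inf (S U x).
Proof.
split; first by exists 1; right.
by exists 0 => _ [[b _ ->]|->].
Qed.

Let phi_ge0 U x : 0 <= phi U x.
Proof. by apply: lb_le_inf; [case: (hS U x)|move=> _ [[b _ ->]|->]]. Qed.

Let phi_le U x b : ~ U (act b x) -> phi U x <= dG 1%g b.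
Proof. by move=> Ub; apply: ge_inf; [case: (hS U x)|left; exists b]. Qed.

Let phi_le1 U x : phi U x <= 1.
Proof. by apply: ge_inf; [case: (hS U x)|right]. Qed.

Let phi_act U x c : phi U x <= phi U (act c x) + dG 1%g c.
Proof.
rewrite -lerBlDr; apply: lb_le_inf; first by case: (hS U (act c x)).
move=> _ [[b Ub ->]|->]; rewrite lerBlDr.
  rewrite actM in Ub; apply: le_trans (phi_le Ub) _.
  by apply: le_trans (dG_tri _ c _) _; rewrite -{2}(mul1g c) dG_inv addrC.
by apply: le_trans (phi_le1 _ _) _; rewrite lerDl.
Qed.

Let phi_continuous U : continuous (phi U).
Proof.
move=> x; apply: hom_cvgP => e e0; apply: (nbhs_homP Gs _ _).2.
have [r r0 rP] := near1_dG dGP e0; apply/nbhs_SL2P; exists r => // c /rP ce /=.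
have dV : dG 1%g (c^-1)%g = dG 1%g c.
  by rewrite -(dG_inv _ _ c) mul1g mulVg dG_sym.
have := phi_act U x c; have := phi_act U (act c x) (c^-1)%g; rewrite act_invK dV.
by rewrite ler_norml => ? ?; apply/andP; split; lra.
Qed.

Let phi_out U x : ~ U x -> phi U x = 0.
Proof.
move=> Ux; apply/eqP; rewrite eq_le phi_ge0 andbT -(dG_eq0 1%g 1%g).2//.
by apply: phi_le; rewrite act1.
Qed.

Let phi_gt0 U x : open U -> U x -> 0 < phi U x.
Proof.
move=> oU Ux; have := (nbhs_homP Gs x U).1 (open_nbhs_nbhs (conj oU Ux)).
move=> /nbhs_SL2P[e e0 eP]; have [r r0 rP] := dG_near1 dGP e0.
apply: lt_le_trans (_ : Num.min 1 r <= _); first by rewrite lt_min r0 ltr01.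
apply: lb_le_inf; first by case: (hS U x).
move=> _ [[b Ub ->]|->]; last by rewrite ge_min lexx.
rewrite ge_min; apply/orP; right; rewrite leNgt; apply/negP => /rP/eP.
exact: Ub.
Qed.

(** Carries identities between integrals of continuous functions over to open sets;
    [hom_measure_unique] then extends them to all Borel sets. *)
Lemma open_approx (U : set X) : open U -> exists f : nat -> X -> R,
  [/\ forall n, continuous (f n), forall n x, 0 <= f n x <= 1,
      forall x, U x -> f ^~ x @ \oo --> (1 : R) & forall n x, ~ U x -> f n x = 0].
Proof.
move=> oU; exists (fun n x => Num.min 1 (n%:R * phi U x)); split.
- move=> n x; apply: (@continuous_min _ _ (fun=> 1) (fun x => n%:R * phi U x)).
    exact: hcont_cst.
  exact: (@hcontZ _ _ n%:R _ (@phi_continuous U)).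
- move=> n x; rewrite le_min ler01 mulr_ge0// ?phi_ge0//=.
  by rewrite ge_min lexx.
- move=> x Ux; have p0 := phi_gt0 oU Ux.
  have [N NP] := exists_nat_ge ((phi U x)^-1).
  apply: cvg_near_cst; exists N => // n /= Nn.
  apply/min_idPl; rewrite -ler_pdivrMr// mul1r; apply: le_trans NP _.
  by rewrite ler_nat.
- by move=> n x /phi_out ->; rewrite mulr0 (min_idPr _).
Qed.

Section Limit.
Variables (mu : probability X R).

Lemma hom_integralE (A : set X) (f : X -> R) : measurable A -> continuous f ->
  (\int[mu]_(x in A) (f x)%:E = (\int[mu]_(x in A) f x)%:E)%E.
Proof.
move=> mA cf; rewrite /Rintegral fineK//.
exact: integrable_fin_num (continuous_hom_integrable Gc mu cf mA).
Qed.

(** The weight [w] is 1 in the proof of ergodicity and the density of [nu] in that of its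
    invariance. *)
Lemma open_integral_limit (A U : set X) (f : nat -> X -> R) (w : X -> R) :
  measurable A -> open U -> continuous w -> (forall x, 0 <= w x) ->
  (forall n, continuous (f n)) -> (forall n x, 0 <= f n x <= 1) ->
  (forall x, U x -> f ^~ x @ \oo --> (1 : R)) -> (forall n x, ~ U x -> f n x = 0) ->
  ((fun n => (\int[mu]_(x in A) (f n x * w x))%:E) @ \oo -->
  \int[mu]_(x in A `&` U) (w x)%:E)%E.
Proof.
move=> mA oU cw w0 cf f01 fU f0; have mU := open_hom_measurable oU.
have cfw n := hcontM (cf n) cw.
rewrite integral_mkcondr.
under eq_fun do rewrite -hom_integralE//.
have [] // := @dominated_convergence _ _ _ mu A mA (fun n x => (f n x * w x)%:E)
  ((fun x => (w x)%:E) \_ U) (fun x => (w x)%:E).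
- by move=> n; apply/measurable_EFinP; exact: continuous_hom_measurable.
- apply/measurable_restrict => //; apply/measurable_EFinP.
  by apply: continuous_hom_measurable => //; exact: measurableI.
- apply: aeW => x _; rewrite patchE; case: ifPn => [/set_mem Ux|].
    rewrite -{2}[w x]mul1r; apply: cvg_EFin; first by near=> n.
    by apply: cvgMl; exact: fU.
  move=> /negP xU; have Ux : ~ U x by move=> /mem_set.
  by under eq_fun do rewrite f0// mul0r; exact: cvg_cst.
- exact: continuous_hom_integrable.
- apply: aeW => x n _; rewrite /= lee_fin normrM (ger0_norm (w0 x)).
  by have /andP[? ?] := f01 n x; rewrite ger0_norm// ler_piMl.
Unshelve. all: by end_near. Qed.

End Limit.

Lemma hom_measure_unique (m1 m2 : {measure set X -> \bar R}) :
  (m1 setT < +oo)%E -> (forall U, open U -> m1 U = m2 U) ->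
  forall A, measurable A -> m1 A = m2 A.
Proof.
move=> m1oo m12 A mA.
apply: (measure_unique (@open X) (fun=> setT)) => //.
- exact: openI.
- by move=> _; exact: openT.
- by apply/seteqP; split => // x _; exists 0%N.
Qed.

End OpenApproximation.

Lemma distB_le (R : realDomainType) (a b c d K : R) :
  `|a - c| <= K -> `|b - d| <= K -> `|(a - b) - (c - d)| <= 2 * K.
Proof.
by rewrite !ler_norml => /andP[? ?] /andP[? ?]; apply/andP; split; lra.
Qed.

(** * Invariance and ergodicity of the time change *)

Section ErgodicTimeChange.
Context {R : realType} {Gam : set (SL2 R)}.
Hypotheses (Gs : subgroup Gam) (Gc : cocompact Gam).
Local Notation X := (homspace Gam).
Variables (dG : SL2 R -> SL2 R -> R) (dGP : right_invariant_metric dG).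
Variables (mu nu : probability X R) (inv : SL2_invariant mu).
Variables (tau : X -> R) (ct : continuous tau) (tau0 : forall x, 0 < tau x).
Hypothesis tcm : time_change_measure tau mu nu.
Local Notation T := (time_change tau).

Let c := \int[mu]_y tau y.

Lemma int_tau_gt0 : 0 < c.
Proof.
have [m m0 mtau] := hom_lower Gc ct tau0.
apply: lt_le_trans m0 _; rewrite -[leLHS](hom_int_one mu).
by apply: hom_int_le => //; exact: hcont_cst.
Qed.

(** Uniform convergence of the averages gives, for continuous [f], an integral over the invariant
    set [A] equal to [a] times the integral over the space, where [a] is the measure of [A]. So the
    restriction of [mu] to [A] is [a] times [mu], and evaluation at [A] itself yields a = a^2. *)
Lemma hflow_ergodic (A : set X) : measurable A ->
  (forall t, horocycle_flow t @^-1` A = A) -> mu A = 0%E \/ mu A = 1%E.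
Proof.
move=> mA iA; set a := fine (mu A).
have aE : mu A = a%:E by rewrite fineK// ge0_fin_numE// (le_lt_trans (probability_le1 _ mA)) ?ltry.
have a0 : 0 <= a by rewrite fine_ge0.
have key (f : X -> R) : continuous f ->
    \int[mu]_(x in A) f x = a * \int[mu]_x f x.
  move=> cf; set I := \int[mu]_x f x.
  suff H : `|\int[mu]_(x in A) f x - a * I| <= 0.
    by apply/eqP; rewrite -subr_eq0 -normr_le0.
  apply/ler_addgt0Pr => e e0; rewrite add0r.
  have ea0 : 0 < e / (a + 1) by rewrite divr_gt0// ltr_wpDl.
  have [n0 n0P] := equidistribution_nat Gs Gc inv cf ea0.
  pose n := n0.+1; have n1 : (0 : R) < n%:R by rewrite ltr0n.
  pose k x := bint f x 1.
  have ck : continuous k by exact: bint_continuous.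
  have ca : continuous (avg n k) by exact: avg_continuous.
  have kI x : `|avg n k x - I| <= e / (a + 1).
    rewrite avg_bint//; have -> : n%:R^-1 * bint f x n%:R - I = n%:R^-1 * (bint f x n%:R - n%:R * I).
      by rewrite mulrBr mulrA mulVf ?mul1r// gt_eqF.
    rewrite normrM ger0_norm ?invr_ge0// ler_pdivrMl// [leRHS]mulrC.
    by apply: n0P; rewrite /n.
  have <- : \int[mu]_(x in A) avg n k x = \int[mu]_(x in A) f x.
    by rewrite (hom_int_avg Gs Gc inv mA iA ck)// (hom_int_bint Gs Gc inv cf mA iA).
  have eae : e / (a + 1) * a <= e.
    by rewrite mulrAC ler_pdivrMr ?ltr_wpDl// ler_pM2l// lerDl.
  have -> : a * I = I * fine (mu A) by rewrite mulrC.
  rewrite -(hom_int_cst mu mA).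
  rewrite ler_norml; apply/andP; split.
    apply: le_trans (_ : - (e / (a + 1)) * fine (mu A) <= _); first by rewrite mulNr lerN2.
    rewrite -(hom_int_cst mu mA) lerBrDr -hom_intD//; [|exact: hcont_cst..].
    apply: hom_int_le => //; first by apply: hcontD; exact: hcont_cst.
    by move=> x; have := kI x; rewrite ler_norml => /andP[? ?]; lra.
  apply: le_trans (_ : e / (a + 1) * fine (mu A) <= _); last exact: eae.
  rewrite -(hom_int_cst mu mA) lerBlDr -hom_intD//; [|exact: hcont_cst..].
  apply: hom_int_le => //; first by apply: hcontD; exact: hcont_cst.
  by move=> x; have := kI x; rewrite ler_norml => /andP[? ?]; lra.
pose m1 : {measure set X -> \bar R} := mrestr mu mA.
pose m2 : {measure set X -> \bar R} := mscale (NngNum a0) mu.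
have m12 U : open U -> m1 U = m2 U.
  move=> oU; have [f [cf f01 fU f0]] := open_approx Gs dGP oU.
  have mU := open_hom_measurable oU.
  have c1 : continuous (fun _ : X => 1 : R) by exact: hcont_cst.
  have lA := open_integral_limit Gc (mu := mu) mA oU c1 (fun=> ler01) cf f01 fU f0.
  have lT := open_integral_limit Gc (mu := mu) measurableT oU c1 (fun=> ler01) cf f01 fU f0.
  have E n : ((\int[mu]_(x in A) (f n x * 1))%:E =
      a%:E * (\int[mu]_x (f n x * 1))%:E)%E.
    by rewrite -EFinM -key//; exact: hcontM.
  have lT' : ((fun n => (\int[mu]_(x in A) (f n x * 1))%:E) @ \oo -->
      a%:E * \int[mu]_(x in setT `&` U) (1%:E : \bar R))%E.
    by under eq_fun do rewrite E; exact: cvgeZl.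
  have : (\int[mu]_(x in A `&` U) (1%:E : \bar R) =
      a%:E * \int[mu]_(x in setT `&` U) (1%:E : \bar R))%E.
    exact: (cvg_unique _ lA lT').
  rewrite setTI !integral_cst//; last exact: measurableI.
  by rewrite !mul1e /m1 /m2 /= /mrestr setIC => ->; rewrite /mscale.
have m1oo : (m1 setT < +oo)%E.
  by rewrite /m1 /= /mrestr setTI (le_lt_trans (probability_le1 _ mA)) ?ltry.
have := hom_measure_unique m1oo m12 mA.
rewrite /m1 /m2 /= /mrestr /mscale setIid => H.
have {H} : (mu A = a%:E * mu A)%E by exact: H.
rewrite aE -EFinM => -[] /eqP.
rewrite -{1}[a]mulr1 -subr_eq0 -mulrBr mulf_eq0 => /orP[/eqP ->|]; first by left.
by rewrite subr_eq0 => /eqP <-; right.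
Qed.

Lemma bint_time_change (f g1 g2 : X -> R) B t x s : continuous f ->
  continuous g1 -> continuous g2 -> (forall y, `|f y| <= B) ->
  (forall y, g1 y = f (T t y) * tau y) -> (forall y, g2 y = f y * tau y) ->
  `|bint g1 x s - bint g2 x s| <= 2 * (B * `|t|).
Proof.
move=> cf c1 c2 fB g1E g2E; have [m m0 mtau] := hom_lower Gc ct tau0.
have co : continuous (fun v => f (T v x)).
  move=> v; apply: (@continuous_comp _ _ _ (fun v => T v x) f); last exact: cf.
  exact: (orbit_time_change_continuous Gs ct m0 mtau).
pose H := oriented_integral (fun v => f (T v x)) 0.
have dH v : der H v (f (T v x)) by exact: der_oint.
have H1 : bint g1 x s = H (t + bint tau x s) - H (t + bint tau x 0).
  have dL u : der (fun u => H (t + bint tau x u)) u (g1 (horocycle_flow u x)).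
    rewrite g1E -{1}(time_change_bint Gs ct m0 mtau) -(time_changeD Gs ct m0 mtau).
    have dI : der (fun u => t + bint tau x u) u (tau (horocycle_flow u x)).
      by apply: der_eq (derD (der_cst t u) (der_bint Gs ct x u)) _; rewrite add0r.
    exact: (der_comp dI (dH _)).
  by have := der_inj 0 s (der_bint Gs c1 x) dL; rewrite bint0// subr0.
have H2 : bint g2 x s = H (bint tau x s) - H (bint tau x 0).
  have dL u : der (fun u => H (bint tau x u)) u (g2 (horocycle_flow u x)).
    rewrite g2E -{1}(time_change_bint Gs ct m0 mtau).
    exact: (der_comp (der_bint Gs ct _ _) (dH _)).
  by have := der_inj 0 s (der_bint Gs c2 x) dL; rewrite bint0// subr0.
have k1 := der_boundT (bint tau x s) (t + bint tau x s) dH (fun v => fB _).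
have k2 := der_boundT (bint tau x 0) (t + bint tau x 0) dH (fun v => fB _).
rewrite !addrK in k1 k2; rewrite H1 H2.
exact: distB_le k1 k2.
Qed.

(* Applied to [f \o T t * tau] and [f * tau], whose integrals along an orbit are
   those of f over two intervals of the new clock that differ by a shift by t *)
Lemma equidistribution_unique (f1 f2 : X -> R) (K : R) x : continuous f1 ->
  continuous f2 -> (forall s, `|bint f1 x s - bint f2 x s| <= K) ->
  \int[mu]_y f1 y = \int[mu]_y f2 y.
Proof.
move=> c1 c2 bd; set I1 := Rintegral _ _ f1; set I2 := Rintegral _ _ f2.
suff H : `|I1 - I2| <= 0 by apply/eqP; rewrite -subr_eq0 -normr_le0.
apply/ler_addgt0Pr => e e0; rewrite add0r; have e3 : 0 < e / 3 by lra.
have [n1 n1P] := equidistribution_nat Gs Gc inv c1 e3.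
have [n2 n2P] := equidistribution_nat Gs Gc inv c2 e3.
have [n3 n3P] := exists_nat_ge (K / (e / 3)).
pose n := (maxn n1 (maxn n2 n3)).+1.
have : (maxn n1 (maxn n2 n3) <= n)%N by [].
rewrite !geq_max => /andP[h1 /andP[h2 h3]].
have np : (0 : R) < n%:R by rewrite ltr0n.
have b1 := n1P n x h1; have b2 := n2P n x h2; have b3 := bd n%:R.
have b4 : K <= e / 3 * n%:R.
  by rewrite mulrC -ler_pdivrMr//; apply: le_trans n3P _; rewrite ler_nat.
rewrite -(ler_pM2l np) -{1}(gtr0_norm np) -normrM.
rewrite -/I1 in b1; rewrite -/I2 in b2.
move: b1 b2 b3; rewrite !ler_norml => /andP[? ?] /andP[? ?] /andP[? ?].
by apply/andP; split; lra.
Qed.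

(** No Jacobian of the flow is computed: the integrals along a single orbit differ by a bounded
    amount, which already forces equal means. *)
Lemma hom_int_time_change (f : X -> R) t : continuous f ->
  \int[mu]_x (f (T t x) * tau x) = \int[mu]_x (f x * tau x).
Proof.
move=> cf; have [m m0 mtau] := hom_lower Gc ct tau0.
have [B B0 fB] := hom_bounded Gc cf.
have cfT : continuous (fun x => f (T t x)).
  by move=> x; apply: (@continuous_comp _ _ _ (T t) f);
    [exact: (time_change_continuous Gs ct m0 mtau)|exact: cf].
have c1 := hcontM cfT ct; have c2 := hcontM cf ct.
apply: (equidistribution_unique (K := 2 * (B * `|t|)) (x := cls Gam 1%g) c1 c2).
by move=> s; exact: (@bint_time_change f _ _ B t _ s cf c1 c2 fB (fun=> erefl) (fun=> erefl)).
Qed.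

Lemma time_change_preserving t (A : set X) : measurable A ->
  nu (T t @^-1` A) = nu A.
Proof.
have [m m0 mtau] := hom_lower Gc ct tau0.
have cT : continuous (T t) by exact: (time_change_continuous Gs ct m0 mtau).
have mT : measurable_fun setT (T t).
  move=> _; apply: (@measurability _ _ _ _ setT _ (@open X)) => // _ [U oU <-].
  by rewrite setTI; apply: open_hom_measurable; move/continuousP : cT; exact.
pose pf : {measure set X -> \bar R} := pushforward nu (T t).
pose m1 := pf mT.
move=> mA; suff H : m1 A = nu A by [].
apply: (@hom_measure_unique _ _ m1 nu) => //.
  by rewrite /m1 /= /pushforward (le_lt_trans (probability_le1 _ _)) ?ltry// preimage_setT.
move=> U oU; rewrite /m1 /= /pushforward.
have oTU : open (T t @^-1` U) by move/continuousP : cT; exact.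
rewrite !tcm; [|exact: open_hom_measurable..].
pose w x := tau x / c; have w0 x : 0 <= w x by rewrite divr_ge0// ltW// int_tau_gt0.
have cw : continuous w by apply: hcontM => //; exact: hcont_cst.
have [f [cf f01 fU f0]] := open_approx Gs dGP oU.
have cfT n : continuous (fun x => f n (T t x)).
  by move=> x; apply: (@continuous_comp _ _ _ (T t) (f n)); [exact: cT|exact: cf].
have l1 := open_integral_limit Gc (mu := mu) measurableT oU cw w0 cf f01 fU f0.
have l2 := open_integral_limit Gc (mu := mu) measurableT oTU cw w0 cfT
  (fun n x => f01 n (T t x)) (fun x => fU (T t x)) (fun n x => f0 n (T t x)).
have E n : \int[mu]_x (f n (T t x) * w x) = \int[mu]_x (f n x * w x).
  transitivity (c^-1 * \int[mu]_x (f n (T t x) * tau x)).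
    rewrite -hom_intZ//; last exact: hcontM.
    by apply: eq_Rintegral => x _; rewrite /w; ring.
  rewrite hom_int_time_change// -hom_intZ//; last exact: hcontM.
  by apply: eq_Rintegral => x _; rewrite /w; ring.
rewrite !setTI in l1 l2; apply: (cvg_unique (@ereal_hausdorff R) _ l1).
by move: l2; under eq_fun do rewrite E.
Qed.

Lemma time_change_ergodic : ergodic_flow nu T.
Proof.
have [m m0 mtau] := hom_lower Gc ct tau0.
split; first split.
- exact: (time_change0 Gs ct m0 mtau).
- exact: (time_changeD Gs ct m0 mtau).
- exact: (time_change_measurable Gs ct m0 mtau).
- by move=> t A mA; exact: time_change_preserving.
move=> A mA iA.
(* The two flows have the same orbits, hence the same invariant sets. *)
have iAh t : horocycle_flow t @^-1` A = A.
  apply/seteqP; split=> x /=.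
    by rewrite -(time_change_bint Gs ct m0 mtau) -{2}(iA (bint tau x t)).
  by rewrite -(time_change_bint Gs ct m0 mtau) -{1}(iA (bint tau x t)).
have null (B : set X) : measurable B -> mu B = 0%E -> nu B = 0%E.
  move=> mB B0; rewrite tcm// null_set_integral//; apply/measurable_EFinP.
  apply: continuous_hom_measurable => //.
  by apply: hcontM => //; exact: hcont_cst.
have [A0|A1] := hflow_ergodic mA iAh; [left; exact: null|right].
have A'0 : mu (~` A) = 0%E by rewrite probability_setC// A1 subee.
have H := null _ (measurableC mA) A'0.
by rewrite -[A]setCK probability_setC; [rewrite H sube0|exact: measurableC].
Qed.

End ErgodicTimeChange.

(** * Continuously differentiable functions *)

Section DirectionalDerivative.
Context {R : realType}.
Local Notation M := 'M[R]_2.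
Implicit Types (A B v w : M) (U : set M) (F : M -> R).

Lemma sum_ord22 (f : 'I_2 -> 'I_2 -> R) :
  \sum_i \sum_j f i j = f 0 0 + f 0 1 + (f 1 0 + f 1 1).
Proof.
rewrite !big_ord_recl !big_ord0 !addr0.
by congr (f _ _ + f _ _ + (f _ _ + f _ _)); exact: val_inj.
Qed.

Lemma derive_entries F B w : differentiable F B ->
  'D_w F B = w 0 0 * 'D_(delta_mx 0 0) F B + w 0 1 * 'D_(delta_mx 0 1) F B +
    (w 1 0 * 'D_(delta_mx 1 0) F B + w 1 1 * 'D_(delta_mx 1 1) F B).
Proof.
move=> dF; rewrite -(sum_ord22 (fun i j => w i j * 'D_(delta_mx i j) F B)).
rewrite deriveE// {1}[w]matrix_sum_delta linear_sum.
apply: eq_bigr => i _; rewrite linear_sum; apply: eq_bigr => j _.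
by rewrite linearZ deriveE.
Qed.

(** [C1_on] gives continuity for each fixed direction; the expansion in elementary matrices makes it
    joint in the base point and the direction. *)
Lemma C1_on_directional U F A w : open U -> U A -> C1_on U F ->
  forall e, 0 < e -> exists2 r, 0 < r & forall B v,
    (forall i j, `|A i j - B i j| < r) -> (forall i j, `|w i j - v i j| < r) ->
    U B /\ `|'D_v F B - 'D_w F A| <= e.
Proof.
move=> oU UA [dF cF] e e0.
have c1 i j : (fun p : M * M => 'D_(delta_mx i j) F p.1) @ (A, w) -->
    'D_(delta_mx i j) F A.
  have c : (fst : M * M -> M) @ (A, w) --> A by exact: cvg_fst.
  exact: (cvg_comp _ _ c (cF (delta_mx i j) A UA)).
have c2 i j : (fun p : M * M => p.2 i j) @ (A, w) --> w i j.
  have c : (snd : M * M -> M) @ (A, w) --> w by exact: cvg_snd.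
  exact: (cvg_comp _ _ c (@coord_continuous _ _ _ i j w)).
have : (fun p : M * M => p.2 0 0 * 'D_(delta_mx 0 0) F p.1 +
      p.2 0 1 * 'D_(delta_mx 0 1) F p.1 + (p.2 1 0 * 'D_(delta_mx 1 0) F p.1 +
      p.2 1 1 * 'D_(delta_mx 1 1) F p.1)) @ (A, w) --> 'D_w F A.
  rewrite derive_entries; last exact: dF.
  by apply: cvgD; apply: cvgD; apply: cvgM;
    [exact: c2|exact: c1|exact: c2|exact: c1|exact: c2|exact: c1|exact: c2|exact: c1].
move=> /cvgrPdist_le /(_ e e0) H.
have nU : \forall p \near (A, w), U p.1.
  exact: (cvg_fst (open_nbhs_nbhs (conj oU UA))).
have [r /= r0 rP] := (nbhs_ballP _ _).1 (filterI nU H).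
exists r => // B v Br vr; have /= [] := rP (B, v).
  by split; split.
move=> UB; rewrite -derive_entries; last exact: dF.
by rewrite distrC.
Qed.

Lemma C1_on_chord U F A v : C1_on U F ->
  (forall s : R, 0 <= s <= 1 -> U (A + s *: v)) ->
  exists2 s, 0 <= s <= 1 & F (A + v) - F A = 'D_v F (A + s *: v).
Proof.
move=> [dF _] UA.
have dG s : 0 <= s <= 1 -> der (fun s => F (A + s *: v)) s ('D_v F (A + s *: v)).
  move=> /UA/dF dFs.
  have dv : derivable F (A + s *: v) v by exact: diff_derivable.
  have E : (fun h : R => h^-1 *: (F (A + (h *: 1 + s) *: v) - F (A + s *: v))) =
      (fun h : R => h^-1 *: (F (h *: v + (A + s *: v)) - F (A + s *: v))).
    apply/funext => h; congr (_ *: (F _ - _)).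
    by rewrite scalerDl [h *: (1 : R)]mulr1 addrCA.
  split; first by rewrite /derivable /= E.
  by rewrite /derive /= E.
have [s s01 sE] := der_MVT ler01 dG.
by exists s => //; move: sE; rewrite scale1r scale0r addr0 subr0 mulr1.
Qed.

End DirectionalDerivative.

(** * First-order expansions along one-parameter subgroups *)

Section C1Homspace.
Context {R : realType} {Gam : set (SL2 R)}.
Hypotheses (Gs : subgroup Gam) (Gc : cocompact Gam).
Local Notation X := (homspace Gam).
Variables (tau : X -> R) (tauC1 : C1_homspace tau).
Implicit Types (l c : R) (g h : SL2 R).

Lemma C1_homspace_continuous : continuous tau.
Proof.
apply/(@quotient_continuous _ _ _ tau) => g.
have [U [F [oU Ug [dF _] tF]]] := tauC1 g.
have nU : nbhs g (val @^-1` U).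
  apply: (@initial_continuous _ _ (val : SL2 R -> _) g).
  by apply: open_nbhs_nbhs.
have cF : (fun h : SL2 R => F (val h)) @ g --> F (val g).
  apply: (cvg_comp _ _ (@initial_continuous _ _ (val : SL2 R -> _) g)).
  exact: differentiable_continuous (dF _ Ug).
suff H : (fun h : SL2 R => tau (cls Gam h)) @ g --> tau (cls Gam g) by exact: H.
have -> : tau (cls Gam g) = F (val g) by exact: (tF g Ug).
move=> A /cF; rewrite !nbhs_filterE /fmap /= => nA.
apply: (@filterS2 _ (nbhs g) (nbhs_filter g) _ _ _ _ nU nA) => h Uh.
by rewrite /preimage /= (_ : tau (cls Gam h) = F (val h))//; exact: (tF h Uh).
Qed.

Lemma mx2_comb (a b c d a' b' c' d' s : R) :
  mx2 a b c d + s *: mx2 a' b' c' d' =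
  mx2 (a + s * a') (b + s * b') (c + s * c') (d + s * d').
Proof. by apply: mx2P; rewrite !mxE. Qed.

Lemma mx2_close (r a b c d a' b' c' d' : R) :
  `|a - a'| < r -> `|b - b'| < r -> `|c - c'| < r -> `|d - d'| < r ->
  forall i j, `|mx2 a b c d i j - mx2 a' b' c' d' i j| < r.
Proof. by move=> ? ? ? ? i j; elim/ord2P: i; elim/ord2P: j; rewrite !mx2E. Qed.

Lemma dist_scale_lt (g h v s G d r : R) : 0 <= s <= 1 -> `|g - h| <= d ->
  `|v| <= G -> d + G < r -> `|g - (h + s * v)| < r.
Proof.
move=> /andP[s0 s1] gh vG dG.
have -> : g - (h + s * v) = (g - h) - s * v by ring.
apply: le_lt_trans (ler_normB _ _) _; apply: le_lt_trans dG; apply: lerD => //.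
rewrite normrM (ger0_norm s0); apply: le_trans vG.
by rewrite ler_piMl.
Qed.

Lemma norm_le_near (u v G d : R) : `|u - v| < d -> d <= 1 -> `|u| <= G - 1 -> `|v| <= G.
Proof.
move=> uv d1 uG; have -> : v = u - (u - v) by ring.
by apply: le_trans (ler_normB _ _) _; lra.
Qed.

Lemma norm_le_sum4 (a b c d : R) (G := 1 + `|a| + `|b| + `|c| + `|d|) :
  [/\ 1 <= G, `|a| <= G - 1, `|b| <= G - 1, `|c| <= G - 1 & `|d| <= G - 1].
Proof.
have := normr_ge0 a; have := normr_ge0 b; have := normr_ge0 c; have := normr_ge0 d.
by rewrite /G => *; split; lra.
Qed.

Lemma near1_neq0 l : `|1 - l| <= 4^-1 -> l != 0.
Proof. by move=> /near1_gt0/andP[? _]; lra. Qed.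

Lemma C1_chord_le U (F : 'M[R]_2 -> R) (A v w : 'M[R]_2) (t k e : R) :
  C1_on U F -> v = t *: w ->
  (forall s, 0 <= s <= 1 -> U (A + s *: v) /\ `|'D_w F (A + s *: v) - k| <= e) ->
  `|F (A + v) - F A - t * k| <= e * `|t|.
Proof.
move=> cF vE H; have [s s01 ->] := C1_on_chord cF (fun s s01 => (H s s01).1).
have [US He] := H _ s01.
have dFs : differentiable F (A + s *: v) by apply: cF.1.
have -> : 'D_v F (A + s *: v) = t * 'D_w F (A + s *: v).
  move: dFs; move: (A + s *: v) => B dFs.
  by rewrite (deriveE v dFs) (deriveE w dFs) vE linearZ.
by rewrite -mulrBr normrM mulrC ler_wpM2r.
Qed.

(** Along the diagonal the error has to be a small multiple of [|1 - l|]. Along [vert] a Lipschitz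
    bound suffices, because [|c| * T] is at most the drift weight over the whole range of length
    [T]. *)
Definition C1_bounds (e k K r : R) (y : X) : Prop :=
  (forall l, `|1 - l| <= r -> `|tau (act (dil l) y) - tau y - (1 - l) * k| <= e * `|1 - l|)
  /\ (forall c, `|c| <= r -> `|tau (act (vert c) y) - tau y| <= K * `|c|).

Lemma C1_local (e : R) (x : X) : 0 < e -> exists k K r : R, [/\ 0 < K, 0 < r &
  \forall y \near x, C1_bounds e k K r y].
Proof.
move=> e0; pose g := repr x; have [U [F [oU Ug cF tF]]] := tauC1 g.
(* [w0] and [w1] are the velocities at [g] of [dil l * g], as a function of [1 - l], and of
   [vert c * g]. Below, the chords starting at a nearby [h] are exact multiples of vectors close to
   these. *)
pose w0 := mx2 (m11 g) (m12 g) (- m21 g) (- m22 g).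
pose w1 := mx2 0 0 (m11 g) (m12 g).
have [r1 r10 r1P] := C1_on_directional w0 oU Ug cF e0.
have [r2 r20 r2P] := C1_on_directional w1 oU Ug cF ltr01.
pose r := Num.min r1 r2; have r0 : 0 < r by rewrite lt_min r10.
have rr1 : r <= r1 by rewrite ge_min lexx.
have rr2 : r <= r2 by rewrite ge_min lexx orbT.
pose G := 1 + `|m11 g| + `|m12 g| + `|m21 g| + `|m22 g|.
have [G1 b11 b12 b21 b22] := norm_le_sum4 (m11 g) (m12 g) (m21 g) (m22 g).
rewrite -/G in G1 b11 b12 b21 b22.
exists ('D_w0 F (val g)), (`|'D_w1 F (val g)| + 1).
have K0 : 0 < `|'D_w1 F (val g)| + 1 by rewrite ltr_wpDl.
pose d := Num.min 1 (r / 4).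
have d0 : 0 < d by rewrite lt_min ltr01/= divr_gt0.
have d1 : d <= 1 by rewrite ge_min lexx.
have dr : d <= r / 4 by rewrite ge_min lexx orbT.
have drr : d < r by lra.
(* [G] bounds the entries of every [h] within [d <= 1] of [g], and the coefficients of the chord are
   at most [2 * p] as [|l^-1 - 1| <= 2 * |1 - l|]; so [d + 2 * p * G < r] keeps the whole chord in
   the range of [r1P] and [r2P]. *)
pose p := Num.min 4^-1 (r / (8 * G)).
have G0 : 0 < G := lt_le_trans ltr01 G1.
have p0 : 0 < p by rewrite lt_min invr_gt0 /= ltr0n /= divr_gt0// mulr_gt0.
have p2 : p <= 2 * p by rewrite ler_peMl ?(ltW p0)// ler1n.
have p4 : p <= 4^-1 by rewrite ge_min lexx.
have dpr : d + 2 * p * G < r.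
  suff pr : 2 * p * G <= r / 4 by lra.
  have : p <= r / (8 * G) by rewrite ge_min lexx orbT.
  by rewrite ler_pdivlMr ?mulr_gt0//; lra.
exists p; split => //.
have : nbhs g (SL2_close d g) by apply/nbhs_SL2P; exists d.
move=> /(nbhs_cls Gs); rewrite cls_repr; apply: (@filterS _ (nbhs x) (nbhs_filter x)).
move=> _ [h /SL2_closeP[h11 h12 h21 h22] <-].
have Gh (u v : R) : `|u - v| < d -> `|u| <= G - 1 -> `|v| <= G.
  by move=> uv; exact: norm_le_near uv d1.
have {}b11 := Gh _ _ h11 b11; have {}b12 := Gh _ _ h12 b12.
have {}b21 := Gh _ _ h21 b21; have {}b22 := Gh _ _ h22 b22.
have Uh : U (val h).
  have [] // := r1P (val h) w0; last by move=> i j; rewrite subrr normr0.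
  by rewrite !valSL2E; apply: mx2_close; apply: lt_le_trans rr1; apply: lt_trans drr.
have bnd (a q : R) : `|q| <= 2 * p -> `|a| <= G -> `|q * a| <= 2 * p * G.
  by move=> qp aG; rewrite normrM; exact: ler_pM.
split=> [l lp|c cp].
  have l4 : `|1 - l| <= 4^-1 by exact: le_trans lp p4.
  have ln0 := near1_neq0 l4.
  pose w := mx2 (m11 h / l) (m12 h / l) (- m21 h) (- m22 h).
  pose v := (1 - l) *: w.
  have vE : v = mx2 ((l^-1 - 1) * m11 h) ((l^-1 - 1) * m12 h)
      ((l - 1) * m21 h) ((l - 1) * m22 h).
    by apply: mx2P; rewrite /v /w !mxE /=; field.
  have q1 : `|l^-1 - 1| <= 2 * p by apply: le_trans (near1_inv l4) _; rewrite ler_wpM2l.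
  have q2 : `|l - 1| <= 2 * p by rewrite distrC; exact: le_trans lp p2.
  have E : val (dil l * h)%g = val h + v.
    rewrite vE [val (dil l * h)%g]valSL2E {1}[val h]valSL2E.
    rewrite !mulSL2E !(dilE ln0) -[mx2 ((l^-1 - 1) * _) _ _ _]scale1r mx2_comb.
    by apply: mx2P; rewrite !mx2E; field.
  have H s : 0 <= s <= 1 -> U (val h + s *: v) /\ `|'D_w F (val h + s *: v) - 'D_w0 F (val g)| <= e.
    move=> s01; apply: r1P => i j.
      rewrite vE (valSL2E g) (valSL2E h) mx2_comb.
      by apply: mx2_close; apply: lt_le_trans rr1;
        apply: (dist_scale_lt s01 _ _ dpr); first [exact: ltW|exact: bnd].
    have E1 (a b : R) : `|a - b| < d -> `|b| <= G -> `|a - b / l| < r1.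
      move=> ab bG; have -> : a - b / l = a - (b + 1 * ((l^-1 - 1) * b)) by field.
      apply: lt_le_trans rr1; apply: (@dist_scale_lt _ _ _ _ (2 * p * G) d) => //.
      - by rewrite ler01 lexx.
      - exact: ltW.
      - exact: bnd.
    have E2 (a b : R) : `|a - b| < d -> `|- a - - b| < r1.
      by move=> ab; rewrite -opprD normrN; apply: lt_le_trans (lt_trans ab drr) rr1.
    by apply: mx2_close; [exact: E1|exact: E1|exact: E2|exact: E2].
  rewrite act_cls.
  have -> : tau (cls Gam h) = F (val h) by exact: tF.
  have -> : tau (cls Gam (dil l * h)%g) = F (val h + v).
    by rewrite -E; apply: tF; rewrite E; have := (H 1); rewrite scale1r => -[]//; rewrite ler01 lexx.
  exact: C1_chord_le cF erefl H.
pose w := mx2 0 0 (m11 h) (m12 h); pose v := c *: w.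
have vE : v = mx2 (c * 0) (c * 0) (c * m11 h) (c * m12 h).
  by apply: mx2P; rewrite /v /w !mxE.
have c2 : `|c| <= 2 * p by exact: le_trans cp p2.
have E : val (vert c * h)%g = val h + v.
  rewrite vE [val (vert c * h)%g]valSL2E {1}[val h]valSL2E.
  rewrite !mulSL2E !vertE -[mx2 (c * 0) _ _ _]scale1r mx2_comb.
  by apply: mx2P; rewrite !mx2E; ring.
have H s : 0 <= s <= 1 -> U (val h + s *: v) /\ `|'D_w F (val h + s *: v) - 'D_w1 F (val g)| <= 1.
  move=> s01; apply: r2P => i j.
    rewrite vE (valSL2E g) (valSL2E h) mx2_comb.
    have G00 : `|0 : R| <= G by rewrite normr0 ltW.
    by apply: mx2_close; apply: lt_le_trans rr2;
      apply: (dist_scale_lt s01 _ _ dpr); first [exact: ltW|exact: bnd].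
  by apply: mx2_close; rewrite ?subrr ?normr0//; apply: lt_le_trans rr2; exact: lt_trans drr.
rewrite act_cls.
have -> : tau (cls Gam h) = F (val h) by exact: tF.
have -> : tau (cls Gam (vert c * h)%g) = F (val h + v).
  by rewrite -E; apply: tF; rewrite E; have := (H 1); rewrite scale1r => -[]//; rewrite ler01 lexx.
have := C1_chord_le cF (erefl v) H; set D := 'D_w1 F (val g) => HD.
have -> : F (val h + v) - F (val h) = (F (val h + v) - F (val h) - c * D) + c * D by ring.
apply: le_trans (ler_normD _ _) _; rewrite mulrDl addrC; apply: lerD => //.
by rewrite normrM mulrC.
Qed.

End C1Homspace.

(** * The drift *)

Section Drift.
Context {R : realType} {Gam : set (SL2 R)}.
Hypotheses (Gs : subgroup Gam) (Gc : cocompact Gam).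
Local Notation X := (homspace Gam).
Variables (mu : probability X R) (inv : SL2_invariant mu).
Variables (tau : X -> R) (tauC1 : C1_homspace tau).
Implicit Types (l c t s T : R) (g : SL2 R) (x : X).

Let ct : continuous tau. Proof. exact: C1_homspace_continuous. Qed.

(* Derivative of tau along the diagonal subgroup, replaced by a difference
   quotient at a fixed l: its error is uniformly small because tau is C^1, and
   its integral vanishes because mu is invariant *)
Definition diff_quot l (x : X) := (1 - l)^-1 * (tau (act (dil l) x) - tau x).

Lemma C1_uniform (e : R) : 0 < e -> exists r K : R, [/\ 0 < r, 0 < K &
  forall x, (forall l l0, `|1 - l| <= r -> `|1 - l0| <= r -> l0 != 1 ->
      `|tau (act (dil l) x) - tau x - (1 - l) * diff_quot l0 x| <= e * `|1 - l|) /\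
    (forall c, `|c| <= r -> `|tau (act (vert c) x) - tau x| <= K * `|c|)].
Proof.
move=> e0; have e2 : 0 < e / 2 by lra.
(* A single parameter [r], used as radius and as inverse of the Lipschitz constant, lets [near_hom]
   treat all bounds at once. The local constant [k] of [C1_local] is replaced by [diff_quot l0], at
   the cost of a second [e / 2]. *)
have : \forall r \near (0 : R)^'+, forall x, 0 < r /\
    ((forall l l0, `|1 - l| <= r -> `|1 - l0| <= r -> l0 != 1 ->
      `|tau (act (dil l) x) - tau x - (1 - l) * diff_quot l0 x| <= e * `|1 - l|) /\
    (forall c, `|c| <= r -> `|tau (act (vert c) x) - tau x| <= r^-1 * `|c|)).
  apply: (near_hom Gc) => x.
  have [k [K [r1 [K0 r10 nB]]]] := C1_local Gs tauC1 x e2.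
  exists ([set y | C1_bounds tau (e / 2) k K r1 y],
    [set r | 0 < r /\ r <= Num.min r1 K^-1]).
    split => //=; near=> r; split; near: r; first exact: nbhs_right_gt.
    by apply: nbhs_right_le; rewrite lt_min r10 invr_gt0.
  move=> [y r] /= [[B1 B2] [r0]]; rewrite le_min => /andP[rr1 rK]; split => //; split.
    move=> l l0 lr l0r l01; have h1 := B1 _ (le_trans lr rr1); have h2 := B1 _ (le_trans l0r rr1).
    have n0 : 1 - l0 != 0 by rewrite subr_eq0 eq_sym.
    have n0' : 0 < `|1 - l0| by rewrite normr_gt0.
    have h3 : `|diff_quot l0 y - k| <= e / 2.
      rewrite -(ler_pM2l n0') -normrM [leRHS]mulrC.
      by rewrite mulrBr /diff_quot mulrA mulfV// mul1r.
    have -> : tau (act (dil l) y) - tau y - (1 - l) * diff_quot l0 y =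
      (tau (act (dil l) y) - tau y - (1 - l) * k) - (diff_quot l0 y - k) * (1 - l) by ring.
    apply: le_trans (ler_normB _ _) _; rewrite normrM.
    have -> : e * `|1 - l| = e / 2 * `|1 - l| + e / 2 * `|1 - l| by field.
    by apply: lerD => //; rewrite ler_wpM2r.
  move=> c cr; apply: le_trans (B2 _ (le_trans cr rr1)) _.
  by rewrite ler_wpM2r// -[K]invrK lef_pV2 ?posrE ?invr_gt0.
move=> H; have [r rP] : exists r : R, forall x, 0 < r /\
    ((forall l l0, `|1 - l| <= r -> `|1 - l0| <= r -> l0 != 1 ->
      `|tau (act (dil l) x) - tau x - (1 - l) * diff_quot l0 x| <= e * `|1 - l|) /\
    (forall c, `|c| <= r -> `|tau (act (vert c) x) - tau x| <= r^-1 * `|c|)).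
  near (0 : R)^'+ => r; exists r; near: r; exact: H.
have r0 : 0 < r by have [] := rP (cls Gam 1%g).
exists r, r^-1; split => //; first by rewrite invr_gt0.
by move=> x; have [] := rP x.
Unshelve. all: by end_near. Qed.

Lemma ltri_vert_dil c l : l != 0 -> ltri c l = (vert (c * l) * dil l)%g :> SL2 R.
Proof.
move=> l0; apply: SL2P; rewrite !mulSL2E !vertE !(dilE l0) !(ltriE _ l0); by field.
Qed.

(** The factor [l ^- 2] is expanded to second order at 1. The constants 5 and 7 are those of
    [near1_invsq] and [near1_invsq2]; the last hypothesis turns the quadratic remainder into one of
    the three [e]. *)
Lemma der_drift_alg (ty ty' tz l D c K e B M : R) : `|1 - l| <= 4^-1 ->
  `|tz - ty'| <= K * (2 * `|c|) -> `|ty' - ty - (1 - l) * D| <= e * `|1 - l| ->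
  `|D| <= B -> `|ty| <= M -> (5 * B + 7 * M) * `|1 - l| <= e ->
  `|tz * l ^- 2 - ty - (2 * ty + D) * (1 - l)| <= 3 * e * `|1 - l| + 4 * K * `|c|.
Proof.
move=> l4 h1 h2 DB tM le.
have /andP[i0 i2] := near1_invsq_le l4.
have j1 := near1_invsq l4; have j2 := near1_invsq2 l4.
have -> : tz * l ^- 2 - ty - (2 * ty + D) * (1 - l) =
  ((tz - ty') + (ty' - ty - (1 - l) * D)) * l ^- 2 +
  ((1 - l) * (l ^- 2 - 1) * D + (l ^- 2 - 1 - 2 * (1 - l)) * ty) by ring.
set n := `|1 - l| in h2 le j1 j2 *; have n0 : 0 <= n by exact: normr_ge0.
have k1 : `|(tz - ty' + (ty' - ty - (1 - l) * D)) * l ^- 2| <= (K * (2 * `|c|) + e * n) * 2.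
  rewrite normrM (ger0_norm i0); apply: ler_pM => //.
  by apply: le_trans (ler_normD _ _) _; exact: lerD.
have k2 : `|(1 - l) * (l ^- 2 - 1) * D| <= n * (5 * n) * B.
  by rewrite !normrM; apply: ler_pM => //; rewrite ?mulr_ge0//; apply: ler_pM.
have k3 : `|(l ^- 2 - 1 - 2 * (1 - l)) * ty| <= 7 * n ^+ 2 * M.
  by rewrite normrM; apply: ler_pM.
have k4 : n * ((5 * B + 7 * M) * n) <= n * e by rewrite ler_wpM2l.
move: k1 k2 k3; set u := (_ + _) * _; set v := _ * D; set w := _ * ty => k1 k2 k3.
apply: le_trans (ler_normD _ _) _; apply: le_trans (lerD k1 (le_trans (ler_normD _ _) (lerD k2 k3))) _.
have -> : (K * (2 * `|c|) + e * n) * 2 + (n * (5 * n) * B + 7 * n ^+ 2 * M) =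
  4 * K * `|c| + 2 * e * n + n * ((5 * B + 7 * M) * n) by ring.
lra.
Qed.

(** In psi, [2 * tau] comes from the clock factor [l ^- 2] and the difference quotient from the
    displacement by [dil l]; the displacement by [vert] is of the size of [c] and goes into the
    error. *)
Lemma drift_deriv (e : R) : 0 < e -> exists psi : X -> R,
  [/\ continuous psi, \int[mu]_x psi x = 2 * \int[mu]_x tau x &
  exists r C : R, [/\ 0 < r, r <= 4^-1, 0 <= C & forall x c l, `|1 - l| <= r -> `|c| <= r ->
    `|tau (act (ltri c l) x) * l ^- 2 - tau x - psi x * (1 - l)| <= e * `|1 - l| + C * `|c|]].
Proof.
move=> e0; have e3 : 0 < e / 3 by lra.
have [r [K [r0 K0 rP]]] := C1_uniform e3.
have [M M0 tM] := hom_bounded Gc ct.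
pose l0 := 1 - r; have l0r : `|1 - l0| <= r by rewrite /l0 subKr ger0_norm// ltW.
have l01 : l0 != 1 by rewrite /l0 -subr_eq0 addrAC subrr sub0r oppr_eq0 gt_eqF.
have cD : continuous (diff_quot l0).
  by apply: hcontZ; apply: hcontB => //; exact: hcont_act.
have [B B0 DB] := hom_bounded Gc cD.
exists (fun x => 2 * tau x + diff_quot l0 x); split.
- by apply: hcontD => //; exact: hcontZ.
- have cta := @hcont_act _ _ Gs tau (dil l0) ct.
  rewrite (hom_intD Gc mu measurableT (hcontZ ct) cD) (hom_intZ Gc mu measurableT _ ct).
  rewrite /diff_quot (hom_intZ Gc mu measurableT _ (hcontB cta ct)).
  have -> : \int[mu]_x (tau (act (dil l0) x) - tau x) = 0.
    have -> : \int[mu]_x (tau (act (dil l0) x) - tau x) =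
        \int[mu]_x (tau (act (dil l0) x)) - \int[mu]_x tau x.
      by rewrite RintegralB//; exact: continuous_hom_integrable.
    by rewrite (hom_int_actT Gs Gc inv)// subrr.
  by rewrite mulr0 addr0.
pose A := 5 * B + 7 * M; have A0 : 0 < A by rewrite addr_gt0// mulr_gt0.
pose r' := Num.min (Num.min 4^-1 (r / 2)) (e / 3 / A).
have r'4 : r' <= 4^-1 by rewrite !ge_min lexx.
have r'r : r' <= r / 2 by rewrite !ge_min lexx orbT.
have r'A : r' <= e / 3 / A by rewrite ge_min lexx orbT.
exists r', (4 * K); split => //.
- by rewrite !lt_min invr_gt0 ltr0n !divr_gt0.
- by rewrite mulr_ge0// ltW.
move=> x c l lr cr.
have l4 : `|1 - l| <= 4^-1 by exact: le_trans lr r'4.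
have ln0 := near1_neq0 l4; have /andP[_ l54] := near1_gt0 l4; have /andP[l34 _] := near1_gt0 l4.
have [P1 P2] := rP x; have [_ P2'] := rP (act (dil l) x).
have clr : `|c * l| <= 2 * `|c|.
  by rewrite normrM mulrC ler_wpM2r// ger0_norm; lra.
have h1 : `|tau (act (ltri c l) x) - tau (act (dil l) x)| <= K * (2 * `|c|).
  rewrite ltri_vert_dil// -actM; apply: le_trans (P2' (c * l) _) _.
    by apply: le_trans clr _; lra.
  by rewrite ler_wpM2l// ltW.
have rr : r / 2 <= r by lra.
have h2 := P1 l l0 (le_trans lr (le_trans r'r rr)) l0r l01.
apply: le_trans (der_drift_alg l4 h1 h2 (DB x) (tM x) _) _.
  by rewrite -/A mulrC -ler_pdivlMr//; exact: le_trans lr r'A.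
by rewrite [3 * _]mulrC divfK.
Qed.

Definition drift g x t := bint tau (act g x) (shear_time g t) - bint tau x t.

Lemma der_drift g x t : shear_lam g t != 0 -> der (drift g x) t
  (tau (act (ltri (m21 g) (shear_lam g t)) (horocycle_flow t x)) * shear_lam g t ^- 2 -
   tau (horocycle_flow t x)).
Proof. by move=> l0; exact: (derB (der_shear Gs x ct l0) (der_bint Gs ct x t)). Qed.

Definition drift_weight g T := `|1 - m22 g| + `|m21 g| * T.

Lemma shear_lam_weight g t T : 0 <= t <= T -> `|1 - shear_lam g t| <= drift_weight g T.
Proof.
move=> /andP[t0 tT]; rewrite /shear_lam /drift_weight opprB addrCA addrC -addrA.
rewrite [X in `|X|](_ : _ = (1 - m22 g) + m21 g * t); last by ring.
apply: le_trans (ler_normD _ _) _; rewrite lerD2l normrM (ger0_norm t0).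
by rewrite ler_wpM2l.
Qed.

Lemma drift_estimate (e : R) : 0 < e -> exists r C : R, [/\ 0 < r, r <= 4^-1, 0 < C &
  forall g x T, 0 <= T -> drift_weight g T <= r -> `|m21 g| <= r ->
  (forall s t, 0 <= s -> s <= t -> t <= T ->
    `|drift g x t - drift g x s| <= C * (drift_weight g T + `|m21 g|) * (t - s)) /\
  `|drift g x T - 2 * (\int[mu]_x tau x) * ((1 - m22 g) * T + m21 g * T ^+ 2 / 2)| <=
  `|drift g x 0| + 3 * e * (T * drift_weight g T) + C * drift_weight g T].
Proof.
move=> e0; have [psi [cpsi Ipsi [r [C [r0 r4 C0 rP]]]]] := drift_deriv e0.
have [Ce Ce0 CeP] := equidistribution Gs Gc inv cpsi e0.
have [B B0 psiB] := hom_bounded Gc cpsi.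
rewrite Ipsi in CeP; set J := 2 * _ in CeP *.
pose C' := B + e + C + 2 * Ce; exists r, C'.
have C'0 : 0 < C' by rewrite ltr_wpDr ?mulr_ge0// ltr_wpDr// addr_gt0.
split => // g x T T0 wr cr; set w := drift_weight g T in wr *.
have lw t : 0 <= t <= T -> `|1 - shear_lam g t| <= w by exact: shear_lam_weight.
have l0 t : 0 <= t <= T -> shear_lam g t != 0.
  by move=> /lw tw; apply: near1_neq0; apply: le_trans tw (le_trans wr r4).
have w0 : 0 <= w by rewrite addr_ge0// mulr_ge0.
set c := m21 g in cr *.
pose d' t := tau (act (ltri c (shear_lam g t)) (horocycle_flow t x)) * shear_lam g t ^- 2 -
   tau (horocycle_flow t x).
have dD t : 0 <= t <= T -> der (drift g x) t (d' t).
  by move=> tT; apply: der_drift; exact: l0.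
have d'P t : 0 <= t <= T ->
    `|d' t - psi (horocycle_flow t x) * (1 - shear_lam g t)| <= e * w + C * `|c|.
  move=> tT; apply: le_trans (rP _ c _ (le_trans (lw _ tT) wr) cr) _.
  by rewrite lerD2r ler_wpM2l ?(ltW e0)// lw.
have d'B t : 0 <= t <= T -> `|d' t| <= C' * (w + `|c|).
  move=> tT; have -> : d' t = (d' t - psi (horocycle_flow t x) * (1 - shear_lam g t)) +
    psi (horocycle_flow t x) * (1 - shear_lam g t) by ring.
  apply: le_trans (ler_normD _ _) _.
  have k1 : `|psi (horocycle_flow t x) * (1 - shear_lam g t)| <= B * w.
    by rewrite normrM; apply: ler_pM => //; exact: lw.
  apply: le_trans (lerD (d'P _ tT) k1) _.
  have k2 : 0 <= (C + 2 * Ce) * w by rewrite mulr_ge0// addr_ge0// mulr_ge0.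
  have k3 : 0 <= (B + e + 2 * Ce) * `|c| by rewrite mulr_ge0// addr_ge0 ?mulr_ge0// ltW// addr_gt0.
  rewrite /C'; lra.
split.
  move=> s t s0 st tT; apply: (der_bound st (f := d')) => u /andP[su ut].
    by apply: dD; rewrite (le_trans s0 su) (le_trans ut tT).
  by apply: d'B; rewrite (le_trans s0 su) (le_trans ut tT).
(* Integration by parts moves the weight [1 - l] off psi: the derivative of [G] contains psi only
   through [bint psi x t - t * J], which equidistribution controls. Two of the three terms
   [e * T * w] come from [bG], the third from [k1]. *)
pose G t := drift g x t - bint psi x t * (1 - shear_lam g t) + J * c * (t * t / 2).
have dG t : 0 <= t <= T -> der G t
    (d' t - psi (horocycle_flow t x) * (1 - shear_lam g t) - c * (bint psi x t - t * J)).
  move=> tT.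
  have d1 : der (fun t => 1 - shear_lam g t) t c.
    apply: der_eq (derB (der_cst 1 t) (derB (der_cst (m22 g) t) (derZ c (der_id t)))) _.
    by ring.
  have d2 : der (fun t => t * t / 2) t t.
    by apply: der_eq (derM (derM (der_id t) (der_id t)) (der_cst 2^-1 t)) _; field.
  apply: der_eq (derD (derB (dD t tT) (derM (der_bint Gs cpsi x t) d1)) (derZ (J * c) d2)) _.
  by ring.
have bG t : 0 <= t <= T ->
    `|d' t - psi (horocycle_flow t x) * (1 - shear_lam g t) - c * (bint psi x t - t * J)| <=
    e * w + C * `|c| + `|c| * (e * T + Ce).
  move=> tT; have /andP[t0 tT'] := tT.
  apply: le_trans (ler_normB _ _) _; apply: lerD; first exact: d'P.
  rewrite normrM ler_wpM2l//; apply: le_trans (CeP t x t0) _.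
  by rewrite lerD2r ler_wpM2l// ltW.
have := der_bound T0 dG bG; rewrite subr0.
have -> : G 0 = drift g x 0 by rewrite /G bint0//; ring.
have := CeP T x T0.
have lT : `|1 - shear_lam g T| <= w by apply: lw; rewrite T0 lexx.
have lTE : 1 - shear_lam g T = (1 - m22 g) + c * T by rewrite /shear_lam -/c; ring.
rewrite /G; move: lT; rewrite lTE.
set D := drift g x T; set D0 := drift g x 0; set P := bint psi x T => lT hP hG.
have cT : `|c| * T <= w by rewrite /w /drift_weight lerDr.
have k1 : `|(P - T * J) * (1 - m22 g + c * T)| <= (e * T + Ce) * w.
  by rewrite normrM; apply: ler_pM.
have -> : D - J * ((1 - m22 g) * T + c * T ^+ 2 / 2) =
  (D - P * (1 - m22 g + c * T) + J * c * (T * T / 2) - D0) +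
  ((P - T * J) * (1 - m22 g + c * T) + D0) by field.
apply: le_trans (ler_normD _ _) _.
apply: le_trans (lerD hG (le_trans (ler_normD _ _) (lerD k1 (lexx _)))) _.
have k2 : C * (`|c| * T) <= C * w by rewrite ler_wpM2l.
have k3 : Ce * (`|c| * T) <= Ce * w by rewrite ler_wpM2l.
have k4 : e * T * (`|c| * T) <= e * T * w by rewrite ler_wpM2l// mulr_ge0// ltW.
have k5 : 0 <= (B + e) * w by rewrite mulr_ge0// ltW// addr_gt0.
rewrite /C'; lra.
Qed.

End Drift.

(** * The strong R-property *)

Section RealSelection.
Context {R : realType}.
Implicit Types (a c T L : R).

(** Used, like [seq_lower], to choose one constant that satisfies a finite list of bounds. *)
Lemma seq_upper (s : seq R) : exists B, all (fun z => z <= B) s.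
Proof.
elim: s => [|z s [B IH]]; first by exists 0.
exists (Num.max z B); rewrite /= le_max lexx /=; apply: sub_all IH => y yB.
by rewrite le_max yB orbT.
Qed.

Lemma seq_lower (s : seq R) : all (fun z => 0 < z) s ->
  exists2 r, 0 < r & all (fun z => r <= z) s.
Proof.
elim: s => [|z s IH] /=; first by exists 1.
move=> /andP[z0 /IH[r r0 rs]]; exists (Num.min z r); first by rewrite lt_min z0.
by rewrite ge_min lexx /=; apply: sub_all rs => y yB; rewrite ge_min yB orbT.
Qed.

(** At one time [E] and [C] may cancel, but they are linear combinations of the values at two times.
    Since |E| <= 4 |q2| + |q1| and |C| <= 8 |q2| + 4 |q1|, the constant is 12 + 5 = 17. *)
Lemma quadratic_norm (E C : R) (Q := fun s : R => E * s + C * s ^+ 2 / 2) :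
  `|E| + `|C| <= 17 * `|Q 1| \/ `|E| + `|C| <= 17 * `|Q 2^-1|.
Proof.
have EE : E = 4 * Q 2^-1 - Q 1 by rewrite /Q; field.
have CE : C = 2 * (Q 1 - E) by rewrite /Q; field.
move: EE CE; move: (Q 1) (Q 2^-1) => q1 q2 EE CE.
have hE : `|E| <= 4 * `|q2| + `|q1|.
  by rewrite EE; apply: le_trans (ler_normB _ _) _; rewrite normrM (ger0_norm (_ : 0 <= 4)).
have hC : `|C| <= 2 * (`|q1| + `|E|).
  by rewrite CE normrM (ger0_norm (_ : 0 <= 2))// ler_wpM2l// ler_normB.
by have [h|h] := leP `|q1| `|q2|; [right|left]; lra.
Qed.

Lemma exists_weight a c (W : R) : 0 <= a -> 0 <= c -> 0 < a + c -> 0 < W ->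
  exists2 T, 0 < T & T * (a + c * T) = W.
Proof.
move=> a0 c0 ac W0; pose b := 1 + W / (a + c).
have b1 : 1 <= b by rewrite lerDl divr_ge0 ?ltW.
pose f T := T * (a + c * T).
have fb : W <= f b.
  apply: le_trans (_ : b * (a + c) <= _).
    by rewrite mulrDl mul1r divfK ?gt_eqF// lerDr ltW.
  by rewrite ler_wpM2l ?lerD2l ?ler_peMr// (le_trans ler01).
have [|||T] := @IVT R f 0 b W.
- exact: le_trans ler01 b1.
- apply: der_within => t _; eexists.
  exact: (derM (der_id t) (derD (der_cst a t) (derZ c (der_id t)))).
- by rewrite ge_min le_max fb orbT andbT /f mul0r ltW.
rewrite in_itv /= => /andP[T0 _] fT; exists T => //; rewrite lt_neqAle T0 andbT.
by apply: contraTneq W0 => TE; rewrite -fT /f -TE mul0r ltxx.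
Qed.

Lemma drift_lower (D Q D0 a b : R) : `|D0| <= 8^-1 -> a <= 4^-1 -> b <= 8^-1 ->
  `|D - Q| <= `|D0| + a + b -> 2 <= `|Q| -> 3 / 2 <= `|D|.
Proof. by have := lerB_dist Q D; rewrite distrC; lra. Qed.

Lemma norm_shift_ge (p q : R) : 3 / 2 <= `|q| -> `|p - q| <= 8^-1 -> 3 / 4 <= `|p|.
Proof. by have := lerB_dist q p; rewrite distrC; lra. Qed.

(** [M1] is the first integer where [P] reaches 3/4. At earlier integers [P] is below 3/4, and a
    unit of time adds at most 1/8. *)
Lemma drift_select (P : R -> R) (N1 n1 : nat) :
  (forall u v, 0 <= u -> u <= v -> v <= u + 1 -> v <= n1%:R -> `|P v - P u| <= 8^-1) ->
  (forall n, (n <= N1)%N -> `|P n%:R| < 3 / 4) -> 3 / 4 <= `|P n1%:R| ->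
  exists M1 : nat, [/\ (N1 < M1)%N, (M1 <= n1)%N, 3 / 4 <= `|P M1%:R| &
    forall L, 0 <= L <= M1%:R -> `|P L| <= 1].
Proof.
move=> Pv PN Pn1; have exP : exists n, 3 / 4 <= `|P n%:R| by exists n1.
have [M1 PM1 minM1] := ex_minnP exP; exists M1.
have NM : (N1 < M1)%N by rewrite ltnNge; apply/negP => /PN; rewrite ltNge PM1.
have Mn : (M1 <= n1)%N by exact: minM1.
split => // L /andP[L0 LM].
case: M1 => [//|k] in PM1 minM1 NM Mn LM *.
have /andP[tL Lt] : (Num.truncn L)%:R <= L < (Num.truncn L).+1%:R by exact: truncn_itv.
(* For [L = k.+1], which is [M1], truncation would return [M1] itself, where [P] is only bounded
   below; the minimum falls back to [k]. *)
pose n := minn (Num.truncn L) k.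
have nk : (n <= k)%N by rewrite geq_minr.
have nL : n%:R <= L by apply: le_trans tL; rewrite ler_nat geq_minl.
have Ln : L <= n%:R + 1.
  rewrite natr1 /n; have [h|h] := leqP (Num.truncn L) k; first exact: ltW.
  exact: LM.
have Pn : `|P n%:R| < 3 / 4.
  by rewrite ltNge; apply/negP => /minM1; rewrite leqNgt ltnS nk.
have H := Pv n%:R L (ler0n _ _) nL Ln (le_trans LM _).
have {}H : `|P L - P n%:R| <= 8^-1 by apply: H; rewrite ler_nat.
have -> : P L = (P L - P n%:R) + P n%:R by ring.
by apply: le_trans (ler_normD _ _) _; lra.
Qed.

End RealSelection.

(** * Growth of the drift and bounds on its slope *)

Section StrongR.
Context {R : realType} {Gam : set (SL2 R)}.
Hypotheses (Gs : subgroup Gam) (Gc : cocompact Gam).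
Local Notation X := (homspace Gam).
Variables (dG : SL2 R -> SL2 R -> R) (dGP : right_invariant_metric dG).
Variables (mu : probability X R) (inv : SL2_invariant mu).
Variables (tau : X -> R) (tauC1 : C1_homspace tau).
Variables (m M : R) (m0 : 0 < m) (mtau : forall x, m <= tau x)
  (M0 : 0 < M) (tauM : forall x, `|tau x| <= M).
Local Notation T := (time_change tau).
Local Notation alpha := (time_alpha tau).
Local Notation d := (@quot_dist R dG Gam).

Let ct : continuous tau. Proof. exact: C1_homspace_continuous. Qed.

Let J := 2 * \int[mu]_x tau x.

Hypothesis J0 : 0 < J.

(** The drift read in the new clock of the first orbit; its value at L serves as the shift p_L. *)
Definition drift_time g x u := drift tau g x (alpha x u).

Lemma time_change_drift g x u : shear_lam g (alpha x u) != 0 ->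
  T (u + drift_time g x u) (act g x) =
  act (ltri (m21 g) (shear_lam g (alpha x u))) (T u x).
Proof.
move=> l0; rewrite /drift_time /drift (bint_alpha Gs ct m0 mtau) addrCA subrr addr0.
by rewrite (time_change_bint Gs ct m0 mtau) shear_flow.
Qed.

Lemma drift0_le g x : `|1 - m22 g| <= 4^-1 -> `|m12 g| <= (16 * M)^-1 ->
  `|drift tau g x 0| <= 8^-1.
Proof.
move=> d4 bM; rewrite /drift bint0// subr0.
apply: le_trans (bint_bound Gs ct _ _ tauM) _.
have -> : shear_time g 0 = (m22 g)^-1 * - m12 g.
  by rewrite /shear_time /shear_lam mul0r sub0r mulr0 subr0 mulrC.
have /andP[i0 i2] := near1_inv_le d4.
have h : `|(m22 g)^-1 * - m12 g| <= 2 * (16 * M)^-1.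
  by rewrite normrM normrN (gtr0_norm i0); apply: ler_pM => //; exact: ltW.
have -> : 8^-1 = M * (2 * (16 * M)^-1) by field; rewrite gt_eqF.
by rewrite ler_wpM2l// ltW.
Qed.

Lemma bint_le x t : 0 <= t -> bint tau x t <= M * t.
Proof.
move=> t0; apply: le_trans (ler_norm _) _.
by have := bint_bound Gs ct x t tauM; rewrite (ger0_norm t0).
Qed.

Lemma bint_ge0 x t : 0 <= t -> 0 <= bint tau x t.
Proof.
move=> t0; have := bint_growth Gs ct mtau x t0; rewrite bint0// !subr0.
by apply: le_trans; rewrite mulr_ge0// ltW.
Qed.

Lemma alpha_ge0 x u : 0 <= u -> 0 <= alpha x u.
Proof. by move=> u0; rewrite -(alpha0 Gs ct m0 mtau x); exact: (alpha_le Gs ct m0 mtau). Qed.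

Lemma alphaB_le x u v : u <= v -> alpha x v - alpha x u <= (v - u) / m.
Proof.
move=> uv; apply: le_trans (ler_norm _) _; apply: le_trans (alpha_lip Gs ct m0 mtau _ _ _) _.
by rewrite ger0_norm// subr_ge0.
Qed.

(** [K] precedes [B] because kappa is later chosen from [K], whereas [B] carries the dependence on
    N. The bounds extend to [4 * S]: the integer [n1] is reached before [2 * S], and a window may go
    beyond it by at most as much. *)
Lemma drift_profile : exists K : R, 0 < K /\ forall B : R, exists2 r, 0 < r &
  forall g x, SL2_close r 1%g g -> ~ (exists t, g = horo t) ->
  exists (S : R) (n1 : nat), [/\ B <= S, 0 < S, n1%:R <= 2 * M * S & alpha x n1%:R <= 2 * S] /\
    [/\ 3 / 4 <= `|drift_time g x n1%:R|, `|drift tau g x 0| <= 8^-1,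
      (forall t, 0 <= t <= 4 * S -> `|1 - shear_lam g t| <= K / S) &
      (forall s t, 0 <= s -> s <= t -> t <= 4 * S ->
        `|drift tau g x t - drift tau g x s| <= K / S * (t - s))].
Proof.
(* 34 = 2 * 17, so that by quadratic_norm the main term of the drift reaches 2
   at S / 2 or at S; e makes the error terms at most 1 / 2 in total *)
pose W := 34 / J; have W0 : 0 < W by rewrite divr_gt0.
pose e := (12 * W)^-1; have e0 : 0 < e by rewrite invr_gt0 mulr_gt0.
have [r1 [C [r10 r14 C0 CP]]] := drift_estimate Gs Gc inv tauC1 e0.
(* [4 * W] bounds [S] times the drift weight of [4 * S]; [5 * C * W] bounds the slope, where
   [|m21 g|] adds one more [W / S] to this weight. *)
pose K := 4 * W + 5 * C * W.
have W1 := ltW W0; have C1 := ltW C0.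
have CW : 0 <= 5 * C * W by apply: mulr_ge0 => //; exact: mulr_ge0.
have K4 : 4 * W <= K by rewrite lerDl.
have K5 : 5 * C * W <= K by rewrite lerDr; exact: mulr_ge0.
have K0 : 0 < K by apply: lt_le_trans K4; rewrite mulr_gt0.
exists K; split => // B.
(* Lower bounds on [S]: 1 for [|m21 g| <= W / S]; [M^-1] and [m^-1] so that rounding to an integer
   time at most doubles the bounds; [K / r1] for [drift_estimate]; [8 * C * W] for an error of 1/8;
   [8 * K / m] for a change of at most 1/8 under rounding. *)
have [S0] := seq_upper [:: 1; B; M^-1; m^-1; K / r1; 8 * C * W; 8 * K / m].
move=> /= /and5P[S01 S0B S0M S0m /and4P[S0r S0C S0K _]].
have S00 : 0 < S0 by exact: lt_le_trans S01.
(* [4^-1] and [(16 * M)^-1] make the initial drift at most 1/8. The last entry gives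
   [S0 * (r + r * S0) <= W], which excludes [S < S0]. *)
have [|r r0] := seq_lower (s := [:: 4^-1; r1; (16 * M)^-1; W / (S0 * (1 + S0))]).
  by rewrite /= invr_gt0 ltr0n r10 invr_gt0 mulr_gt0//= divr_gt0// mulr_gt0// addr_gt0.
move=> /= /and5P[r4 rr1 rM rW _]; exists r => // g x /SL2_closeP.
rewrite !oneSL2E !sub0r !normrN => -[_ bg cg dg] nh.
(* If both coefficients vanish then [g] is horocyclic, and the two points lie on one orbit. *)
have nz : 0 < `|1 - m22 g| + `|m21 g|.
  rewrite lt_neqAle eq_sym addr_ge0// andbT; apply/negP; rewrite paddr_eq0// !normr_eq0.
  move=> /andP[/eqP d1 /eqP c0]; apply: nh; exists (m12 g).
  have d1' : m22 g = 1 by lra.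
  have := SL2_det g; rewrite d1' c0 mulr1 mulr0 subr0 => a1.
  by apply: SL2P; rewrite !horoE ?a1 ?d1' ?c0.
have [S Sp SW] := exists_weight (normr_ge0 (1 - m22 g)) (normr_ge0 (m21 g)) nz W0.
have SS0 : S0 <= S.
  rewrite leNgt; apply/negP => SlS0.
  have : S * (`|1 - m22 g| + `|m21 g| * S) < W; last by rewrite SW ltxx.
  have h1 : S * (`|1 - m22 g| + `|m21 g| * S) < S0 * (r + r * S0).
    apply: ltr_pM => //; first exact: ltW.
      by rewrite addr_ge0// mulr_ge0// ltW.
    by apply: ltrD => //; apply: ltr_pM => //; exact: ltW.
  apply: lt_le_trans h1 _; rewrite -[X in _ + X]mulrC -[X in X + _]mul1r -mulrDl.
  by rewrite mulrA -ler_pdivlMl ?mulr_gt0 ?addr_gt0// mulrC.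
have wS : drift_weight g S = W / S.
  by rewrite -SW /drift_weight mulrAC mulfV ?mul1r// gt_eqF.
have wm (s t : R) : s <= t -> drift_weight g s <= drift_weight g t.
  by move=> st; rewrite lerD2l ler_wpM2l.
have wS4 : drift_weight g (4 * S) <= 4 * W / S.
  have -> : 4 * W / S = 4 * drift_weight g S by rewrite wS; ring.
  have -> : 4 * drift_weight g S = drift_weight g (4 * S) + 3 * `|1 - m22 g|.
    by rewrite /drift_weight; ring.
  by rewrite lerDl mulr_ge0.
have S1 := le_trans S01 SS0.
have cS : `|m21 g| <= W / S.
  rewrite -wS /drift_weight; apply: le_trans (_ : `|m21 g| * S <= _).
    by rewrite ler_peMr.
  by rewrite lerDr.
have S40 : 0 <= 4 * S by rewrite mulr_ge0// ltW.
have le_div (a b : R) : 0 < b -> a / b <= S -> a / S <= b.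
  by move=> b0; rewrite !ler_pdivrMr// mulrC.
have KS : K / S <= r1 by apply: le_div => //; exact: le_trans S0r SS0.
have w4r : drift_weight g (4 * S) <= r1.
  by apply: le_trans wS4 (le_trans _ KS); rewrite ler_pM2r// invr_gt0.
have cr1 : `|m21 g| <= r1 by apply: le_trans (ltW cg) rr1.
have [var _] := CP g x (4 * S) S40 w4r cr1.
have D0 : `|drift tau g x 0| <= 8^-1.
  by apply: drift0_le; [exact: le_trans (ltW dg) r4|exact: le_trans (ltW bg) rM].
have lin (s t : R) : 0 <= s -> s <= t -> t <= 4 * S ->
    `|drift tau g x t - drift tau g x s| <= K / S * (t - s).
  move=> s0 st tS; apply: le_trans (var _ _ s0 st tS) _.
  rewrite ler_wpM2r ?subr_ge0//.
  apply: le_trans (_ : C * (4 * W / S + W / S) <= _).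
    by rewrite ler_wpM2l ?lerD// ltW.
  have -> : C * (4 * W / S + W / S) = 5 * C * W / S by field; rewrite gt_eqF.
  by rewrite ler_pM2r// invr_gt0.
have big (t : R) : 0 <= t -> t <= S ->
    2 <= `|J * ((1 - m22 g) * t + m21 g * t ^+ 2 / 2)| -> 3 / 2 <= `|drift tau g x t|.
  move=> t0 tS H.
  have wt : drift_weight g t <= W / S by rewrite -wS; exact: wm.
  have w4t : drift_weight g t <= r1.
    by apply: le_trans (wm _ _ _) w4r; apply: le_trans tS _; rewrite ler_peMl ?ler1n// ltW.
  have [_ est] := CP g x t t0 w4t cr1; rewrite -/J in est.
  have w0 : 0 <= drift_weight g t by rewrite addr_ge0// mulr_ge0.
  have h1 : t * drift_weight g t <= W.
    apply: le_trans (_ : S * (W / S) <= _); first exact: ler_pM.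
    by rewrite mulrCA mulfV ?mulr1// gt_eqF.
  have h2 : 3 * e * (t * drift_weight g t) <= 4^-1.
    have -> : (4^-1 : R) = 3 * e * W by rewrite /e; field; rewrite gt_eqF.
    by rewrite ler_wpM2l// mulr_ge0// ltW.
  have h3 : C * drift_weight g t <= 8^-1.
    apply: le_trans (_ : C * (W / S) <= _); first by rewrite ler_wpM2l// ltW.
    rewrite mulrA; apply: le_div; first by rewrite invr_gt0.
    by rewrite invrK mulrC mulrA; exact: le_trans S0C SS0.
  exact: drift_lower D0 h2 h3 est H.
have [t [t0 tS Dt]] : exists t, [/\ 0 <= t, t <= S & 3 / 2 <= `|drift tau g x t|].
  have Wle : W = `|(1 - m22 g) * S| + `|m21 g * S ^+ 2|.
    by rewrite !normrM (gtr0_norm Sp) -SW; ring.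
  have J2 q : W <= 17 * `|q| -> 2 <= `|J * q|.
    move=> Wq; have -> : (2 : R) = J * (W / 17) by rewrite /W; field; rewrite gt_eqF.
    by rewrite normrM (gtr0_norm J0) ler_pM2l// ler_pdivrMr// mulrC.
  have [H|H] := quadratic_norm ((1 - m22 g) * S) (m21 g * S ^+ 2).
    exists S; split; [exact: ltW|by []|]; apply: big => //; first exact: ltW.
    apply: J2; rewrite {1}Wle.
    by apply: le_trans H _; rewrite expr1n !mulr1.
  have S20 : 0 <= S / 2 by rewrite divr_ge0// ltW.
  have S2S : S / 2 <= S by rewrite ler_pdivrMr// ler_peMr ?ler1n// ltW.
  exists (S / 2); split=> //; apply: big => //; apply: J2; rewrite {1}Wle.
  apply: le_trans H _; rewrite le_eqVlt; apply/orP; left; apply/eqP; congr (_ * `|_|).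
  by field.
pose u := bint tau x t; have u0 : 0 <= u by exact: bint_ge0.
have ua : alpha x u = t by rewrite /u (alpha_bint Gs ct m0 mtau).
have uM : u <= M * S by apply: le_trans (bint_le x t0) _; rewrite ler_wpM2l// ltW.
(* The drift is large at a real time; the next integer of the new clock changes it by at most 1/8,
   and 3/2 leaves room above 3/4. *)
pose n1 := (Num.truncn u).+1.
have /andP[un nu] : (Num.truncn u)%:R <= u < n1%:R by exact: truncn_itv.
have n1u : n1%:R <= u + 1 by rewrite /n1 -natr1 lerD2r.
have MS : 1 <= M * S.
  by rewrite -ler_pdivrMl// mulr1; exact: le_trans S0M SS0.
have mS : m^-1 <= S by exact: le_trans S0m SS0.
have an : alpha x n1%:R - alpha x u <= m^-1.
  apply: le_trans (alphaB_le x (ltW nu)) _; rewrite -[leRHS]mul1r ler_pM2r ?invr_gt0//.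
  by rewrite lerBlDl.
have an2 : alpha x n1%:R <= 2 * S.
  rewrite ua in an; have -> : 2 * S = S + S by ring.
  by rewrite -[alpha _ _](subrK t); apply: lerD => //; exact: le_trans an mS.
exists S, n1; split; split => //.
- exact: le_trans S0B SS0.
- have -> : 2 * M * S = M * S + M * S by ring.
  by apply: le_trans n1u _; exact: lerD.
- have tn : t <= alpha x n1%:R by rewrite -ua; apply: (alpha_le Gs ct m0 mtau); exact: ltW.
  have n4 : alpha x n1%:R <= 4 * S by apply: le_trans an2 _; rewrite ler_wpM2r ?(ltW Sp)// ler_nat.
  have h := lin _ _ t0 tn n4.
  have h' : `|drift_time g x n1%:R - drift tau g x t| <= 8^-1.
    apply: le_trans h _; rewrite -ua; apply: le_trans (_ : K / S * m^-1 <= _).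
      by rewrite ler_wpM2l// divr_ge0// ltW.
    rewrite mulrAC; apply: le_div; first by rewrite invr_gt0.
    by rewrite invrK mulrAC [K * 8]mulrC; exact: le_trans S0K SS0.
  exact: norm_shift_ge Dt h'.
- move=> t' t'S; apply: le_trans (shear_lam_weight _ t'S) _; apply: le_trans wS4 _.
  by rewrite ler_pM2r// invr_gt0.
Qed.

End StrongR.

(** * Closeness of the orbits on windows *)

Section Closeness.
Context {R : realType} {Gam : set (SL2 R)}.
Hypotheses (Gs : subgroup Gam) (Gc : cocompact Gam).
Local Notation X := (homspace Gam).
Variables (dG : SL2 R -> SL2 R -> R) (dGP : right_invariant_metric dG).
Hypothesis iG : isolated Gam = Gam.
Variables (mu : probability X R) (inv : SL2_invariant mu).
Variables (tau : X -> R) (tauC1 : C1_homspace tau) (tau0 : forall x, 0 < tau x).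
Local Notation T := (time_change tau).
Local Notation alpha := (time_alpha tau).
Local Notation d := (@quot_dist R dG Gam).

Let ct : continuous tau. Proof. exact: C1_homspace_continuous. Qed.

Lemma horo_close (r t : R) : `|t| < r -> SL2_close r 1%g (horo t).
Proof.
move=> tr; have r0 : 0 < r by exact: le_lt_trans tr.
by apply/SL2_closeP; rewrite !oneSL2E !horoE !subrr sub0r normrN normr0; split.
Qed.

Lemma time_change_near e : 0 < e -> exists2 r, 0 < r &
  forall x v, `|v| <= r -> d x (T v x) < e.
Proof.
have [m m0 mtau] := hom_lower Gc ct tau0.
move=> e0; have [r r0 rP] := @quot_dist_near _ Gam _ dGP _ e0.
exists (m * (r / 2)); first by rewrite mulr_gt0// divr_gt0.
move=> x v vr; rewrite time_changeE; apply: rP; apply: horo_close.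
have := alpha_lip Gs ct m0 mtau x v 0; rewrite (alpha0 Gs ct m0 mtau) !subr0 => h.
apply: le_lt_trans h _; rewrite ltr_pdivrMr// mulrC.
by apply: le_lt_trans vr _; rewrite ltr_pM2l// ltr_pdivrMr// ltr_pMr// ltr1n.
Qed.

Lemma not_orbit_not_horo x g : ~ (exists t, x = T t (act g x)) -> ~ (exists t, g = horo t).
Proof.
have [m m0 mtau] := hom_lower Gc ct tau0.
move=> nx [t gt]; apply: nx; exists (bint tau (act g x) (- t)).
rewrite (time_change_bint Gs ct m0 mtau) gt -/(horocycle_flow t x).
by rewrite -hflowD// addNr hflow0.
Qed.

Lemma close_on_full eps kap L q x x' : 0 < eps -> 0 < kap -> 0 < L ->
  (forall t, L <= t <= L + kap * L -> d (T t x) (T (t + q) x') < eps) ->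
  close_on d T eps kap L q x x'.
Proof.
move=> e0 k0 L0 H; rewrite /close_on.
have -> : [set t | (L <= t <= L + kap * L)%R /\ (d (T t x) (T (t + q) x') < eps)%R] =
    `[L, L + kap * L]%classic.
  apply/seteqP; split => t /=; rewrite in_itv /=; first by case.
  by move=> tL; split => //; exact: H.
rewrite lebesgue_measure_itv /= lte_fin ltrDl mulr_gt0// -EFinB lee_fin.
rewrite addrAC subrr add0r ler_piMl ?(ltW (mulr_gt0 k0 L0))//.
by rewrite gerBl ltW.
Qed.

Lemma time_change_strong_R : forall eps : R, 0 < eps -> exists2 kap : R, 0 < kap < eps &
  forall N : nat, exists2 del : R, 0 < del &
    forall x x', d x x' < del -> ~ (exists t, x = T t x') ->
    exists (M1 : nat) (q : R -> R),
      [/\ (N <= M1)%N, kap ^- 2 <= M1%:R,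
          forall L, kap ^- 2 <= L <= M1%:R ->
            - 1 <= q L <= 1 /\ close_on d T eps kap L (q L) x x' &
          1 / 2 <= `|q M1%:R|].
Proof.
move=> eps e0; have e2 : 0 < eps / 2 by rewrite divr_gt0.
have [m m0 mtau] := hom_lower Gc ct tau0.
have [M M0 tauM] := hom_bounded Gc ct.
have J0 : 0 < 2 * \int[mu]_x tau x by rewrite mulr_gt0//; exact: (int_tau_gt0 Gc mu ct tau0).
have [K [K0 prof]] := drift_profile Gs Gc inv tauC1 m0 mtau M0 tauM J0.
have [rd rd0 rdP] := @quot_dist_near _ Gam _ dGP _ e2.
have [rho rho0 rhoP] := time_change_near e2.
have rd4 : 2 * (rd / 4) < rd by lra.
have n58 : 2^-1 + 8^-1 < 3 / 4 :> R by lra.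
have n12 : 1 / 2 <= 3 / 4 :> R by lra.
have [_ _ _ dtri] := quot_dist_metric Gs dGP iG.
(* [eps / 2] gives [kap < eps]; [m / M] keeps the windows before time [4 * S] of the horocycle flow;
   the third bound makes the drift vary by at most [rho] on a window, whose length is at most
   [kap * (2 * M * S)]. *)
have [|kap k0] := seq_lower (s := [:: eps / 2; m / M; rho * m / (2 * M * K)]).
  by rewrite /= e2 !divr_gt0// !mulr_gt0.
move=> /= /and4P[ke kmM krho _]; exists kap.
  by rewrite k0 (le_lt_trans ke)// ltr_pdivrMr// ltr_pMr// ltr1n.
(* Beyond [N1] both lower bounds on [M1] hold. Up to [N1] the drift will be kept below 3/4, so that
   the selected integer is larger. *)
move=> N; pose N1 := ((Num.truncn (kap ^- 2)).+1 + N)%N.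
have kN1 : kap ^- 2 <= N1%:R.
  have k2 : 0 <= kap ^- 2 by rewrite invr_ge0 exprn_ge0// ltW.
  have /andP[_ h] := truncn_itv k2; apply: le_trans (ltW h) _.
  by rewrite ler_nat leq_addr.
(* In order: the drift changes by at most 1/8 per unit of time; [N1] is reached before [4 * S]; the
   drift moves by at most 1/2 up to [N1], and 1/2 + 1/8 < 3/4; [|1 - l| <= 4^-1]; and
   [2 * |1 - l| < rd]. *)
have [B] := seq_upper [:: 8 * K / m; N1%:R / m; 2 * K * N1%:R / m; 4 * K; 4 * K / rd].
move=> /= /and5P[B1 B2 B3 B4 /andP[B5 _]].
have [r r0 rP] := prof B.
have rr0 : 0 < Num.min r rd by rewrite lt_min r0 rd0.
have [del del0 delP] := @quot_dist_close _ Gam _ dGP _ rr0.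
exists del => // x x' /delP[g gr x'E] nx; rewrite x'E in nx *.
have gr1 : SL2_close r 1%g g by move=> i j; have := gr i j; rewrite lt_min => /andP[].
have gr2 : SL2_close rd 1%g g by move=> i j; have := gr i j; rewrite lt_min => /andP[].
have [S [n1 [[BS S0 n1S an1] [Dn1 D0 lamS lip]]]] := rP g x gr1 (not_orbit_not_horo nx).
pose P := drift_time tau g x.
have le_div (a b : R) : 0 < b -> a / b <= S -> a / S <= b.
  by move=> b0; rewrite !ler_pdivrMr// mulrC.
have KS0 : 0 <= K / S by rewrite divr_ge0// ltW.
have Plip u v : 0 <= u -> u <= v -> alpha x v <= 4 * S ->
    `|P v - P u| <= K / S * ((v - u) / m).
  move=> u0 uv av; apply: le_trans (lip _ _ _ _ av) _.
  - exact: (alpha_ge0 Gs tauC1 m0 mtau).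
  - exact: (alpha_le Gs ct m0 mtau).
  - by rewrite ler_wpM2l// (alphaB_le Gs tauC1 m0 mtau).
have a24 : 2 * S <= 4 * S by rewrite ler_pM2r// ler_nat.
have an4 v : v <= n1%:R -> alpha x v <= 4 * S.
  by move=> vn; apply: le_trans (alpha_le Gs ct m0 mtau x vn) (le_trans an1 a24).
have Punit u v : 0 <= u -> u <= v -> v <= u + 1 -> v <= n1%:R -> `|P v - P u| <= 8^-1.
  move=> u0 uv vu vn; apply: le_trans (Plip _ _ u0 uv (an4 _ vn)) _.
  apply: le_trans (_ : K / S * m^-1 <= _).
    by rewrite ler_wpM2l// -[leRHS]mul1r ler_pM2r ?invr_gt0// lerBlDl.
  rewrite mulrAC; apply: le_div; first by rewrite invr_gt0.
  by rewrite invrK mulrAC [K * 8]mulrC; exact: le_trans B1 BS.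
have P0 : P 0 = drift tau g x 0 by rewrite /P /drift_time (alpha0 Gs ct m0 mtau).
have Psmall n : (n <= N1)%N -> `|P n%:R| < 3 / 4.
  move=> nN; have nN' : n%:R / m <= N1%:R / m by rewrite ler_pM2r ?invr_gt0// ler_nat.
  have an : alpha x n%:R <= 4 * S.
    have := alphaB_le Gs tauC1 m0 mtau x (ler0n R n); rewrite (alpha0 Gs ct m0 mtau) !subr0.
    move=> /le_trans; apply; apply: le_trans nN' _; apply: le_trans B2 _; apply: le_trans BS _.
    by rewrite ler_peMl ?ler1n// ltW.
  have := Plip 0 n%:R (lexx _) (ler0n _ _) an; rewrite subr0 P0 => h.
  have {}h : `|P n%:R - drift tau g x 0| <= 2^-1.
    apply: le_trans h _; apply: le_trans (_ : K / S * (N1%:R / m) <= _).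
      by rewrite ler_wpM2l.
    rewrite mulrAC; apply: le_div; first by rewrite invr_gt0.
    by rewrite invrK [_ * 2]mulrC !mulrA; exact: le_trans B3 BS.
  have -> : P n%:R = (P n%:R - drift tau g x 0) + drift tau g x 0 by ring.
  apply: le_lt_trans (ler_normD _ _) _; exact: le_lt_trans (lerD h D0) n58.
have [M1 [NM1 M1n PM1 PL]] := drift_select Punit Psmall Dn1.
have kM1 : kap ^- 2 <= M1%:R by apply: le_trans kN1 _; rewrite ler_nat ltnW.
exists M1, P; split => //.
- by rewrite (leq_trans _ (ltnW NM1))// leq_addl.
- move=> L /andP[kL LM]; have L0 : 0 < L.
    by apply: lt_le_trans kL; rewrite invr_gt0 exprn_gt0.
  split; first by rewrite -ler_norml; apply: PL; rewrite (ltW L0).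
  apply: close_on_full => // u /andP[Lu uL].
  have LS : L <= 2 * M * S by apply: le_trans LM (le_trans _ n1S); rewrite ler_nat.
  have u0 : 0 <= u by exact: le_trans (ltW L0) Lu.
  have uLm : (u - L) / m <= kap * (2 * M * S) / m.
    rewrite ler_pM2r ?invr_gt0// lerBlDl; apply: le_trans uL _.
    by rewrite lerD2l ler_pM2l.
  have au : alpha x u <= 4 * S.
    have aL : alpha x L <= 2 * S.
      by apply: le_trans an1; apply: (alpha_le Gs ct m0 mtau); apply: le_trans LM _; rewrite ler_nat.
    have h := le_trans (alphaB_le Gs tauC1 m0 mtau x Lu) uLm.
    have h2 : kap * (2 * M * S) / m <= 2 * S.
      have -> : kap * (2 * M * S) / m = kap / (m / M) * (2 * S) by field; rewrite !gt_eqF.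
      by rewrite ler_piMl ?ler_pdivrMr ?mul1r ?divr_gt0// mulr_ge0// ltW.
    have -> : 4 * S = 2 * S + 2 * S by ring.
    by rewrite -[alpha x u](subrK (alpha x L)); apply: lerD aL; exact: le_trans h h2.
  have a0 : 0 <= alpha x u by exact: (alpha_ge0 Gs tauC1 m0 mtau).
  have Pu : `|P L - P u| <= rho.
    rewrite distrC; apply: le_trans (Plip _ _ (ltW L0) Lu au) _.
    apply: le_trans (_ : K / S * (kap * (2 * M * S) / m) <= _); first by rewrite ler_wpM2l.
    have -> : K / S * (kap * (2 * M * S) / m) = kap / (rho * m / (2 * M * K)) * rho.
      by field; rewrite !gt_eqF.
    by rewrite ler_piMl ?ler_pdivrMr ?mul1r ?divr_gt0 ?mulr_gt0// ltW.
  have lam := lamS _ (introT andP (conj a0 au)).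
  have lam4 : `|1 - shear_lam g (alpha x u)| <= 4^-1.
    apply: le_trans lam _; apply: le_div; first by rewrite invr_gt0.
    by rewrite invrK mulrC; exact: le_trans B4 BS.
  have lamrd : 2 * `|1 - shear_lam g (alpha x u)| < rd.
    have h : K / S <= rd / 4.
      apply: le_div; first by rewrite divr_gt0.
      by rewrite invf_div mulrA [K * 4]mulrC; exact: le_trans B5 BS.
    by apply: le_lt_trans rd4; rewrite ler_wpM2l// (le_trans lam).
  have crd : `|m21 g| < rd.
    by have /SL2_closeP := gr2; rewrite !oneSL2E !sub0r !normrN; case.
  have tcd := time_change_drift Gs tauC1 m0 mtau (near1_neq0 lam4).
  have -> : eps = eps / 2 + eps / 2 by field.
  (* With the exact shift [P u] the second orbit is at [ltri] times the first one; using [P L]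
     throughout the window moves it by a time of at most [rho]. *)
  have -> : u + P L = (P L - P u) + (u + P u) by ring.
  rewrite (time_changeD Gs ct m0 mtau).
  apply: le_lt_trans (dtri _ (T (u + P u) (act g x)) _) _; apply: ltrD; last exact: rhoP.
  by rewrite /P tcd; apply: rdP; exact: ltri_close.
- exact: le_trans n12 PM1.
Qed.

End Closeness.

Theorem proposition5p3 (R : realType) (Gam : set (SL2 R))
  (dG : SL2 R -> SL2 R -> R) (mu nu : probability (homspace Gam) R)
  (tau : homspace Gam -> R) :
  lattice Gam -> cocompact Gam ->
  right_invariant_metric dG ->
  SL2_invariant mu ->
  C1_homspace tau -> (forall x, 0 < tau x) ->
  time_change_measure tau mu nu ->
  strong_R (@quot_dist R dG Gam) nu (time_change tau).
Proof.
move=> [[Gs iG] _] Gc dGP inv tauC1 tau0 tcm.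
have ct : continuous tau by exact: (C1_homspace_continuous tauC1).
exists 1; split => //; first exact: (quot_dist_metric Gs dGP iG).
  exact: (time_change_ergodic Gs Gc dGP inv ct tau0 tcm).
move=> eps e0; have [kap kP H] := time_change_strong_R Gs Gc dGP iG inv tauC1 tau0 e0.
exists kap => // N; have [del del0 delP] := H N.
(* [Z] is the whole space, since the convergence of the horocycle averages is uniform in the
   starting point. *)
exists setT, del; split => //.
  by rewrite probability_setT lee_fin gerBl ltW.
by move=> x x' _ _; exact: delP.
Qed.
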